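(* Let $\mathbb X=\mathbb D$ (the open unit disk) or $\mathbb X=\mathbb T$ (the homogeneous tree). Let $u$ be a subharmonic function on $\mathbb X$ and consider the closed set $$E=\Bigl\{\xi\in\partial\mathbb X:\ \limsup_{\mathbb X\ni x\to\xi}u(x)=\infty\Bigr\},$$ assumed nonempty. Suppose that $\Psi:[0,\mathrm{diam}(\mathbb X)]\to[0,\infty]$ is a continuous, decreasing function with $$\Psi(t)=\infty\iff t=0\qquad\text{and}\qquad \lim_{t\to0}\Psi(t)=\infty,$$ and that $$u(x)\le\Psi\bigl(\mathrm{dist}(x,E)\bigr)\quad\text{for all }x\in\mathbb X.$$ If $$\int_{\partial\mathbb X}\Psi\bigl(\mathrm{dist}(\xi,E)\bigr)\,d\lambda(\xi)<\infty,$$ then $u$ has a finite harmonic majorant on $\mathbb X$, and its Riesz measure $\mu^u$ has finite first boundary moment, that is, $$\int_{\mathbb X}\mathrm{dist}(x,\partial\mathbb X)\,d\mu^u(x)<\infty.$$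
   Context: Two settings are treated simultaneously. Disk case $\mathbb X=\mathbb D=\{z\in\mathbb C:|z|<1\}$: $\partial\mathbb X=\mathbb S$ is the unit circle, $\mathrm{dist}(z,w)=|z-w|$, $\mathrm{diam}(\mathbb X)=2$, and $\lambda$ is normalized arc length measure on $\mathbb S$. A function $u:\mathbb D\to[-\infty,\infty)$ is subharmonic if it is upper semicontinuous, $\{u=-\infty\}$ has Lebesgue measure $0$, and $u(z)\le\frac1{2\pi}\int_0^{2\pi}u(z+re^{it})\,dt$ for all $z\in\mathbb D$, $0<r<1-|z|$. Its Riesz measure is the non-negative Radon measure $\mu^u=\frac1{2\pi}\Delta u$ on $\mathbb D$, with $\Delta=\partial_x^2+\partial_y^2$ in the sense of distributions. Harmonic has the usual meaning. Tree case $\mathbb X=\mathbb T$: $\mathbb T$ is (the vertex set of) the tree in which every vertex has $q+1$ neighbours, $q\ge2$ an integer, with a fixed root $o$. $\partial\mathbb T$ is the set of ends (equivalence classes of geodesic rays, two rays being equivalent if they differ only by finite initial pieces). For $z\in\mathbb T\cup\partial\mathbb T$, $|z|$ is the graph distance from $o$ to $z$ ($\infty$ if $z\in\partial\mathbb T$). For $w,z\in\mathbb T\cup\partial\mathbb T$, $w\wedge z$ is the last common element of the geodesics from $o$ to $w$ and from $o$ to $z$. The metric is $\mathrm{dist}(w,z)=q^{-|w\wedge z|}$ if $w\ne z$, and $0$ if $w=z$; thus $\mathrm{diam}(\mathbb X)=1$ and $\mathrm{dist}(x,\partial\mathbb T)=q^{-|x|}$ for $x\in\mathbb T$. Limits $x\to\xi$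 are with respect to this metric. $\lambda$ is the unique Borel probability measure on $\partial\mathbb T$ invariant under all graph automorphisms of $\mathbb T$ fixing $o$. Put $\Delta_{\mathbb T}f(x)=\frac1{q+1}\sum_{y\sim x}(f(y)-f(x))$. A function $u:\mathbb T\to\mathbb R$ is subharmonic if $\Delta_{\mathbb T}u\ge0$ and harmonic if $\Delta_{\mathbb T}u=0$. The Riesz measure $\mu^u$ of a subharmonic $u$ is the measure on $\mathbb T$ with atoms $\mu^u(x)=\Delta_{\mathbb T}u(x)$. In both cases, a harmonic majorant of $u$ is a real-valued harmonic function $h$ on $\mathbb X$ with $h\ge u$. ''Decreasing'' means non-increasing. $\mathrm{dist}(x,A)=\inf_{a\in A}\mathrm{dist}(x,a)$. *)

(* Defs.v *)
From HB Require Import structures.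
From mathcomp Require Import all_boot all_order all_algebra.
From mathcomp Require Import all_classical all_reals all_analysis.
From mathcomp Require Import measurable_realfun.

Set Implicit Arguments.
Unset Strict Implicit.
Unset Printing Implicit Defensive.

Import Order.TTheory GRing.Theory Num.Theory.
Import numFieldNormedType.Exports.

Local Open Scope classical_set_scope.
Local Open Scope ring_scope.

Definition dist_set (R : realType) (X : Type) (d : X -> X -> R) (x : X)
    (A : set X) : R :=
  inf [set d x a | a in A].

Record majorant_profile (R : realType) (diam : R) (Psi : R -> \bar R) : Prop := {
  profile_cont : {within `[0, diam], continuous Psi} ;
  profile_ge0 : forall t, 0 <= t <= diam -> (0 <= Psi t)%E ;
  profile_decr : forall s t, 0 <= s -> s <= t -> t <= diam -> (Psi t <= Psi s)%E ;
  profile_infty : forall t, 0 <= t <= diam -> (Psi t = +oo%E <-> t = 0) ;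
  profile_lim : Psi t @[t --> 0^'+] --> +oo%E }.

Section Disk.
Variable R : realType.

(* The complex plane is R * R. The library norm on R * R is the sup norm, which
   induces the right topology but not the distance used here. *)
Definition cdist (z w : R * R) : R :=
  Num.sqrt ((z.1 - w.1) ^+ 2 + (z.2 - w.2) ^+ 2).

Definition disk : set (R * R) := [set z | cdist z (0, 0) < 1].

Definition circle : set (R * R) := [set z | cdist z (0, 0) = 1].

Definition leb2 := (@lebesgue_measure R \x @lebesgue_measure R)%E.

(* The point z + r e^{it}. *)
Definition polar (z : R * R) (r t : R) : R * R :=
  (z.1 + r * cos t, z.2 + r * sin t).

Record disk_subharmonic (u : R * R -> \bar R) : Prop := {
  dsub_lty : forall z, disk z -> (u z < +oo)%E ;
  dsub_usc : forall z, disk z -> forall a : R, (u z < a%:E)%E ->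
    \forall w \near z, (u w < a%:E)%E ;
  dsub_null : leb2.-negligible (disk `&` [set z | u z = -oo%E]) ;
  dsub_mean : forall z r, disk z -> 0 < r < 1 - cdist z (0, 0) ->
    (u z <= (((2 * pi)^-1)%R)%:E *
       \int[lebesgue_measure]_(t in `[0%R, (2 * pi)%R]) u (polar z r t))%E }.

Definition e1 : R * R := (1, 0).
Definition e2 : R * R := (0, 1).

(* Continuous differentiability of order k on an open set U. *)
Fixpoint Ck_on (U : set (R * R)) (k : nat) (f : R * R -> R) : Prop :=
  if k is k'.+1 then
    [/\ forall z, U z -> {for z, continuous f},
        forall z, U z -> derivable f z e1 /\ derivable f z e2,
        Ck_on U k' (fun z => 'D_e1 f z) &
        Ck_on U k' (fun z => 'D_e2 f z)]
  else forall z, U z -> {for z, continuous f}.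

Definition laplacian (f : R * R -> R) (z : R * R) : R :=
  'D_e1 (fun w => 'D_e1 f w) z + 'D_e2 (fun w => 'D_e2 f w) z.

Definition disk_harmonic (h : R * R -> R) : Prop :=
  Ck_on disk 2 h /\ forall z, disk z -> laplacian h z = 0.

Definition disk_test (phi : R * R -> R) : Prop :=
  (forall k, Ck_on setT k phi) /\
  exists K : set (R * R), [/\ compact K, K `<=` disk &
    forall z, ~ K z -> phi z = 0].

(* mu = (2 pi)^-1 Delta u in the sense of distributions on the disk; only the
   restriction of mu to the disk is relevant. *)
Record disk_riesz (u : R * R -> \bar R)
    (mu : {measure set (measurableTypeR R * measurableTypeR R) -> \bar R})
    : Prop := {
  driesz_radon : forall K : set (R * R), compact K -> K `<=` disk ->
    (mu K < +oo)%E ;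
  driesz_distr : forall phi, disk_test phi ->
    (\int[mu]_(z in disk) (phi z)%:E =
     (((2 * pi)^-1)%R)%:E * \int[leb2]_(z in disk) (u z * (laplacian phi z)%:E))%E }.

Lemma two_pi_gt0 : 0 < 2 * pi :> R.
Proof. by rewrite mulr_gt0// pi_gt0. Qed.

Definition circle_param (t : measurableTypeR R) :
  measurableTypeR R * measurableTypeR R := (cos t, sin t).

Lemma measurable_circle_param : measurable_fun setT circle_param.
Proof.
apply: measurable_fun_pair => /=.
  exact: (@continuous_measurable_fun _ _ (@continuous_cos R)).
exact: (@continuous_measurable_fun _ _ (@continuous_sin R)).
Qed.

HB.instance Definition _ :=
  @isMeasurableFun.Build _ _ _ _ circle_param measurable_circle_param.

(* Normalized arc length, as the law of e^{it} for t uniform on [0, 2 pi]. *)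
Definition arc_measure := distribution (uniform_prob two_pi_gt0) circle_param.

Definition disk_blowup (u : R * R -> \bar R) : set (R * R) :=
  [set xi | circle xi /\ limf_esup u (within disk (nbhs xi)) = +oo%E].

End Disk.

(* A tree in which every vertex has tree_q + 1 neighbours, as a connected graph
   without cycles; ucycle also holds of the two ends of an edge, hence the
   bound 2. *)
Record homTree := HomTree {
  vertex :> choiceType ;
  tree_q : nat ;
  tree_root : vertex ;
  nbr : vertex -> seq vertex ;
  tree_q_ge2 : (2 <= tree_q)%N ;
  nbr_uniq : forall x, uniq (nbr x) ;
  nbr_size : forall x, size (nbr x) = tree_q.+1 ;
  nbr_sym : forall x y, (y \in nbr x) = (x \in nbr y) ;
  nbr_irr : forall x, x \notin nbr x ;
  tree_connected : forall x y, exists2 p, path (grel nbr) x p & last x p = y ;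
  tree_acyclic : forall c, ucycle (grel nbr) c -> (size c <= 2)%N }.

Section Tree.
Variable T : homTree.

Definition tadj : rel T := grel (@nbr T).

Definition shortest_path (x y : T) (p : seq T) : Prop :=
  [/\ path tadj x p, last x p = y &
      forall p', path tadj x p' -> last x p' = y -> (size p <= size p')%N].

(* The vertices after x on the geodesic from x to y. *)
Definition geod (x y : T) : seq T := xget [::] (shortest_path x y).

Definition gdist (x y : T) : nat := size (geod x y).

Definition geodesic_ray (r : nat -> T) : Prop :=
  forall m n, (m <= n)%N -> gdist (r m) (r n) = (n - m)%N.

Definition ray_equiv (r s : nat -> T) : Prop :=
  exists m n, forall k, r (m + k)%N = s (n + k)%N.

Definition is_end (C : set (nat -> T)) : Prop :=
  exists2 r, geodesic_ray r &
    C = [set s | geodesic_ray s /\ ray_equiv r s].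

Definition tree_end : Type := set_type is_end.

HB.instance Definition _ := Choice.on tree_end.

Lemma geodP x y : shortest_path x y (geod x y).
Proof.
rewrite /geod; case: xgetP => [p _ //|noP].
have ex : exists n, `[< exists p, [/\ path tadj x p, last x p = y & size p = n] >].
  have [p pp pl] := tree_connected x y.
  by exists (size p); apply/asboolP; exists p.
have [n /asboolP[p [pp pl ps]] nmin] := ex_minnP ex.
exfalso; apply: (noP p); split => // p' pp' pl'.
by rewrite ps; apply: nmin; apply/asboolP; exists p'.
Qed.

Lemma gdist_le x y p : path tadj x p -> last x p = y -> (gdist x y <= size p)%N.
Proof. by have [_ _] := geodP x y; exact. Qed.

Lemma tadj_sym : symmetric tadj.
Proof. by move=> x y; rewrite /tadj/= nbr_sym. Qed.

Lemma gdist_triangle x y z : (gdist x z <= gdist x y + gdist y z)%N.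
Proof.
have [pxy lxy _] := geodP x y; have [pyz lyz _] := geodP y z.
rewrite /gdist -size_cat; apply: gdist_le.
  by rewrite cat_path pxy lxy.
by rewrite last_cat lxy.
Qed.

Lemma gdist_refl x : gdist x x = 0%N.
Proof. by apply/eqP; rewrite -leqn0; exact: (@gdist_le x x [::]). Qed.

Lemma gdist_adj x y : tadj x y -> (gdist x y <= 1)%N.
Proof. by move=> xy; apply: (@gdist_le x y [:: y]) => //=; rewrite xy. Qed.

Lemma geod_avoid (o x y : T) : y != x -> (gdist o y <= gdist o x)%N ->
  x \notin geod o y.
Proof.
move=> yx le; apply/negP => xin.
have [pp pl pm] := geodP o y.
have [p1 [p2 E]] : exists p1 p2, geod o y = p1 ++ x :: p2.
  by case/splitPr: xin => p1 p2; exists p1, p2.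
have := pp; rewrite E -cat_rcons cat_path => /andP[pp1 _].
have := gdist_le pp1 (last_rcons _ _ _).
move: le; rewrite /gdist E size_cat/= size_rcons => le1 le2.
have := leq_trans le1 le2; rewrite addnS ltnS -{2}(addn0 (size p1)) leq_add2l.
rewrite leqn0 size_eq0 => /eqP p20; move: pl yx.
by rewrite E p20 cats1 last_rcons => ->; rewrite eqxx.
Qed.

Lemma up_neighbour (o x : T) :
  exists2 y, tadj x y & gdist o y = (gdist o x).+1.
Proof.
have step y : tadj x y -> (gdist o y <= (gdist o x).+1)%N.
  move=> xy; apply: leq_trans (gdist_triangle o x y) _.
  by rewrite -addn1 leq_add2l gdist_adj.
case: (boolP (has (fun y => gdist o x < gdist o y)%N (nbr x))) => [/hasP[y yx lt]|].
  by exists y => //; apply/eqP; rewrite eqn_leq lt step.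
rewrite -all_predC => /allP low.
have := nbr_size x; have := nbr_uniq x; have := tree_q_ge2 T.
case E: (nbr x) => [//|y [|z s]] /=; first by move=> + _ [q0]; rewrite -q0.
move=> _ /andP[]; rewrite inE negb_or => /andP[yz _] _ _.
have yx : tadj x y by rewrite /tadj/= E mem_head.
have zx : tadj x z by rewrite /tadj/= E !inE eqxx orbT.
have neq v : tadj x v -> v != x.
  by apply: contraTneq => ->; rewrite /tadj/= (negbTE (nbr_irr x)).
have av v : tadj x v -> x \notin geod o v.
  move=> xv; apply: geod_avoid; first exact: neq.
  by have := low v xv; rewrite /= -leqNgt.
have o_eq v : gdist o v = 0%N -> v = o.
  by have [_ + _] := geodP o v; rewrite /gdist; case: (geod o v).
have xo : x != o.
  apply/eqP => xo; have := low y; rewrite E mem_head => /(_ isT).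
  rewrite /= xo gdist_refl -leqNgt leqn0 => /eqP/o_eq yo.
  by have := neq y yx; rewrite xo yo eqxx.
have {av} av v : tadj x v -> x \notin o :: geod o v.
  by move=> xv; rewrite inE negb_or xo av.
have [py ly _] := geodP o y; have [pz lz _] := geodP o z.
pose p := rev (belast o (geod o y)) ++ geod o z.
have lr : last y (rev (belast o (geod o y))) = o.
  by rewrite -{1}ly; case: (geod o y) => //= a s'; rewrite rev_cons last_rcons.
have pp : path tadj y p.
  rewrite cat_path lr pz andbT -{1}ly rev_path.
  by under eq_path do rewrite tadj_sym.
have pl : last y p = z by rewrite last_cat lr.
have xp : x \notin y :: p.
  rewrite inE negb_or eq_sym neq//= mem_cat negb_or mem_rev.
  have := av z zx; rewrite inE negb_or => /andP[_ ->]; rewrite andbT.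
  by apply: contra (av y yx) => /mem_belast.
case/shortenP: pp pl => p' pp' up' sp' pl'.
have : (size [:: x, y & p'] <= 2)%N.
  apply: (@tree_acyclic T); apply/andP; split.
    rewrite -[cycle _ _]/(tadj x y && path tadj y (rcons p' x)).
    by rewrite yx rcons_path pp' pl' tadj_sym.
  rewrite cons_uniq up' andbT.
  apply: contra xp; rewrite !inE => /orP[->//|/sp' ->]; by rewrite orbT.
case: p' {pp' up' sp'} pl' => // pl' _.
by move: yz; rewrite -pl' /= eqxx.
Qed.

Lemma geodesic_ray_ex (o : T) : exists2 r : nat -> T, geodesic_ray r & r 0 = o.
Proof.
have up x : exists y, tadj x y /\ gdist o y = (gdist o x).+1.
  by have [y xy yd] := up_neighbour o x; exists y.
have [f fP] := choice up.
exists (fun n => iter n f o) => //.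
have lev n : gdist o (iter n f o) = n.
  by elim: n => [|n IH]/=; rewrite ?gdist_refl// (fP _).2 IH.
move=> m n mn; apply/eqP; rewrite eqn_leq; apply/andP; split; last first.
  by rewrite leq_subLR -{1}(lev n) -{1}(lev m) gdist_triangle.
rewrite -{1}(subnKC mn); elim: (n - m)%N => [|k IH]; first by rewrite addn0 gdist_refl.
apply: leq_trans (gdist_triangle _ (iter (m + k) f o) _) _.
rewrite addnS -[k.+1]addn1; apply: leq_add => //.
exact: gdist_adj (fP _).1.
Qed.

Lemma tree_end_ex : exists _ : tree_end, True.
Proof.
have [r rr _] := geodesic_ray_ex (tree_root T).
have H : is_end [set s | geodesic_ray s /\ ray_equiv r s] by exists r.
by exists (SigSub (mem_set H)).
Qed.

HB.instance Definition _ := isPointed.Build tree_end (projT1 (cid tree_end_ex)).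

Definition tree_point : Type := T.

HB.instance Definition _ := Choice.on tree_point.
HB.instance Definition _ := isPointed.Build tree_point (tree_root T).

(* The tree together with its boundary. *)
Definition tree_bar : Type := (T + tree_end)%type.

Definition tlevel (x : T) : nat := gdist (tree_root T) x.

(* The vertices of the geodesic from the root to z. *)
Definition root_geodesic (z : tree_bar) : set T :=
  match z with
  | inl x => [set` tree_root T :: geod (tree_root T) x]
  | inr xi => [set x | exists2 r, (val xi : set (nat -> T)) r &
                       r 0 = tree_root T /\ exists n, r n = x]
  end.

(* The last common vertex; a junk value if w and z are the same end. *)
Definition confluent (w z : tree_bar) : T :=
  let common := root_geodesic w `&` root_geodesic z in
  xget (tree_root T) [set x | common x /\
                         forall y, common y -> (tlevel y <= tlevel x)%N].

Definition tree_aut (g : T -> T) : Prop :=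
  bijective g /\ forall x y, tadj (g x) (g y) = tadj x y.

Section RealValued.
Variable R : realType.

Definition tdist (w z : tree_bar) : R :=
  if `[< w = z >] then 0 else (tree_q T)%:R ^- tlevel (confluent w z).

Definition end_open (U : set tree_end) : Prop :=
  forall xi, U xi -> exists2 e : R, 0 < e &
    forall eta, tdist (inr xi) (inr eta) < e -> U eta.

Definition borel_end : Type := g_sigma_algebraType end_open.

(* An automorphism g acts on ends by composing rays with g; the set measured on
   the left is the preimage of A under this action. *)
Definition aut_invariant (lam : set borel_end -> \bar R) : Prop :=
  forall g, tree_aut g -> g (tree_root T) = tree_root T ->
  forall A : set borel_end, measurable A ->
    lam [set xi : borel_end | exists2 eta : borel_end, A eta &
      val (eta : tree_end) = [set g \o r | r in val (xi : tree_end)]] = lam A.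

Definition tree_laplacian (f : T -> R) (x : T) : R :=
  (tree_q T).+1%:R^-1 * \sum_(y <- nbr x) (f y - f x).

Definition tree_subharmonic (u : T -> R) : Prop :=
  forall x, 0 <= tree_laplacian u x.

Definition tree_harmonic (h : T -> R) : Prop :=
  forall x, tree_laplacian h x = 0.

(* The vertex set with the sigma-algebra of all its subsets. *)
Definition discrete_tree : Type := g_sigma_algebraType (@setT (set tree_point)).

Definition tree_riesz (u : T -> R)
    (mu : set discrete_tree -> \bar R) : Prop :=
  forall x : T, mu [set (x : discrete_tree)] = (tree_laplacian u x)%:E.

Definition tree_limsup (u : T -> R) (xi : tree_end) : \bar R :=
  ereal_inf [set ereal_sup
      [set (u x)%:E | x in [set x : T | tdist (inl x) (inr xi) < e]]
    | e in [set e : R | 0 < e]].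

Definition tree_blowup (u : T -> R) : set tree_end :=
  [set xi | tree_limsup u xi = +oo%E].

End RealValued.

HB.instance Definition _ (R : realType) := Measurable.on (borel_end R).
HB.instance Definition _ := Measurable.on discrete_tree.

End Tree.

(* Main.v *)
(** The majorant is, up to constants, the Poisson integral of the boundary function
    [Psi (dist xi E)].  For [x] in the disk close to [E] there is a boundary arc, of
    length and distance to [x] comparable to [1 - |x|], whose points are not farther
    from [E] than [x]; there [Psi (dist xi E) >= Psi (dist x E) >= u x] and the
    Poisson kernel is at least [c / (1 - |x|)].  On the tree the ends below a vertex
    [x] play the role of the arc, and their measure is forced by the automorphisms
    exchanging two subtrees rooted at siblings.

    For the moment, let [h] be the majorant.  On the disk, Green's formula for [h]
    compares the Riesz measure with [u - h] through test functions increasing to a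
    function comparable to [1 - |z|], whose Laplacian is at least [- C] on
    [|z|^2 <= 1/2] and nonnegative elsewhere.  Their integrals are bounded by [C]
    times the integral of [h - u] over [|z|^2 <= 1/2], where [u] is integrable
    because its pairing with the Laplacian of a test function is finite.  On the
    tree, summation by parts over the spheres around the root bounds the weighted
    sums of [tree_laplacian u] by a multiple of [h - u] at the root. *)

Require Import Defs.
From mathcomp Require Import all_boot all_order all_algebra.
From mathcomp Require Import all_classical all_reals all_analysis.
From mathcomp Require Import measurable_realfun ring lra.

Set Implicit Arguments.
Unset Strict Implicit.
Unset Printing Implicit Defensive.

Import Order.TTheory GRing.Theory Num.Theory.
Import numFieldNormedType.Exports.

Local Open Scope classical_set_scope.
Local Open Scope ring_scope.

(** * Smooth kernels on the disk *)

(** Harmonicity is pointwise, with two continuous derivatives, so the disk majorant has to be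
    differentiated under the integral sign. A class of kernels stable under sums, products and
    partial derivatives reduces this to algebra with the Poisson kernel. Away from the blow-up set a
    constant suffices as majorant, and it is absorbed into the same kernel integral.

    For the moment, [1 - |z|^2] would be the natural weight, but its Laplacian is negative
    everywhere, whereas the inequality [u <= h] survives multiplication only by nonnegative
    quantities. Applying the convex function [exp (2 x) - 1] to it gives a weight that is
    subharmonic for [|z|^2 >= 1/2], at the price of a bounded error on a compact core. A smooth,
    convex, nondecreasing ramp then cuts the weight off near the circle: it produces compact
    support, and convexity preserves the sign of the Laplacian. On the tree the weight [q^-|x|] is
    itself harmonic off the root, so only its truncation has to be dealt with. *)

Lemma open_measurable_plane (R : realType) (U : set (R * R)) :
  open U -> measurable (U : set (measurableTypeR R * measurableTypeR R)).
Proof.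
move=> oU.
(* The sigma-algebra is the product one, so [U] is written as a countable union of rational boxes; a
   box not inside [U] is replaced by [set0], which keeps the index type countable. *)
pose box (q : rat * rat * (rat * rat)) : set (R * R) :=
  `]ratr q.1.1, ratr q.1.2[%classic `*` `]ratr q.2.1, ratr q.2.2[%classic.
pose F (q : rat * rat * (rat * rat)) : set (measurableTypeR R * measurableTypeR R) :=
  if `[< box q `<=` U >] then box q else set0.
have -> : U = \bigcup_q F q.
  apply/seteqP; split => [z Uz|z [q _]]; last first.
    by rewrite /F; case: asboolP => // + zq; exact.
  have := oU; rewrite openE => /(_ z Uz) /nbhs_ballP[e /= e0 eU].
  have [a ha] : exists a : rat, ratr a \in `]z.1 - e, z.1[.
    by apply: rat_in_itvoo; rewrite ltrBlDr ltrDl.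
  have [b hb] : exists a : rat, ratr a \in `]z.1, z.1 + e[.
    by apply: rat_in_itvoo; rewrite ltrDl.
  have [c hc] : exists a : rat, ratr a \in `]z.2 - e, z.2[.
    by apply: rat_in_itvoo; rewrite ltrBlDr ltrDl.
  have [d hd] : exists a : rat, ratr a \in `]z.2, z.2 + e[.
    by apply: rat_in_itvoo; rewrite ltrDl.
  move: ha hb hc hd; rewrite !in_itv/= => /andP[a1 a2] /andP[b1 b2] /andP[c1 c2] /andP[d1 d2].
  have bU : box (a, b, (c, d)) `<=` U.
    move=> w [] /=; rewrite !in_itv/= => /andP[w1 w2] /andP[w3 w4].
    apply: eU; split; rewrite /= /ball/= ltr_norml; apply/andP; split; lra.
  exists (a, b, (c, d)) => //; rewrite /F; case: asboolP => // _.
  by split; rewrite /= in_itv/= ?a2 ?b1 ?c2 ?d1.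
apply: countable_bigcupT_measurable => // q; rewrite /F.
by case: asboolP => _ //; apply: measurableX; exact: measurable_itv.
Qed.

Lemma measurable_fun_cts_plane (R : realType) (D : set (R * R)) (f : R * R -> R) :
  open D -> (forall z, D z -> {for z, continuous f}) ->
  measurable_fun (D : set (measurableTypeR R * measurableTypeR R)) f.
Proof.
move=> oD cf; apply: (measurability _ (RGenOpens.measurableE R)).
move=> _ [_ [a [b ->] <-]].
apply: open_measurable_plane; rewrite openE => z [Dz fz].
apply: filterI; first by move: oD; rewrite openE; exact.
by apply: (cf z Dz); apply: open_nbhs_nbhs; split => //; exact: itv_open.

Qed.

Lemma cdist_ge0 (R : realType) (z w : R * R) : 0 <= cdist z w.
Proof. exact: sqrtr_ge0. Qed.

Lemma cdist_sqr (R : realType) (z w : R * R) :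
  cdist z w ^+ 2 = (z.1 - w.1) ^+ 2 + (z.2 - w.2) ^+ 2.
Proof. by rewrite sqr_sqrtr// addr_ge0 ?sqr_ge0. Qed.

Lemma cdistC (R : realType) (z w : R * R) : cdist z w = cdist w z.
Proof. by rewrite /cdist -sqrrN opprB -[X in _ + X]sqrrN opprB. Qed.

Lemma cdist_triangle (R : realType) (x y z : R * R) :
  cdist x z <= cdist x y + cdist y z.
Proof.
set a := cdist x y; set b := cdist y z.
have a0 : 0 <= a := cdist_ge0 _ _; have b0 : 0 <= b := cdist_ge0 _ _.
rewrite -(@ler_pXn2r _ 2) ?nnegrE ?addr_ge0 ?cdist_ge0//.
have a2 : a ^+ 2 = _ := cdist_sqr x y; have b2 : b ^+ 2 = _ := cdist_sqr y z.
rewrite sqrrD a2 b2 cdist_sqr.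
set p := x.1 - y.1; set q := x.2 - y.2; set r := y.1 - z.1; set s := y.2 - z.2.
have -> : x.1 - z.1 = p + r by rewrite /p/r; ring.
have -> : x.2 - z.2 = q + s by rewrite /q/s; ring.
(* Cauchy-Schwarz for the two difference vectors; after squaring, the defect is
   [(p * s - q * r) ^+ 2]. *)
suff : p * r + q * s <= a * b by move=> h; rewrite mulr2n; nra.
have [lt0|ge0] := ltP (p * r + q * s) 0; first by rewrite (le_trans (ltW lt0))// mulr_ge0.
rewrite -(@ler_pXn2r _ 2) ?nnegrE ?mulr_ge0// exprMn a2 b2 -/p -/q -/r -/s.
have : 0 <= (p * s - q * r) ^+ 2 by apply: sqr_ge0.
nra.
Qed.

Lemma cdist_le_sum (R : realType) (z w : R * R) :
  cdist z w <= `|z.1 - w.1| + `|z.2 - w.2|.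
Proof.
rewrite -(@ler_pXn2r _ 2) ?nnegrE ?addr_ge0 ?cdist_ge0// cdist_sqr [leRHS]sqrrD.
by rewrite !real_normK ?num_real// lerD2r lerDl mulrn_wge0// mulr_ge0.
Qed.

Lemma cdist_ge1 (R : realType) (z w : R * R) : `|z.1 - w.1| <= cdist z w.
Proof.
rewrite -(@ler_pXn2r _ 2) ?nnegrE ?cdist_ge0// cdist_sqr.
by rewrite real_normK ?num_real// lerDl sqr_ge0.
Qed.

Lemma cdist_ge2 (R : realType) (z w : R * R) : `|z.2 - w.2| <= cdist z w.
Proof.
rewrite -(@ler_pXn2r _ 2) ?nnegrE ?cdist_ge0// cdist_sqr.
by rewrite real_normK ?num_real// lerDr sqr_ge0.
Qed.

Lemma cdist_continuous (R : realType) (w : R * R) : continuous (fun z => cdist z w).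
Proof.
move=> z; apply/cvgrPdist_le => e e0; near=> y.
have yz : cdist y z <= e.
  rewrite (le_trans (cdist_le_sum y z))// (splitr e); apply: lerD; near: y.
    have h : (fun y : R * R => y.1) @ z --> z.1 by exact: cvg_fst.
    move/cvgrPdist_le : h => /(_ (e/2)); rewrite divr_gt0// => /(_ isT).
    by apply: filterS => y; rewrite distrC.
  have h : (fun y : R * R => y.2) @ z --> z.2 by exact: cvg_snd.
  move/cvgrPdist_le : h => /(_ (e/2)); rewrite divr_gt0// => /(_ isT).
  by apply: filterS => y; rewrite distrC.
have := cdist_triangle z y w; have := cdist_triangle y z w.
by rewrite (cdistC z y) ler_distl => *; apply/andP; split; lra.
Unshelve. all: by end_near. Qed.

Lemma disk_open (R : realType) : open (@disk R).
Proof.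
rewrite (_ : @disk R = (fun z : R * R => cdist z (0, 0)) @^-1` [set x | x < 1])//.
apply: open_comp; last exact: open_lt.
by move=> z _; exact: cdist_continuous.
Qed.

Lemma closed_disk_compact (R : realType) (r : R) :
  compact [set z : R * R | cdist z (0, 0) <= r].
Proof.
have cK : compact (`[-r, r]%classic `*` `[-r, r]%classic : set (R * R)).
  by apply: compact_setX; exact: segment_compact.
apply: (subclosed_compact _ cK).
  rewrite (_ : mkset _ = (fun z : R * R => cdist z (0, 0)) @^-1` [set x | x <= r])//.
  apply: closed_comp; last exact: closed_le.
  by move=> z _; exact: cdist_continuous.
move=> z /= zr; split; rewrite /= in_itv/= -ler_norml.
  by have := cdist_ge1 z (0, 0); rewrite /= subr0 => /le_trans; exact.
by have := cdist_ge2 z (0, 0); rewrite /= subr0 => /le_trans; exact.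
Qed.

(** Gives access to one-variable calculus: the chain rule and differentiation under the integral are
    both carried out along this line. *)
Lemma is_derive_line (R : realType) (f : R * R -> R) (z v : R * R) (l : R) :
  is_derive z v f l <-> is_derive (0 : R) (1 : R) (fun t : R => f (t *: v + z)) l.
Proof.
have E : 'D_v f z = 'D_1 (fun t : R => f (t *: v + z)) 0.
  rewrite /derive; set g1 := fun h => h^-1 *: _; set g2 := fun h => h^-1 *: _.
  suff -> : g1 = g2 by [].
  apply/funext => h; rewrite /g1 /g2 /=.
  by rewrite scale0r add0r addr0 scaler1.
by split => [[df <-]|[df <-]]; [rewrite E|rewrite -E]; apply: derivableP;
  [exact: (derivable1P _ _ _).1 | exact: (derivable1P _ _ _).2].
Qed.

Lemma shift_e1 (R : realType) (h : R) (z : R * R) :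
  h *: e1 R + z = (h *: 1 + z.1, z.2).
Proof. by congr pair; rewrite /= scaler0 add0r. Qed.

Lemma shift_e2 (R : realType) (h : R) (z : R * R) :
  h *: e2 R + z = (z.1, h *: 1 + z.2).
Proof. by congr pair; rewrite /= scaler0 add0r. Qed.

Lemma is_derive_e1 (R : realType) (f : R * R -> R) (z : R * R) (l : R) :
  is_derive z (e1 R) f l <-> is_derive z.1 1 (fun x => f (x, z.2)) l.
Proof.
have E : 'D_(e1 R) f z = 'D_1 (fun x => f (x, z.2)) z.1.
  rewrite /derive; set g1 := fun h => h^-1 *: _; set g2 := fun h => h^-1 *: _.
  suff -> : g1 = g2 by [].
  apply/funext => h; rewrite /g1 /g2 /=.
  by rewrite shift_e1 -surjective_pairing.
have E' : derivable f z (e1 R) <-> derivable (fun x => f (x, z.2)) z.1 1.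
  rewrite /derivable; set g1 := fun h => h^-1 *: _; set g2 := fun h => h^-1 *: _.
  suff -> : g1 = g2 by [].
  apply/funext => h; rewrite /g1 /g2 /=.
  by rewrite shift_e1 -surjective_pairing.
by split => [[/E' df <-]|[/E' df <-]]; [rewrite E|rewrite -E]; exact: derivableP.
Qed.

Lemma is_derive_e2 (R : realType) (f : R * R -> R) (z : R * R) (l : R) :
  is_derive z (e2 R) f l <-> is_derive z.2 1 (fun y => f (z.1, y)) l.
Proof.
have E : 'D_(e2 R) f z = 'D_1 (fun y => f (z.1, y)) z.2.
  rewrite /derive; set g1 := fun h => h^-1 *: _; set g2 := fun h => h^-1 *: _.
  suff -> : g1 = g2 by [].
  apply/funext => h; rewrite /g1 /g2 /=.
  by rewrite shift_e2 -surjective_pairing.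
have E' : derivable f z (e2 R) <-> derivable (fun y => f (z.1, y)) z.2 1.
  rewrite /derivable; set g1 := fun h => h^-1 *: _; set g2 := fun h => h^-1 *: _.
  suff -> : g1 = g2 by [].
  apply/funext => h; rewrite /g1 /g2 /=.
  by rewrite shift_e2 -surjective_pairing.
by split => [[/E' df <-]|[/E' df <-]]; [rewrite E|rewrite -E]; exact: derivableP.
Qed.

Lemma is_derive_comp1 (R : realType) (f : R -> R) (g : R * R -> R) (z v : R * R) (a b : R) :
  is_derive (g z) 1 f a -> is_derive z v g b -> is_derive z v (f \o g) (a * b).
Proof.
move=> df /is_derive_line dg; apply/is_derive_line.
apply: (@is_derive1_comp _ f (fun t : R => g (t *: v + z))) => //.
by rewrite scale0r add0r.
Qed.

Lemma is_derive_lineS (R : realType) (f : R * R -> R) (z v : R * R) (s l : R) :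
  is_derive (s *: v + z) v f l -> is_derive s (1 : R) (fun t : R => f (t *: v + z)) l.
Proof.
move=> /is_derive_line d.
have -> : (fun t : R => f (t *: v + z)) =
    (fun t : R => f (t *: v + (s *: v + z))) \o (fun t => t - s).
  by apply/funext => t /=; rewrite addrA -scalerDl subrK.
rewrite -[l]mulr1; apply: is_derive1_comp; first by rewrite subrr.
by apply: is_derive_eq; rewrite subr0.
Qed.

Lemma le_norm_bounded_derive (R : realType) (f df : R -> R) (M a b r : R) :
  `|b - a| <= r ->
  (forall x, `|x - a| <= r -> is_derive x 1 f (df x) /\ `|df x| <= M) ->
  `|f b - f a| <= M * `|b - a|.
Proof.
move=> bar H.
have r0 : 0 <= r by rewrite (le_trans _ bar).
have key c d : c <= d -> `|c - a| <= r -> `|d - a| <= r ->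
    `|f d - f c| <= M * `|d - c|.
  move=> cd hc hd.
  have /andP[c1 c2] : - r <= c - a <= r by rewrite -ler_norml.
  have /andP[d1 d2] : - r <= d - a <= r by rewrite -ler_norml.
  have inr x : c <= x <= d -> `|x - a| <= r.
    by move=> /andP[*]; rewrite ler_norml; apply/andP; split; lra.
  have [||y] := @MVT_segment _ f df c d cd.
  - by move=> x; rewrite in_itv/= => /andP[/ltW ? /ltW ?]; apply: (H _ _).1; apply: inr; apply/andP.
  - apply: derivable_within_continuous => x; rewrite in_itv/= => /inr /H[+ _].
    by case.
  - rewrite in_itv/= => /inr /H[_ yM] ->. by rewrite normrM ler_wpM2r.
have [ab|/ltW ba] := leP a b; first by apply: key; rewrite ?subrr ?normr0.
by rewrite distrC [`|b - a|]distrC; apply: key; rewrite ?subrr ?normr0.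
Qed.

(** Existence of partial derivatives alone does not give continuity. When they are locally bounded,
    going from [z] to [w] along one axis and then the other, the mean value theorem yields a local
    Lipschitz bound. *)
Lemma continuous_bounded_partials (R : realType) (U : set (R * R)) (f g1 g2 : R * R -> R) :
  open U ->
  (forall z, U z -> is_derive z (e1 R) f (g1 z) /\ is_derive z (e2 R) f (g2 z)) ->
  (forall z, U z -> exists M, \forall w \near z, `|g1 w| <= M /\ `|g2 w| <= M) ->
  forall z, U z -> {for z, continuous f}.
Proof.
move=> oU df bg z Uz.
have [M hM] := bg z Uz.
have /nbhs_ballP[r /= r0 rU] : nbhs z [set w | U w /\ `|g1 w| <= M /\ `|g2 w| <= M].
  by apply: filterI => //; move: oU; rewrite openE; exact.
have M0 : 0 <= M.
  by have [_ [+ _]] := rU z (ballxx _ r0); apply: le_trans.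
have lip w : `|w.1 - z.1| <= r / 2 -> `|w.2 - z.2| <= r / 2 ->
    `|f w - f z| <= M * (`|w.1 - z.1| + `|w.2 - z.2|).
  move=> w1 w2.
  have inb x y : `|x - z.1| <= r / 2 -> `|y - z.2| <= r / 2 -> ball z r (x, y).
    move=> hx hy; split; rewrite /= /ball/= distrC.
      by apply: (le_lt_trans hx); lra.
    by apply: (le_lt_trans hy); lra.
  have -> : f w - f z = (f (w.1, w.2) - f (z.1, w.2)) + (f (z.1, w.2) - f (z.1, z.2)).
    by rewrite addrA subrK -!surjective_pairing.
  rewrite (le_trans (ler_normD _ _))// mulrDr lerD//.
    apply: (@le_norm_bounded_derive _ (fun x => f (x, w.2)) (fun x => g1 (x, w.2)) _ _ _ (r / 2)) => // x hx.
    have [Ux [hM1 _]] := rU _ (inb x w.2 hx w2); split => //.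
    exact/(is_derive_e1 f (x, w.2))/(df _ Ux).1.
  apply: (@le_norm_bounded_derive _ (fun y => f (z.1, y)) (fun y => g2 (z.1, y)) _ _ _ (r / 2)) => // y hy.
  have z1 : `|z.1 - z.1| <= r / 2 by rewrite subrr normr0; lra.
  have [Uy [_ hM2]] := rU _ (inb z.1 y z1 hy); split => //.
  exact/(is_derive_e2 f (z.1, y))/(df _ Uy).2.
have c1 : (fun y : R * R => y.1) @ z --> z.1 by exact: cvg_fst.
have c2 : (fun y : R * R => y.2) @ z --> z.2 by exact: cvg_snd.
apply/cvgrPdist_le => e e0; near=> w.
have w1 : `|w.1 - z.1| <= Num.min (r / 2) (e / (2 * (M + 1))).
  rewrite distrC; near: w; move/cvgrPdist_le : c1; apply.
  by rewrite lt_min !divr_gt0// mulr_gt0// ltr_wpDl.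
have w2 : `|w.2 - z.2| <= Num.min (r / 2) (e / (2 * (M + 1))).
  rewrite distrC; near: w; move/cvgrPdist_le : c2; apply.
  by rewrite lt_min !divr_gt0// mulr_gt0// ltr_wpDl.
move: w1 w2; rewrite !le_min => /andP[a1 b1] /andP[a2 b2].
rewrite distrC (le_trans (lip w a1 a2))//.
have M1 : 0 < M + 1 by rewrite ltr_wpDl.
rewrite (@le_trans _ _ ((M + 1) * (e / (2 * (M + 1)) + e / (2 * (M + 1)))))//.
  rewrite ler_pM ?addr_ge0// ?lerDl// lerD//.
rewrite le_eqVlt; apply/orP; left; apply/eqP; field.
by rewrite gt_eqF.
Unshelve. all: by end_near. Qed.

Section SmoothKernel.
Variable R : realType.
Implicit Types (K L : R * R -> R -> R) (z : R * R) (t : R).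

(** The bound is uniform in [t] on each smaller disk; it supplies the dominating function for
    differentiation under the integral. *)
Definition bounded_kernel K : Prop :=
  (forall rho, rho < 1 -> exists M, forall z t, cdist z (0, 0) <= rho -> `|K z t| <= M) /\
  (forall z, disk z -> measurable_fun (setT : set (measurableTypeR R)) (K z)).

(** Derivatives are carried as explicit witnesses and required only inside the disk, so that closure
    under sums and products is a plain induction on [k]. *)
Fixpoint smooth_kernel k K : Prop :=
  bounded_kernel K /\
  if k is k'.+1 then exists K1 K2,
    [/\ forall z t, disk z -> is_derive z (e1 R) (K^~ t) (K1 z t),
        forall z t, disk z -> is_derive z (e2 R) (K^~ t) (K2 z t),
        smooth_kernel k' K1 & smooth_kernel k' K2]
  else True.

Lemma smooth_kernelW k K : smooth_kernel k.+1 K -> smooth_kernel k K.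
Proof.
elim: k K => [K [+ _]|k IH K [bK [K1 [K2 [d1 d2 s1 s2]]]]]; first by split.
by split => //; exists K1, K2; split => //; exact: IH.
Qed.

Lemma smooth_kernel_bounded k K : smooth_kernel k K -> bounded_kernel K.
Proof. by case: k => [|k] []. Qed.

Lemma smooth_kernel_cst k (c : R -> R) (M : R) :
  measurable_fun (setT : set (measurableTypeR R)) c -> (forall t, `|c t| <= M) -> smooth_kernel k (fun _ t => c t).
Proof.
elim: k c M => [|k IH] c M mc cM.
  by split => //; split => // rho _; exists M.
split; first by split => // rho _; exists M.
exists (fun _ _ => 0), (fun _ _ => 0); split.
- by move=> z t _; exact: is_derive_cst.
- by move=> z t _; exact: is_derive_cst.
- by apply: (IH _ 0) => // t; rewrite normr0.
- by apply: (IH _ 0) => // t; rewrite normr0.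
Qed.

Lemma smooth_kernelD k K L :
  smooth_kernel k K -> smooth_kernel k L -> smooth_kernel k (fun z t => K z t + L z t).
Proof.
have bD K' L' : bounded_kernel K' -> bounded_kernel L' -> bounded_kernel (fun z t => K' z t + L' z t).
  move=> [bK mK] [bL mL]; split => [rho r1|z Dz]; last first.
    by apply: measurable_funD; [exact: mK|exact: mL].
  have [M hM] := bK rho r1; have [N hN] := bL rho r1.
  exists (M + N) => z t zr; rewrite (le_trans (ler_normD _ _))// lerD//.
    exact: hM.
  exact: hN.
elim: k K L => [|k IH] K L.
  by move=> [bK _] [bL _]; split => //; exact: bD.
move=> [bK [K1 [K2 [dK1 dK2 sK1 sK2]]]] [bL [L1 [L2 [dL1 dL2 sL1 sL2]]]].
split; first exact: bD.
exists (fun z t => K1 z t + L1 z t), (fun z t => K2 z t + L2 z t); split.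
- by move=> z t Dz; apply: is_deriveD; [exact: dK1|exact: dL1].
- by move=> z t Dz; apply: is_deriveD; [exact: dK2|exact: dL2].
- exact: IH.
- exact: IH.
Qed.

Lemma smooth_kernelM k K L :
  smooth_kernel k K -> smooth_kernel k L -> smooth_kernel k (fun z t => K z t * L z t).
Proof.
have bM K' L' : bounded_kernel K' -> bounded_kernel L' -> bounded_kernel (fun z t => K' z t * L' z t).
  move=> [bK mK] [bL mL]; split => [rho r1|z Dz]; last first.
    by apply: measurable_funM; [exact: mK|exact: mL].
  have [M hM] := bK rho r1; have [N hN] := bL rho r1.
  exists (M * N) => z t zr; rewrite normrM ler_pM//.
    exact: hM.
  exact: hN.
elim: k K L => [|k IH] K L.
  by move=> [bK _] [bL _]; split => //; exact: bM.
move=> sK sL; have := smooth_kernelW sK; have := smooth_kernelW sL.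
move: sK sL => [bK [K1 [K2 [dK1 dK2 sK1 sK2]]]] [bL [L1 [L2 [dL1 dL2 sL1 sL2]]]] sL sK.
split; first exact: bM.
exists (fun z t => K z t * L1 z t + L z t * K1 z t), (fun z t => K z t * L2 z t + L z t * K2 z t); split.
- by move=> z t Dz; have h1 := dK1 z t Dz; have h2 := dL1 z t Dz; exact: is_deriveM.
- by move=> z t Dz; have h1 := dK2 z t Dz; have h2 := dL2 z t Dz; exact: is_deriveM.
- by apply: smooth_kernelD; exact: IH.
- by apply: smooth_kernelD; exact: IH.
Qed.

Lemma is_derive_fst z v : is_derive z v (fst : R * R -> R) v.1.
Proof.
apply/is_derive_line => /=.
by apply: is_derive_eq; rewrite scaler0 addr0 add0r scaler1.
Qed.

Lemma is_derive_snd z v : is_derive z v (snd : R * R -> R) v.2.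
Proof.
apply/is_derive_line => /=.
by apply: is_derive_eq; rewrite scaler0 addr0 add0r scaler1.
Qed.

Lemma smooth_kernel_fst k : smooth_kernel k (fun z _ => z.1).
Proof.
have b : bounded_kernel (fun z _ => z.1).
  split => // rho r1; exists rho => z _; apply: le_trans.
  by have := cdist_ge1 z (0, 0); rewrite subr0.
case: k => [//|k]; split => //.
exists (fun _ _ => 1), (fun _ _ => 0); split.
- by move=> z t _; exact: is_derive_fst.
- by move=> z t _; exact: is_derive_fst.
- by apply: (@smooth_kernel_cst _ _ 1) => // t; rewrite normr1.
- by apply: (@smooth_kernel_cst _ _ 0) => // t; rewrite normr0.
Qed.

Lemma smooth_kernel_snd k : smooth_kernel k (fun z _ => z.2).
Proof.
have b : bounded_kernel (fun z _ => z.2).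
  split => // rho r1; exists rho => z _; apply: le_trans.
  by have := cdist_ge2 z (0, 0); rewrite subr0.
case: k => [//|k]; split => //.
exists (fun _ _ => 0), (fun _ _ => 1); split.
- by move=> z t _; exact: is_derive_snd.
- by move=> z t _; exact: is_derive_snd.
- by apply: (@smooth_kernel_cst _ _ 0) => // t; rewrite normr0.
- by apply: (@smooth_kernel_cst _ _ 1) => // t; rewrite normr1.
Qed.

Definition sqdist_circle z t := (z.1 - cos t) ^+ 2 + (z.2 - sin t) ^+ 2.

(** The lower bound does not depend on [t]; this is what makes the inverse a bounded kernel. *)
Lemma sqdist_circle_ge z t : disk z -> (1 - cdist z (0, 0)) ^+ 2 <= sqdist_circle z t.
Proof.
move=> Dz; have -> : sqdist_circle z t = cdist z (cos t, sin t) ^+ 2 by rewrite cdist_sqr.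
rewrite ler_pXn2r ?nnegrE ?cdist_ge0// ?subr_ge0 ?(ltW Dz)//.
rewrite lerBlDr; have := cdist_triangle (cos t, sin t) z (0, 0).
have -> : cdist (cos t, sin t) (0, 0) = 1 :> R.
  by rewrite /cdist/= !subr0 cos2Dsin2 sqrtr1.
by rewrite cdistC.
Qed.

Lemma sqdist_circle_gt0 z t : disk z -> 0 < sqdist_circle z t.
Proof.
move=> Dz; apply: lt_le_trans (sqdist_circle_ge t Dz).
by rewrite exprn_gt0// subr_gt0.
Qed.

Lemma continuous_sqdist_circle z : continuous (sqdist_circle z).
Proof.
move=> t; rewrite /sqdist_circle; under eq_fun do rewrite !expr2.
apply: cvgD; apply: cvgM; apply: cvgB; try exact: cvg_cst;
  by [exact: continuous_cos | exact: continuous_sin].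
Qed.

Lemma is_derive_sqdist_circle z v t : is_derive z v (sqdist_circle^~ t)
  (2 * (z.1 - cos t) * v.1 + 2 * (z.2 - sin t) * v.2).
Proof.
have d1 := is_derive_fst z v; have d2 := is_derive_snd z v.
have -> : sqdist_circle^~ t =
    ((fst : R * R -> R) - cst (cos t)) ^+ 2 + ((snd : R * R -> R) - cst (sin t)) ^+ 2.
  by apply/funext => w; rewrite /sqdist_circle.
have h1 : is_derive z v ((fst : R * R -> R) - cst (cos t)) (v.1 - 0).
  by apply: is_deriveB.
have h2 : is_derive z v ((snd : R * R -> R) - cst (sin t)) (v.2 - 0).
  by apply: is_deriveB.
have g1 := is_deriveX 2 h1; have g2 := is_deriveX 2 h2.
have g := is_deriveD g1 g2.
apply: (is_derive_eq g).
by rewrite !subr0 !expr1.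
Qed.

Lemma is_derive_inv_sqdist z v t : disk z ->
  is_derive z v (fun z => (sqdist_circle z t)^-1)
    (- (2 * (z.1 - cos t) * v.1 + 2 * (z.2 - sin t) * v.2) *
     ((sqdist_circle z t)^-1 * (sqdist_circle z t)^-1)).
Proof.
move=> Dz; have Q0 := sqdist_circle_gt0 t Dz.
have [dQ eQ] := is_derive_sqdist_circle z v t.
have dV : derivable (fun z => (sqdist_circle z t)^-1) z v.
  by apply: derivableV => //; rewrite gt_eqF.
apply: DeriveDef => //; rewrite deriveV ?gt_eqF// eQ /GRing.scale/=.
by rewrite !mulNr mulrC -invfM expr2.
Qed.

(** Each partial derivative of the inverse is a linear factor times the square of the inverse, so
    the induction closes through products. *)
Lemma smooth_kernel_inv_sqdist k : smooth_kernel k (fun z t => (sqdist_circle z t)^-1).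
Proof.
have mc : measurable_fun (setT : set (measurableTypeR R)) (@cos R) by apply: continuous_measurable_fun; exact: continuous_cos.
have ms : measurable_fun (setT : set (measurableTypeR R)) (@sin R) by apply: continuous_measurable_fun; exact: continuous_sin.
have b : bounded_kernel (fun z t => (sqdist_circle z t)^-1).
  split => [rho r1|z Dz].
    exists ((1 - rho) ^+ 2)^-1 => z t zr.
    have Dz : disk z by exact: le_lt_trans zr r1.
    have Q0 := sqdist_circle_gt0 t Dz.
    rewrite ger0_norm ?invr_ge0 ?(ltW Q0)//.
    rewrite lef_pV2 ?posrE// ?exprn_gt0 ?subr_gt0//.
    apply: le_trans (sqdist_circle_ge t Dz).
    rewrite ler_pXn2r ?nnegrE ?subr_ge0 ?(ltW Dz) ?(ltW r1)//.
    by rewrite lerD2l lerN2.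
  apply: continuous_measurable_fun => t.
  apply: cvgV; first by rewrite gt_eqF// sqdist_circle_gt0.
  exact: continuous_sqdist_circle.
elim: k => [//|k IH]; split => //.
have c1 : smooth_kernel k (fun z t => -2 * (z.1 - cos t)).
  apply: smooth_kernelM; first by apply: (@smooth_kernel_cst _ _ `|-2|).
  apply: smooth_kernelD; first exact: smooth_kernel_fst.
  apply: (@smooth_kernel_cst _ _ 1); first exact: measurableT_comp.
  by move=> t; rewrite normrN ler_norml cos_geN1 cos_le1.
have c2 : smooth_kernel k (fun z t => -2 * (z.2 - sin t)).
  apply: smooth_kernelM; first by apply: (@smooth_kernel_cst _ _ `|-2|).
  apply: smooth_kernelD; first exact: smooth_kernel_snd.
  apply: (@smooth_kernel_cst _ _ 1); first exact: measurableT_comp.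
  by move=> t; rewrite normrN ler_norml sin_geN1 sin_le1.
exists (fun z t => -2 * (z.1 - cos t) * ((sqdist_circle z t)^-1 * (sqdist_circle z t)^-1)),
  (fun z t => -2 * (z.2 - sin t) * ((sqdist_circle z t)^-1 * (sqdist_circle z t)^-1)); split.
- move=> z t Dz; have := is_derive_inv_sqdist (e1 R) t Dz.
  by rewrite /= mulr1 mulr0 addr0 -!mulNr.
- move=> z t Dz; have := is_derive_inv_sqdist (e2 R) t Dz.
  by rewrite /= mulr1 mulr0 add0r -!mulNr.
- by apply: smooth_kernelM => //; exact: smooth_kernelM.
- by apply: smooth_kernelM => //; exact: smooth_kernelM.
Qed.

End SmoothKernel.

Lemma disk_direction_near (R : realType) (z v : R * R) (s : R) :
  cdist v (0, 0) <= 1 -> disk z -> `|s| < (1 - cdist z (0, 0)) / 2 ->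
  cdist (s *: v + z) (0, 0) <= (1 + cdist z (0, 0)) / 2.
Proof.
move=> v1 Dz sr.
have h : cdist (s *: v + z) z <= `|s|.
  rewrite -(@ler_pXn2r _ 2) ?nnegrE ?cdist_ge0// cdist_sqr /= !addrK.
  have : cdist v (0, 0) ^+ 2 <= 1 by rewrite expr_le1// cdist_ge0.
  rewrite cdist_sqr !subr0 real_normK ?num_real// !exprMn -mulrDr => ?.
  by rewrite ler_piMr// sqr_ge0.
have := cdist_triangle (s *: v + z) z (0, 0); lra.
Qed.

(** * Kernel integrals: differentiation under the integral sign and harmonicity *)

Section KernelIntegral.
Variable R : realType.
Local Notation mu := (@lebesgue_measure R).
Implicit Types (K : R * R -> R -> R) (z v : R * R).

Variables (B : set (measurableTypeR R)) (f : measurableTypeR R -> R).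
Hypothesis mB : measurable B.
Hypothesis intf : mu.-integrable B (EFin \o f).

Definition kernel_integral K z : R := \int[mu]_(t in B) (K z t * f t).

Lemma integrable_kernel K z : bounded_kernel K -> disk z ->
  mu.-integrable B (EFin \o (fun t => K z t * f t)).
Proof.
move=> [bK mK] Dz.
have [M hM] := bK _ Dz.
rewrite /comp; under eq_fun do rewrite EFinM.
apply: integrableMr => //.
  by apply: measurable_funTS; exact: mK.
exists `|M|; split; first exact: num_real.
move=> x Mx t _; apply: le_trans (hM z t _) _ => //.
by apply: le_trans (ltW Mx); exact: ler_norm.
Qed.

Lemma integrable_scale_norm (M : R) :
  mu.-integrable B (EFin \o (fun t => M * `|f t|)).
Proof.
have := integrableZl mB M (integrable_abse intf).
by apply: eq_integrable => // t _ /=; rewrite EFinM.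
Qed.

Lemma kernel_integral_bound K : bounded_kernel K ->
  forall rho, rho < 1 -> exists M, forall z, cdist z (0, 0) <= rho ->
    `|kernel_integral K z| <= M.
Proof.
move=> bK rho r1; have [M hM] := bK.1 rho r1.
exists (\int[mu]_(t in B) (`|M| * `|f t|)) => z zr.
have Dz : disk z by exact: le_lt_trans zr r1.
have iK := integrable_kernel bK Dz.
rewrite (le_trans (le_normr_Rintegral _ iK))//.
apply: le_Rintegral => //.
- by have := integrable_abse iK; apply: eq_integrable => // t _.
- exact: integrable_scale_norm.
- move=> t _; rewrite normrM ler_wpM2r//.
  by rewrite (le_trans (hM z t zr))// ler_norm.
Qed.

Lemma is_derive_kernel_integral K K1 v z :
  cdist v (0, 0) <= 1 -> bounded_kernel K -> bounded_kernel K1 ->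
  (forall z t, disk z -> is_derive z v (K^~ t) (K1 z t)) ->
  disk z -> is_derive z v (kernel_integral K) (kernel_integral K1 z).
Proof.
move=> v1 bK bK1 dK Dz; apply/is_derive_line.
(* Half the distance to the circle: the segment [s *: v + z] with [|s| < r] stays in a smaller
   concentric disk, where [K1] has one bound for all [t]. *)
pose r := (1 - cdist z (0, 0)) / 2.
have r0 : 0 < r by rewrite divr_gt0// subr_gt0.
have rho1 : (1 + cdist z (0, 0)) / 2 < 1 by move: (Dz); rewrite /disk/=; lra.
pose F (s : R) (t : measurableTypeR R) := K (s *: v + z) t * f t.
have Dr s : s \in `]- r, r[ -> disk (s *: v + z) /\ cdist (s *: v + z) (0, 0) <= (1 + cdist z (0, 0)) / 2.
  rewrite in_itv/= -ltr_norml => /(disk_direction_near v1 Dz) h; split => //.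
  exact: le_lt_trans h rho1.
have [M hM] := bK1.1 _ rho1.
have dF s t : s \in `]- r, r[ -> is_derive s 1 (F^~ t) (K1 (s *: v + z) t * f t).
  move=> /Dr[Ds _].
  have h := is_derive_lineS (dK _ t Ds).
  have := @is_deriveM R _ (fun s : R => K (s *: v + z) t) (cst (f t) : R -> R) s 1 _ _ h (is_derive_cst _ _ _).
  by move/is_derive_eq; apply; rewrite scaler0 add0r /GRing.scale/= mulrC.
have I0 : `]- r, r[%classic (0 : R) by rewrite /= in_itv/= oppr_lt0 r0.
have G0 t : 0 <= `|M| * `|f t| by rewrite mulr_ge0.
have iF s : `]- r, r[%classic s -> mu.-integrable B (EFin \o F s).
  by move=> /Dr[Ds _]; exact: integrable_kernel.
have iG : mu.-integrable B (EFin \o (fun t => `|M| * `|f t|)).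
  exact: integrable_scale_norm.
have E s t : s \in `]- r, r[ -> partial1of2 F s t = K1 (s *: v + z) t * f t.
  by move=> sr; rewrite partial1of2E; have [_ ->] := dF s t sr.
have derF s t : `]- r, r[%classic s -> B t -> derivable (F^~ t) s 1.
  by move=> /dF d _; case: (d t).
have bF s t : `]- r, r[%classic s -> B t -> `|partial1of2 F s t| <= `|M| * `|f t|.
  move=> sr _; rewrite E// normrM ler_wpM2r//.
  by rewrite (le_trans (hM _ t (Dr s sr).2))// ler_norm.
have H : h^-1 *: (\int[mu]_(t in B) F (h + 0) t - \int[mu]_(t in B) F 0 t) @[h --> 0^']
    --> \int[mu]_(t in B) partial1of2 F 0 t.
  exact: (@cvg_differentiation_under_integral R _ _ mu F B mB 0 (- r) r I0 iF derF _ G0 iG bF).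
have cE : (\int[mu]_(y in B) partial1of2 F 0 y) = kernel_integral K1 z.
  apply: eq_Rintegral => t _; rewrite E; last exact: I0.
  by rewrite scale0r add0r.
rewrite cE in H.
have H' : h^-1 *: (kernel_integral K (h *: 1 *: v + (0 *: v + z)) - kernel_integral K (0 *: v + z))
   @[h --> 0^'] --> kernel_integral K1 z.
  move: H; apply: cvg_trans; apply: near_eq_cvg; near=> h.
  by rewrite /F /kernel_integral scaler1 addrA -scalerDl.
have D0 : derivable (fun t : R => kernel_integral K (t *: v + z)) 0 1.
  apply/cvg_ex; exists (kernel_integral K1 z).
  move: H'; apply: cvg_trans; apply: near_eq_cvg; near=> h.
  by rewrite /= addr0 scaler1 scale0r add0r.
suff <- : 'D_1 (fun t : R => kernel_integral K (t *: v + z)) 0 = kernel_integral K1 z.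
  exact: derivableP.
apply: cvg_lim; first exact: norm_hausdorff.
move: H'; apply: cvg_trans; apply: near_eq_cvg; near=> h.
by rewrite /= addr0 scaler1 scale0r add0r.
Unshelve. all: by end_near. Qed.

Lemma cdist_e1 : cdist (e1 R) (0, 0) <= 1.
Proof. by rewrite /cdist/= !subr0 expr1n expr0n addr0 sqrtr1. Qed.

Lemma cdist_e2 : cdist (e2 R) (0, 0) <= 1.
Proof. by rewrite /cdist/= !subr0 expr1n expr0n add0r sqrtr1. Qed.

Lemma kernel_integral_continuous K : smooth_kernel 1 K ->
  forall z, disk z -> {for z, continuous (kernel_integral K)}.
Proof.
move=> [bK [K1 [K2 [d1 d2 [b1 _] [b2 _]]]]].
apply: (@continuous_bounded_partials _ _ _ (kernel_integral K1) (kernel_integral K2)).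
- exact: disk_open.
- by move=> z Dz; split; apply: is_derive_kernel_integral => //;
    [exact: cdist_e1|exact: cdist_e2].
- move=> z Dz; pose rho := (1 + cdist z (0, 0)) / 2.
  have rho1 : rho < 1 by move: (Dz); rewrite /disk/= /rho; lra.
  have [M hM] := kernel_integral_bound b1 rho1.
  have [N hN] := kernel_integral_bound b2 rho1.
  exists (Num.max M N); near=> w.
  have wr : cdist w (0, 0) <= rho.
    near: w; have : \forall w \near z, cdist w (0, 0) < rho.
      have cz := @cdist_continuous R (0, 0) z.
      apply: (cvgr_lt _ cz).
      by move: (Dz); rewrite /disk/= /rho; lra.
    by apply: filterS => w /ltW.
  by rewrite !le_max hM// hN// orbT.
Unshelve. all: by end_near. Qed.

(** One derivative more is asked of the kernel because continuity at the last stage comes from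
    bounded partial derivatives. Agreement of [h] with the integral is asked only inside the disk,
    since that is all that is known of the derivatives of [h] in the induction. *)
Lemma Ck_kernel_integral k K h : smooth_kernel k.+1 K ->
  (forall z, disk z -> h z = kernel_integral K z) -> Ck_on (@disk R) k h.
Proof.
have near_disk z (g1 g2 : R * R -> R) : disk z -> (forall z, disk z -> g1 z = g2 z) ->
    \forall w \near z, g1 w = g2 w.
  move=> Dz g12; have : nbhs z (@disk R) by apply: open_nbhs_nbhs; split => //; exact: disk_open.
  by apply: filterS => w; exact: g12.
elim: k K h => [|k IH] K h sK hK.
  move=> z Dz; have := kernel_integral_continuous sK Dz.
  rewrite /prop_for /continuous_at -hK//; apply: cvg_trans.
  by apply: near_eq_cvg; apply: near_disk => // w Dw; rewrite hK.
have sK1 : smooth_kernel 1 K.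
  by elim: (k.+1) sK => [//|n IHn /smooth_kernelW /IHn].
have [bK [K1 [K2 [d1 d2 s1 s2]]]] := sK.
have [b1 _] := s1; have [b2 _] := s2.
have e1h z : disk z -> is_derive z (e1 R) h (kernel_integral K1 z).
  move=> Dz; apply: (near_eq_is_derive (f := kernel_integral K)).
    by apply: near_disk => // w Dw; rewrite hK.
  by apply: is_derive_kernel_integral => //; exact: cdist_e1.
have e2h z : disk z -> is_derive z (e2 R) h (kernel_integral K2 z).
  move=> Dz; apply: (near_eq_is_derive (f := kernel_integral K)).
    by apply: near_disk => // w Dw; rewrite hK.
  by apply: is_derive_kernel_integral => //; exact: cdist_e2.
split.
- move=> z Dz; have := kernel_integral_continuous sK1 Dz.
  rewrite /prop_for /continuous_at -hK//; apply: cvg_trans.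
  by apply: near_eq_cvg; apply: near_disk => // w Dw; rewrite hK.
- by move=> z Dz; split; [case: (e1h z Dz)|case: (e2h z Dz)].
- by apply: IH s1 _ => z Dz; case: (e1h z Dz).
- by apply: IH s2 _ => z Dz; case: (e2h z Dz).
Qed.

Lemma kernel_integral_harmonic K : smooth_kernel 3 K ->
  (forall z t, disk z -> laplacian (K^~ t) z = 0) ->
  disk_harmonic (kernel_integral K).
Proof.
have near_disk z (g1 g2 : R * R -> R) : disk z -> (forall z, disk z -> g1 z = g2 z) ->
    \forall w \near z, g1 w = g2 w.
  move=> Dz g12; have : nbhs z (@disk R) by apply: open_nbhs_nbhs; split => //; exact: disk_open.
  by apply: filterS => w; exact: g12.
move=> sK lapK; split; first exact: (Ck_kernel_integral (K := K)).
have [bK [K1 [K2 [d1 d2 s1 s2]]]] := sK.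
have [b1 [K11 [K12 [d11 _ s11 _]]]] := s1; have [b2 [K21 [K22 [_ d22 _ s22]]]] := s2.
have [b11 _] := s11; have [b22 _] := s22.
move=> z Dz.
have D1 (F G : R * R -> R) v : (forall w, disk w -> F w = G w) -> 'D_v F z = 'D_v G z.
  by move=> FG; apply: near_eq_derive; exact: near_disk.
have E1 : 'D_(e1 R) (fun w => 'D_(e1 R) (kernel_integral K) w) z = kernel_integral K11 z.
  transitivity ('D_(e1 R) (kernel_integral K1) z).
    apply: D1 => w Dw.
    by case: (is_derive_kernel_integral cdist_e1 bK b1 d1 Dw).
  by case: (is_derive_kernel_integral cdist_e1 b1 b11 d11 Dz).
have E2 : 'D_(e2 R) (fun w => 'D_(e2 R) (kernel_integral K) w) z = kernel_integral K22 z.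
  transitivity ('D_(e2 R) (kernel_integral K2) z).
    apply: D1 => w Dw.
    by case: (is_derive_kernel_integral cdist_e2 bK b2 d2 Dw).
  by case: (is_derive_kernel_integral cdist_e2 b2 b22 d22 Dz).
have F1 t : 'D_(e1 R) (fun w => 'D_(e1 R) (K^~ t) w) z = K11 z t.
  transitivity ('D_(e1 R) (K1^~ t) z); last by case: (d11 z t Dz).
  by apply: D1 => w Dw; case: (d1 w t Dw).
have F2 t : 'D_(e2 R) (fun w => 'D_(e2 R) (K^~ t) w) z = K22 z t.
  transitivity ('D_(e2 R) (K2^~ t) z); last by case: (d22 z t Dz).
  by apply: D1 => w Dw; case: (d2 w t Dw).
have K0 t : K11 z t + K22 z t = 0 by rewrite -F1 -F2; exact: lapK.
rewrite (_ : laplacian _ _ = kernel_integral K11 z + kernel_integral K22 z); last first.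
  by rewrite -E1 -E2.
have i1 := integrable_kernel b11 Dz; have i2 := integrable_kernel b22 Dz.
transitivity (\int[mu]_(t in B) (K11 z t * f t + K22 z t * f t)).
  by apply/esym; exact: RintegralD mB i1 i2.
transitivity (\int[mu]_(t in B) (0 : R)).
  by apply: eq_Rintegral => t _; rewrite -mulrDl K0 mul0r.
by rewrite Rintegral_cst// mul0r.
Qed.

End KernelIntegral.

(** * The Poisson kernel and its harmonicity *)

Section PoissonKernel.
Variable R : realType.
Implicit Types (z v : R * R) (t : R).

(** The unnormalised Poisson kernel [(1 - |z|^2) / |z - e^{it}|^2]; the factor [(2 * pi)^-1] is left
    out, as constants do not matter for a majorant. *)
Definition poisson z t : R := (1 - z.1 ^+ 2 - z.2 ^+ 2) * (sqdist_circle z t)^-1.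

Lemma is_derive_affine (a b c : R) z v :
  is_derive z v (fun z => a * z.1 + b * z.2 + c) (a * v.1 + b * v.2).
Proof.
have d1 := is_deriveZ a (is_derive_fst z v).
have d2 := is_deriveZ b (is_derive_snd z v).
have d := is_deriveD (is_deriveD d1 d2) (is_derive_cst c z v).
by apply: (is_derive_eq d); rewrite addr0.
Qed.

Lemma smooth_kernel_poisson k : smooth_kernel k poisson.
Proof.
have s1 (c : R) : smooth_kernel k (fun _ _ => c) by apply: (@smooth_kernel_cst _ _ _ `|c|).
apply: smooth_kernelM; last exact: smooth_kernel_inv_sqdist.
have -> : (fun z _ => 1 - z.1 ^+ 2 - z.2 ^+ 2) =
    (fun z (_ : R) => (1 + -1 * (z.1 * z.1)) + -1 * (z.2 * z.2)).
  by apply/funext => z; apply/funext => t; ring.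
have f := smooth_kernel_fst R k; have g := smooth_kernel_snd R k.
apply: smooth_kernelD; last by apply: smooth_kernelM => //; exact: smooth_kernelM.
by apply: smooth_kernelD => //; apply: smooth_kernelM => //; exact: smooth_kernelM.
Qed.

Let A z : R := 1 - z.1 ^+ 2 - z.2 ^+ 2.

Lemma is_derive_one_sub_sqr z v : is_derive z v A (-2 * v.1 * z.1 + -2 * v.2 * z.2 + 0).
Proof.
have d1 := is_deriveM (is_derive_fst z v) (is_derive_fst z v).
have d2 := is_deriveM (is_derive_snd z v) (is_derive_snd z v).
have d := is_deriveB (is_deriveB (is_derive_cst (1 : R) z v) d1) d2.
by apply: (is_derive_eq d); rewrite /GRing.scale/=; ring.
Qed.

Let dP v z t : R :=
  A z * (- (2 * v.1 * z.1 + 2 * v.2 * z.2 + -2 * (cos t * v.1 + sin t * v.2)) *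
     ((sqdist_circle z t)^-1 * (sqdist_circle z t)^-1))
  + (sqdist_circle z t)^-1 * (-2 * v.1 * z.1 + -2 * v.2 * z.2 + 0).

(** The linear factor is rewritten as an affine form in [z], ready to be differentiated a second
    time by [is_derive_affine]. *)
Lemma is_derive_inv_sqdist' z v t : disk z ->
  is_derive z v (fun z => (sqdist_circle z t)^-1)
   (- (2 * v.1 * z.1 + 2 * v.2 * z.2 + -2 * (cos t * v.1 + sin t * v.2)) *
     ((sqdist_circle z t)^-1 * (sqdist_circle z t)^-1)).
Proof.
move=> Dz; have d := is_derive_inv_sqdist v t Dz.
by apply: (is_derive_eq d); congr (_ * _); ring.
Qed.

Lemma is_derive_poisson z v t : disk z -> is_derive z v (poisson^~ t) (dP v z t).
Proof.
move=> Dz; exact: (is_deriveM (is_derive_one_sub_sqr z v) (is_derive_inv_sqdist' v t Dz)).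
Qed.

Lemma laplacian_poisson z t : disk z -> laplacian (poisson^~ t) z = 0.
Proof.
move=> Dz.
have Dn v : 'D_v (fun w => 'D_v (poisson^~ t) w) z = 'D_v (dP v ^~ t) z.
  apply: near_eq_derive; have : nbhs z (@disk R).
    by apply: open_nbhs_nbhs; split => //; exact: disk_open.
  by apply: filterS => w Dw; case: (is_derive_poisson v t Dw).
rewrite /laplacian !Dn.
have DD v : is_derive z v (dP v ^~ t)
   (let V := (sqdist_circle z t)^-1 in
    let l := 2 * v.1 * z.1 + 2 * v.2 * z.2 + -2 * (cos t * v.1 + sin t * v.2) in
    let b := -2 * v.1 * z.1 + -2 * v.2 * z.2 + 0 in
    let n := v.1 ^+ 2 + v.2 ^+ 2 in
    A z * (- l * (V * (- l * (V * V)) + V * (- l * (V * V))) + (V * V) * (- (2 * n)))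
    + (- l * (V * V)) * b + (V * (-2 * n) + b * (- l * (V * V)))).
  have dV := is_derive_inv_sqdist' v t Dz.
  have dA := is_derive_one_sub_sqr z v.
  have dl := is_derive_affine (2 * v.1) (2 * v.2) (-2 * (cos t * v.1 + sin t * v.2)) z v.
  have db := is_derive_affine (-2 * v.1) (-2 * v.2) 0 z v.
  have d := is_deriveD (is_deriveM dA (is_deriveM (is_deriveN dl) (is_deriveM dV dV))) (is_deriveM dV db).
  apply: (is_derive_eq d); rewrite /GRing.scale/= !fctE; ring.
have [_ ->] := DD (e1 R); have [_ ->] := DD (e2 R).
have Q0 := sqdist_circle_gt0 t Dz.
have c2 := cos2Dsin2 t.
rewrite /= /A /sqdist_circle in Q0 *.
have Q0' : (z.1 - cos t) ^+ 2 + (z.2 - sin t) ^+ 2 != 0 by rewrite gt_eqF.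
move: c2 Q0'; move: (cos t) (sin t) (z.1) (z.2) => c s x y c2 Q0'.
(* The identity between rational functions holds only modulo the equation of the circle. *)
have c2' : c ^+ 2 = 1 - s ^+ 2 by lra.
field: c2'.
exact: Q0'.
Qed.

End PoissonKernel.

(** * The majorant on the disk *)

Section DistSet.
Variables (R : realType) (X : Type) (d : X -> X -> R).
Hypothesis d_ge0 : forall x y, 0 <= d x y.
Implicit Types (x a : X) (A : set X).

Lemma dist_set_le x A a : A a -> dist_set d x A <= d x a.
Proof.
move=> Aa; apply: ge_inf; last by exists a.
by exists 0 => _ [b _ <-].
Qed.

Lemma dist_set_ge x A (m : R) : A !=set0 -> (forall a, A a -> m <= d x a) -> m <= dist_set d x A.
Proof.
move=> [a Aa] mA; apply: lb_le_inf; first by exists (d x a); exists a.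
by move=> _ [b Ab <-]; exact: mA.
Qed.

Lemma dist_set_near x A (e : R) : A !=set0 -> 0 < e ->
  exists2 a, A a & d x a < dist_set d x A + e.
Proof.
move=> [a Aa] e0.
have [|_ [b Ab <-] h] := @inf_adherent _ [set d x a | a in A] e e0.
  by split; [exists (d x a); exists a|exists 0 => _ [b _ <-]].
by exists b.
Qed.

End DistSet.

(** By monotonicity the superlevel sets are intervals. *)
Lemma measurable_profile (R : realType) (diam : R) (Psi : R -> \bar R) :
  majorant_profile diam Psi ->
  measurable_fun (`[0, diam]%classic : set (measurableTypeR R)) Psi.
Proof.
move=> H; apply: (measurability _ (ErealGenOInfty.measurableE R)).
move=> _ [_ [x ->] <-]; apply: is_interval_measurable.
move=> s t [/= s1 s2] [/= t1 t2] y /andP[sy yt].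
move: s1 t1; rewrite /= !in_itv/= => /andP[s0 sd] /andP[t0 td].
have y0 : 0 <= y by exact: le_trans sy.
have yd : y <= diam by exact: le_trans td.
split; first exact/andP.
rewrite andbT; move: t2; rewrite in_itv/= andbT => /lt_le_trans; apply.
exact: (profile_decr H).
Qed.

(** * Distances to subsets of the circle *)

Section CircleGeometry.
Variable R : realType.
Implicit Types (x y z xi eta : R * R) (E : set (R * R)).
Local Notation distE := (dist_set (@cdist R)).

Lemma dist_set_lipschitz x y E : E !=set0 -> distE x E <= distE y E + cdist x y.
Proof.
move=> E0; rewrite -lerBlDr; apply: dist_set_ge => // a Ea.
rewrite lerBlDr addrC (le_trans _ (cdist_triangle x y a))//.
exact: (dist_set_le (@cdist_ge0 R)).
Qed.

Lemma dist_set_continuous E : E !=set0 -> continuous (fun x => distE x E).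
Proof.
move=> E0 x; apply/cvgrPdist_le => e e0.
have cx : \forall y \near x, cdist y x <= e.
  have := @cdist_continuous R x x => /cvgrPdist_le/(_ e e0).
  apply: filterS => y.
  have -> : cdist x x = 0 by rewrite /cdist !subrr expr0n addr0 sqrtr0.
  by rewrite sub0r normrN ger0_norm// cdist_ge0.
near=> y.
have yx : cdist y x <= e by near: y.
have := dist_set_lipschitz x y E0; have := dist_set_lipschitz y x E0.
by rewrite (cdistC x y) ler_distl => *; apply/andP; split; lra.
Unshelve. all: by end_near. Qed.

Lemma circle_angle eta : circle eta -> exists2 a : R, 0 <= a <= 2 * pi & eta = (cos a, sin a).
Proof.
move=> c1; have h : eta.1 ^+ 2 + eta.2 ^+ 2 = 1.
  by have := cdist_sqr eta (0, 0); rewrite c1 !subr0 expr1n.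
have x1 : -1 <= eta.1 <= 1 by apply/andP; split; have := sqr_ge0 eta.2; nra.
have sq : Num.sqrt (1 - eta.1 ^+ 2) = `|eta.2|.
  by rewrite -sqrtr_sqr; congr Num.sqrt; lra.
have p0 := pi_ge0 R.
have a0 := acos_ge0 x1; have a1 := acos_lepi x1.
have [y0|y0] := leP 0 eta.2.
  exists (acos eta.1); first by apply/andP; split => //; lra.
  by rewrite acosK// sin_acos// sq ger0_norm// -surjective_pairing.
exists (2 * pi - acos eta.1); first by apply/andP; split; lra.
have -> : 2 * pi - acos eta.1 = - acos eta.1 + pi *+ 2 by rewrite mulr_natl addrC.
rewrite cosD2pi sinD2pi cosN sinN acosK// sin_acos// sq ltr0_norm// opprK.
by rewrite -surjective_pairing.
Qed.

Lemma cdist_arc (s t : R) : cdist (cos s, sin s) (cos t, sin t) <= 2 * `|s - t|.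
Proof.
rewrite (le_trans (cdist_le_sum _ _))// (_ : 2 = 1 + 1)// mulrDl lerD//=.
  apply: (@le_norm_bounded_derive _ cos (fun v => - sin v) 1 t s `|s - t|) => // x _; split.
    exact: is_derive_cos.
  by rewrite normrN ler_norml sin_geN1 sin_le1.
apply: (@le_norm_bounded_derive _ sin cos 1 t s `|s - t|) => // x _; split.
  exact: is_derive_sin.
by rewrite ler_norml cos_geN1 cos_le1.
Qed.

(* The chord from x to xi stays within O(cdist x xi * step) of the circle, so
   moving from x towards xi by 6 times the depth of x and projecting radially
   gains at least the depth in the distance to xi. *)
Lemma circle_point_towards x xi : disk x -> circle xi -> cdist x xi <= 2^-1 ->
  exists eta, [/\ circle eta, cdist eta xi <= cdist x xi - (1 - cdist x (0, 0)) &
    cdist eta x <= 11 * (1 - cdist x (0, 0))].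
Proof.
move=> Dx Cxi d2.
set d := cdist x xi in d2 *; set r := cdist x (0, 0); pose e := 1 - r.
have e0 : 0 < e by rewrite subr_gt0.
have ed : e <= d.
  have := cdist_triangle xi x (0, 0); rewrite Cxi -/r cdistC -/d /e; lra.
have [d6|d6] := ltP d (6 * e).
  exists xi; split => //; last by rewrite cdistC -/d -/e; lra.
  by rewrite /cdist !subrr expr0n addr0 sqrtr0 subr_ge0.
have d0 : 0 < d by lra.
pose l := 6 * e / d.
have l0 : 0 <= l by rewrite divr_ge0// ltW// mulr_gt0.
have l1 : l <= 1 by rewrite ler_pdivrMr// mul1r.
have ld : l * d = 6 * e by rewrite /l divfK// gt_eqF.
pose y : R * R := (x.1 + l * (xi.1 - x.1), x.2 + l * (xi.2 - x.2)).
have dd : d ^+ 2 = (x.1 - xi.1) ^+ 2 + (x.2 - xi.2) ^+ 2 by exact: cdist_sqr.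
have rr : r ^+ 2 = x.1 ^+ 2 + x.2 ^+ 2 by rewrite /r cdist_sqr/= !subr0.
have xx : 1 = xi.1 ^+ 2 + xi.2 ^+ 2.
  by have := cdist_sqr xi (0, 0); rewrite Cxi expr1n !subr0.
have yx : cdist y x = 6 * e.
  apply/eqP; rewrite -(@eqrXn2 _ 2) ?cdist_ge0// ?mulr_ge0 ?(ltW e0)//.
  rewrite -ld exprMn dd cdist_sqr /=; apply/eqP; ring.
have yxi : cdist y xi = d - 6 * e.
  apply/eqP; rewrite -(@eqrXn2 _ 2) ?cdist_ge0// ?subr_ge0//.
  rewrite -ld -{1}(mul1r d) -mulrBl exprMn dd cdist_sqr /=; apply/eqP; ring.
set s := cdist y (0, 0).
(* Stewart's theorem for the point [y] on the chord from [x] to [xi], with [|xi| = 1]. *)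
have ss : s ^+ 2 = (1 - l) * r ^+ 2 + l - l * (1 - l) * d ^+ 2.
  rewrite /s cdist_sqr dd rr /= !subr0.
  transitivity ((1 - l) * (x.1 ^+ 2 + x.2 ^+ 2) + l * (xi.1 ^+ 2 + xi.2 ^+ 2) -
    l * (1 - l) * ((x.1 - xi.1) ^+ 2 + (x.2 - xi.2) ^+ 2)); first by ring.
  by rewrite -xx mulr1.
have s0 : 0 <= s := cdist_ge0 _ _.
have r0 : 0 <= r := cdist_ge0 _ _.
have r21 : 0 <= 1 - r ^+ 2.
  by rewrite -[1](expr1n _ 2) subr_sqr mulr_ge0 ?(ltW e0)// addr_ge0.
(* The first term below is at most [2 * e], the second at most [6 * e * d <= 3 * e] as [d <= 1/2].
   Projecting thus costs at most [5 * e]: of the advance [6 * e] a gain of [e] remains, and the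
   total displacement is at most [11 * e]. *)
have s1 : 1 - s ^+ 2 <= 5 * e.
  have -> : 1 - s ^+ 2 = (1 - l) * (1 - r ^+ 2) + (1 - l) * d * (l * d) by rewrite ss; ring.
  have h1 : 1 - r ^+ 2 <= 2 * e by rewrite /e; nra.
  rewrite ld; nra.
have s2 : s ^+ 2 <= 1.
  have : 0 <= (1 - l) * (1 - r ^+ 2) + l * (1 - l) * d ^+ 2.
    have l2 : 0 <= 1 - l by rewrite subr_ge0.
    apply: addr_ge0; first exact: mulr_ge0.
    by rewrite mulr_ge0 ?sqr_ge0// mulr_ge0.
  have -> : s ^+ 2 = 1 - ((1 - l) * (1 - r ^+ 2) + l * (1 - l) * d ^+ 2) by rewrite ss; ring.
  lra.
have s3 : s <= 1 by nra.
have sgt : 0 < s.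
  rewrite lt_neqAle s0 andbT eq_sym; apply/eqP => z0; move: s1; rewrite z0 expr0n subr0.
  lra.
exists (y.1 / s, y.2 / s).
have yy : s ^+ 2 = y.1 ^+ 2 + y.2 ^+ 2 by rewrite /s cdist_sqr/= !subr0.
have sN0 : s != 0 by rewrite gt_eqF.
have etay : cdist (y.1 / s, y.2 / s) y = 1 - s.
  apply/eqP; rewrite -(@eqrXn2 _ 2) ?cdist_ge0// ?subr_ge0//.
  rewrite cdist_sqr /=.
  have -> : (y.1 / s - y.1) ^+ 2 + (y.2 / s - y.2) ^+ 2 = (y.1 ^+ 2 + y.2 ^+ 2) * (s^-1 - 1) ^+ 2 by ring.
  by rewrite -yy -exprMn mulrBr mulfV// mulr1.
have es : 1 - s <= 5 * e by nra.
split.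
- rewrite /circle/= /cdist/= !subr0 !expr_div_n -mulrDl -yy divff ?sqrtr1//.
  by rewrite expf_neq0.
- have := cdist_triangle (y.1 / s, y.2 / s) y xi; rewrite etay yxi -/e; lra.
- have := cdist_triangle (y.1 / s, y.2 / s) y x; rewrite etay yx -/e; lra.
Qed.

End CircleGeometry.

(** * Lower bound for the Poisson integral of the boundary profile *)

Section DiskMajorant.
Variable R : realType.
Local Notation mu := (@lebesgue_measure R).
Local Notation distE := (dist_set (@cdist R)).
Local Notation plane := (measurableTypeR R * measurableTypeR R)%type.

Lemma dist_set_circle_ge (E : set (R * R)) z : E !=set0 -> E `<=` @circle R ->
  1 - cdist z (0, 0) <= distE z E.
Proof.
move=> E0 EC; apply: dist_set_ge => // a /EC Ca.
have := cdist_triangle a z (0, 0); rewrite Ca (cdistC a); lra.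
Qed.

Lemma dist_set_circle_le2 (E : set (R * R)) z : E !=set0 -> E `<=` @circle R ->
  cdist z (0, 0) <= 1 -> 0 <= distE z E <= 2.
Proof.
move=> E0 EC z1; apply/andP; split.
  by apply: dist_set_ge => // a _; exact: cdist_ge0.
have [a Ea] := E0.
rewrite (le_trans (dist_set_le (@cdist_ge0 R) z Ea))//.
have := cdist_triangle z (0, 0) a; rewrite (cdistC (0, 0)) (EC _ Ea); lra.
Qed.

Lemma cdist_cos_sin (t : R) : cdist (cos t, sin t) (0, 0) = 1.
Proof. by rewrite /cdist/= !subr0 cos2Dsin2 sqrtr1. Qed.

Lemma measurable_circle : measurable (@circle R : set plane).
Proof.
have mc := @measurable_fun_cts_plane R setT (fun z => cdist z (0, 0)) openT
  (fun z _ => @cdist_continuous R (0, 0) z).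
have := mc measurableT _ (@measurable_set1 _ (1 : R)).
by rewrite setTI.
Qed.

Lemma measurable_dist_set (E : set (R * R)) (D : set plane) : E !=set0 ->
  measurable_fun D (fun z => distE z E).
Proof.
move=> E0; apply: measurable_funTS.
by apply: (measurable_fun_cts_plane openT) => z _; exact: dist_set_continuous.
Qed.

Lemma measurable_profile_comp d (T : measurableType d) (D : set T) (diam : R) (Psi : R -> \bar R)
    (g : T -> R) : majorant_profile diam Psi -> measurable_fun D g ->
  (forall t, D t -> 0 <= g t <= diam) -> measurable_fun D (Psi \o g).
Proof.
move=> H mg gD.
apply: (@measurable_comp _ _ _ _ _ _ (`[0, diam]%classic : set (measurableTypeR R))) => //.
- by move=> _ [t Dt <-]; rewrite /= in_itv/=; exact: gD.
- exact: (measurable_profile H).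
Qed.

Variables (E : set (R * R)) (Psi : R -> \bar R).
Hypothesis E0 : E !=set0.
Hypothesis EC : E `<=` @circle R.
Hypothesis HPsi : majorant_profile 2 Psi.

Definition boundary_profile (t : measurableTypeR R) : \bar R := Psi (distE (cos t, sin t) E).

Lemma boundary_profile_ge0 t : (0 <= boundary_profile t)%E.
Proof.
apply: (profile_ge0 HPsi); apply: dist_set_circle_le2 => //.
by rewrite cdist_cos_sin.
Qed.

Lemma measurable_boundary_profile D : measurable_fun D boundary_profile.
Proof.
apply: measurable_funTS.
apply: (measurable_profile_comp (diam := 2) (g := fun t => distE (cos t, sin t) E)) => //.
  apply: (measurableT_comp (f := fun z : plane => distE z E)).
    exact: measurable_dist_set.
  exact: measurable_circle_param.
by move=> t _; apply: dist_set_circle_le2 => //; rewrite cdist_cos_sin.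
Qed.

Lemma integral_arc_measure :
  (\int[@arc_measure R]_(xi in @circle R) Psi (distE xi E) =
   (((2 * pi)^-1)%R)%:E * \int[mu]_(t in `[0%R, (2 * pi)%R]) boundary_profile t)%E.
Proof.
rewrite /arc_measure /distribution ge0_integral_pushforward//.
- rewrite (_ : _ @^-1` _ = setT); last first.
    by apply/seteqP; split => // t _; rewrite /= /circle/= /circle_param cdist_cos_sin.
  rewrite integral_uniform ?subr0//.
  + exact: measurable_boundary_profile.
  + exact: boundary_profile_ge0.
- exact: measurable_circle.
- apply: (measurable_profile_comp (diam := 2) (g := fun z => distE z E)) => //.
    exact: measurable_dist_set.
  by move=> z Cz; apply: dist_set_circle_le2 => //; rewrite Cz.
- move=> z; rewrite inE => Cz; apply: (profile_ge0 HPsi).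
  by apply: dist_set_circle_le2 => //; rewrite Cz.
Qed.

Local Notation B := (`[0%R, (2 * pi)%R]%classic : set (measurableTypeR R)).

Hypothesis Ioo : (\int[mu]_(t in B) boundary_profile t < +oo)%E.

Let f : measurableTypeR R -> R := fine \o boundary_profile.

Lemma integrable_boundary_profile : mu.-integrable B boundary_profile.
Proof.
apply/integrableP; split; first exact: measurable_boundary_profile.
by under eq_integral => t _ do rewrite gee0_abs ?boundary_profile_ge0//.
Qed.

Lemma integrable_fine_boundary_profile : mu.-integrable B (EFin \o f).
Proof.
apply: le_integrable integrable_boundary_profile => //.
  apply/measurable_EFinP; apply: measurableT_comp => //.
  exact: measurable_boundary_profile.
move=> t _ /=; rewrite /f /=; have := boundary_profile_ge0 t.
by case: boundary_profile => [r _|_|//]; rewrite /= ?lexx// leey.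
Qed.

Lemma poisson_ge0 (z : R * R) t : disk z -> 0 <= poisson z t.
Proof.
move=> Dz; rewrite mulr_ge0 ?invr_ge0 ?(ltW (sqdist_circle_gt0 t Dz))//.
have := cdist_sqr z (0, 0); rewrite !subr0 => h.
have := cdist_ge0 z (0, 0); move: Dz; rewrite /disk/=.
move: (cdist z (0, 0)) h => r h; nra.
Qed.

Lemma measurable_poisson z : disk z -> measurable_fun (setT : set (measurableTypeR R)) (poisson z).
Proof. by move=> Dz; have [_] := smooth_kernel_bounded (smooth_kernel_poisson R 0); exact. Qed.

(** [fine] sends [+oo] to [0], but an integrable profile is finite almost everywhere, so its
    real-valued version has the same integrals. *)
Lemma kernel_integral_boundary_profile z : disk z ->
  (kernel_integral B f (@poisson R) z)%:E =
  (\int[mu]_(t in B) ((poisson z t)%:E * boundary_profile t))%E.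
Proof.
move=> Dz; have mB : measurable B by exact: measurable_itv.
have bK := smooth_kernel_bounded (smooth_kernel_poisson R 0).
rewrite /kernel_integral /Rintegral fineK; last first.
  apply: integrable_fin_num => //.
  exact: (integrable_kernel _ integrable_fine_boundary_profile bK Dz).
apply: ae_eq_integral => //.
- by case/integrableP: (integrable_kernel mB integrable_fine_boundary_profile bK Dz).
- apply: emeasurable_funM; last exact: measurable_boundary_profile.
  by apply/measurable_EFinP; apply: measurable_funTS; exact: measurable_poisson.
have := integrable_ae mB integrable_boundary_profile.
apply: filterS => t /[apply] ft; rewrite /f /= EFinM fineK//.
Qed.

Lemma le_kernel_integral_boundary_profile : exists2 C : R, 0 <= C &
  forall x, disk x -> distE x E < 4^-1 ->
  (Psi (distE x E) <= (C * kernel_integral B f (@poisson R) x)%:E)%E.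
Proof.
(* [576 = 12^2 * 4]: a parameter interval of length [e / 4] is found whose points lie within
   [12 * e] of [x], where the kernel is at least [e / (12 * e)^2]. *)
exists 576; first exact: ler0n.
move=> x Dx dx.
pose e := 1 - cdist x (0, 0).
have e0 : 0 < e by rewrite subr_gt0.
have ed : e <= distE x E by exact: dist_set_circle_ge.
(* A near-minimiser is taken. Its slack [e / 2] and the radius [e / 2] of the arc around [eta]
   together use up exactly the gain [e] of [circle_point_towards]. *)
have [xi Exi dxi] : exists2 xi, E xi & cdist x xi < distE x E + e / 2.
  by apply: dist_set_near => //; [exact: cdist_ge0|rewrite divr_gt0].
have d2 : cdist x xi <= 2^-1 by lra.
have [eta [Ceta h1 h2]] := circle_point_towards Dx (EC Exi) d2.
rewrite -/e in h1 h2.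
have [a /andP[a0 a2] etaE] := circle_angle Ceta.
have pi2 := pi_ge2 R.
(* The interval starts or ends at [a], on whichever side keeps it inside [[0, 2 * pi]]. *)
have [b [b0 b1 ba]] : exists b : R, [/\ 0 <= b, b + e / 4 <= 2 * pi &
    forall t : R, b <= t <= b + e / 4 -> `|t - a| <= e / 4].
  have [api|api] := leP a pi.
    exists a; split => //; first by lra.
    by move=> t /andP[? ?]; rewrite ler_norml; apply/andP; split; lra.
  exists (a - e / 4); split; [lra|lra|].
  by move=> t /andP[? ?]; rewrite ler_norml; apply/andP; split; lra.
pose J : set (measurableTypeR R) := `[b, b + e / 4]%classic.
have JB : J `<=` B.
  move=> t; rewrite /J /= !in_itv/= => /andP[t0 t1].
  by apply/andP; split; [exact: le_trans t0|exact: le_trans b1].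
have mJ : measurable J by exact: measurable_itv.
have dE2 : 0 <= distE x E <= 2 by apply: dist_set_circle_le2 => //; exact: ltW.
have Pfin : Psi (distE x E) \is a fin_num.
  rewrite ge0_fin_numE ?(profile_ge0 HPsi)// ltey; apply/eqP => /(profile_infty HPsi dE2) h.
  by move: ed; rewrite h; lra.
have lowJ (t : R) : J t -> ((144 * e)^-1%:E * Psi (distE x E) <=
    (poisson x t)%:E * boundary_profile t)%E.
  rewrite /J /= in_itv/= => tb; have ta := ba t tb.
  have ce : cdist (cos t, sin t) eta <= e / 2.
    rewrite etaE (le_trans (cdist_arc t a))//. lra.
  have dt : distE (cos t, sin t) E <= distE x E.
    rewrite (le_trans (dist_set_le (@cdist_ge0 R) _ Exi))//.
    have := cdist_triangle (cos t, sin t) eta xi; lra.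
  have ct : cdist x (cos t, sin t) <= 12 * e.
    have := cdist_triangle x eta (cos t, sin t).
    rewrite (cdistC x eta) (cdistC eta (cos t, sin t)); lra.
  apply: lee_pmul => //.
  - by rewrite lee_fin invr_ge0 mulr_ge0// ltW.
  - by rewrite (profile_ge0 HPsi).
  - rewrite lee_fin /poisson.
    have Q0 := sqdist_circle_gt0 t Dx.
    have QE : sqdist_circle x t = cdist x (cos t, sin t) ^+ 2 by rewrite cdist_sqr.
    have Qle : sqdist_circle x t <= 144 * e ^+ 2.
      rewrite QE (_ : 144 * e ^+ 2 = (12 * e) ^+ 2); last by ring.
      by rewrite ler_pXn2r ?nnegrE ?cdist_ge0// mulr_ge0// ltW.
    rewrite ler_pdivlMr//.
    rewrite (@le_trans _ _ ((144 * e)^-1 * (144 * e ^+ 2)))//.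
      by rewrite ler_wpM2l// invr_ge0 mulr_ge0// ltW.
    have -> : (144 * e)^-1 * (144 * e ^+ 2) = e by field; rewrite gt_eqF.
    have := cdist_sqr x (0, 0); rewrite !subr0 => hs.
    have := cdist_ge0 x (0, 0) => r0.
    have -> : 1 - x.1 ^+ 2 - x.2 ^+ 2 = e * (1 + cdist x (0, 0)).
      by rewrite /e; transitivity (1 - cdist x (0, 0) ^+ 2); [rewrite hs|]; ring.
    by rewrite mulrDr mulr1 lerDl mulr_ge0// ltW.
  - apply: (profile_decr HPsi) => //; last by case/andP: dE2.
    by apply: dist_set_ge => // *; exact: cdist_ge0.
have : ((144 * e)^-1%:E * Psi (distE x E) * mu J <=
    (kernel_integral B f (@poisson R) x)%:E)%E.
  rewrite kernel_integral_boundary_profile// -integral_cst//.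
  have mF : measurable_fun B (fun t => ((poisson x t)%:E * boundary_profile t)%E).
    apply: emeasurable_funM; last exact: measurable_boundary_profile.
    by apply/measurable_EFinP; apply: measurable_funTS; exact: measurable_poisson.
  have F0 t : (0 <= (poisson x t)%:E * boundary_profile t)%E.
    by rewrite mule_ge0 ?lee_fin ?poisson_ge0 ?boundary_profile_ge0.
  apply: (@le_trans _ _ (\int[mu]_(t in J) ((poisson x t)%:E * boundary_profile t))%E).
    apply: ge0_le_integral => //.
    - by move=> t _; rewrite mule_ge0 ?(profile_ge0 HPsi)// lee_fin invr_ge0 mulr_ge0// ltW.
    - exact: measurable_funS mF.
  exact: ge0_subset_integral.
rewrite /J lebesgue_measure_itv/= lte_fin ltrDl divr_gt0//.
rewrite -EFinB addrAC subrr add0r -(fineK Pfin) -!EFinM !lee_fin.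
have -> : (144 * e)^-1 * fine (Psi (distE x E)) * (e / 4) = fine (Psi (distE x E)) / 576.
  by field; rewrite gt_eqF.
by move: (fine _) (kernel_integral _ _ _ _) => p k; lra.
Qed.

End DiskMajorant.

Lemma laplacian_addr (R : realType) (g : R * R -> R) (c : R) z :
  laplacian (fun w => g w + c) z = laplacian g z.
Proof.
have D v : (fun w => 'D_v (fun w => g w + c) w) = (fun w => 'D_v g w).
  apply/funext => w; rewrite /derive.
  set h1 := fun h => h^-1 *: _; set h2 := fun h => h^-1 *: _.
  suff -> : h1 = h2 by [].
  by apply/funext => h; rewrite /h1 /h2 /= opprD addrACA subrr addr0.
by rewrite /laplacian !D.
Qed.

Theorem disk_harmonic_majorant (R : realType) (u : R * R -> \bar R) (Psi : R -> \bar R)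
    (E : set (R * R)) :
  E !=set0 -> E `<=` @circle R -> majorant_profile 2 Psi ->
  (forall x, disk x -> (u x <= Psi (dist_set (@cdist R) x E))%E) ->
  (\int[@arc_measure R]_(xi in @circle R) Psi (dist_set (@cdist R) xi E) < +oo)%E ->
  exists h, disk_harmonic h /\ forall x, disk x -> (u x <= (h x)%:E)%E.
Proof.
move=> E0 EC HPsi uPsi.
rewrite (integral_arc_measure E0 EC HPsi) => Ioo.
have I0 : (0 <= \int[@lebesgue_measure R]_(t in `[0%R, (2 * pi)%R]) boundary_profile E Psi t)%E.
  by apply: integral_ge0 => t _; exact: boundary_profile_ge0.
have {}Ioo : (\int[@lebesgue_measure R]_(t in `[0%R, (2 * pi)%R]) boundary_profile E Psi t < +oo)%E.
  move: I0 Ioo; case: integral => [r _ _|_|//]; first by rewrite ltry.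
  by rewrite gt0_muley// lte_fin invr_gt0 two_pi_gt0.
(* Finite because [Psi] is infinite only at [0]; by monotonicity it bounds [u] at distance at least
   [1/4] from [E]. *)
pose c := fine (Psi 4^-1).
have q2 : 0 <= (4^-1 : R) <= 2 by apply/andP; split; lra.
have cE : c%:E = Psi 4^-1.
  rewrite /c fineK// ge0_fin_numE ?(profile_ge0 HPsi)// ltey; apply/eqP.
  by move=> /(profile_infty HPsi q2)/eqP; rewrite invr_eq0 pnatr_eq0.
have c0 : 0 <= c by rewrite -lee_fin cE (profile_ge0 HPsi).
set f : measurableTypeR R -> R := fine \o boundary_profile E Psi.
pose B : set (measurableTypeR R) := `[0%R, (2 * pi)%R]%classic.
have mB : measurable B by exact: measurable_itv.
have muB : (@lebesgue_measure R B = (2 * pi)%:E)%E.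
  by rewrite /B lebesgue_measure_itv/= lte_fin two_pi_gt0 -EFinB subr0.
have intf : (@lebesgue_measure R).-integrable B (EFin \o f).
  exact: integrable_fine_boundary_profile.
have f0 t : 0 <= f t by rewrite fine_ge0// boundary_profile_ge0.
have [C C0 HC] := le_kernel_integral_boundary_profile E0 EC HPsi Ioo.
(* Against the kernel [P + c], the expansion of [(P + c) * (C * f + 1)] has nonnegative terms only.
   The term [C * P * f] majorises [u] near [E], and [c], integrated over a length [2 * pi >= 1],
   does so elsewhere. *)
pose g t := C * f t + 1.
have int1 : (@lebesgue_measure R).-integrable B (EFin \o cst 1).
  apply/integrableP; split; first exact/measurable_EFinP.
  under eq_integral do rewrite /= normr1.
  rewrite integral_cst// mul1e; apply: (@le_lt_trans _ _ (2 * pi)%:E); last exact: ltry.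
  by rewrite -muB.
have intg : (@lebesgue_measure R).-integrable B (EFin \o g).
  have := integrableD mB (integrableZl mB C intf) int1.
  by apply: eq_integrable => // t _; rewrite /= EFinD EFinM.
pose K z t := @poisson R z t + c.
have sK : smooth_kernel 3 K.
  apply: smooth_kernelD; first exact: smooth_kernel_poisson.
  exact: (@smooth_kernel_cst _ _ _ `|c|).
have bK := smooth_kernel_bounded sK.
have bP := smooth_kernel_bounded (smooth_kernel_poisson R 0).
exists (kernel_integral B g K); split.
  apply: kernel_integral_harmonic => // z t Dz.
  by rewrite laplacian_addr laplacian_poisson.
move=> x Dx; rewrite (le_trans (uPsi x Dx))//.
have d2 : 0 <= dist_set (@cdist R) x E <= 2 by apply: dist_set_circle_le2 => //; exact: ltW.
have [dx|dx] := ltP (dist_set (@cdist R) x E) 4^-1.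
  rewrite (le_trans (HC x Dx dx))// lee_fin.
  have iP := integrable_kernel mB intf bP Dx.
  rewrite /kernel_integral -RintegralZl//.
  apply: le_Rintegral => //.
  - have := integrableZl mB C iP.
    by apply: eq_integrable => // t _; rewrite /= EFinM.
  - exact: integrable_kernel.
  - move=> t _; rewrite /K /g -subr_ge0.
    have -> : (poisson x t + c) * (C * f t + 1) - C * (poisson x t * f t) =
        poisson x t + c * (C * f t + 1) by ring.
    have Cf : 0 <= C * f t by exact: mulr_ge0.
    have P0 := poisson_ge0 t Dx.
    by apply: addr_ge0 => //; apply: mulr_ge0 => //; exact: addr_ge0.
have /andP[_ dE2] := d2.
have /andP[q0 _] := q2.
have uc : (Psi (dist_set (@cdist R) x E) <= c%:E)%E.
  by rewrite cE; exact: (profile_decr HPsi q0 dx dE2).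
apply: (le_trans uc); rewrite lee_fin.
rewrite (@le_trans _ _ (\int[@lebesgue_measure R]_(t in B) c))//.
  rewrite Rintegral_cst// (_ : fine _ = 2 * pi); last first.
    by rewrite -[RHS]/(fine (2 * pi)%:E) -muB.
  rewrite ler_peMr//; have := pi_ge2 R; lra.
apply: le_Rintegral => //.
- have := integrableZl mB c int1.
  by apply: eq_integrable => // t _; rewrite /= -EFinM mulr1.
- exact: integrable_kernel.
- move=> t _; rewrite /K /g -subr_ge0.
  have -> : (poisson x t + c) * (C * f t + 1) - c =
      poisson x t * (C * f t + 1) + c * (C * f t) by ring.
  have Cf : 0 <= C * f t by exact: mulr_ge0.
  have P0 := poisson_ge0 t Dx.
  exact: (addr_ge0 (mulr_ge0 P0 (addr_ge0 Cf ler01)) (mulr_ge0 c0 Cf)).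
Qed.

(** * Test functions and Green's formula *)

Section PlaneSmooth.
Variable R : realType.
Implicit Types (f g : R * R -> R) (F : R -> R) (k : nat).

Fixpoint line_smooth k F : Prop :=
  continuous F /\
  if k is k'.+1 then exists2 F', forall x, is_derive x (1 : R) F (F' x) & line_smooth k' F'
  else True.

Fixpoint plane_smooth k f : Prop :=
  continuous f /\
  if k is k'.+1 then exists g1 g2,
    [/\ forall z, is_derive z (e1 R) f (g1 z), forall z, is_derive z (e2 R) f (g2 z),
        plane_smooth k' g1 & plane_smooth k' g2]
  else True.

Lemma plane_smooth_Ck k f : plane_smooth k f -> Ck_on setT k f.
Proof.
elim: k f => [|k IH] f [cf]; first by move=> _ z _; exact: cf.
move=> [g1 [g2 [d1 d2 s1 s2]]].
have E1 : (fun z => 'D_(e1 R) f z) = g1 by apply/funext => z; case: (d1 z).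
have E2 : (fun z => 'D_(e2 R) f z) = g2 by apply/funext => z; case: (d2 z).
split; rewrite ?E1 ?E2; [|move=> z _|exact: IH|exact: IH].
  by move=> z _; exact: cf.
by split; [case: (d1 z)|case: (d2 z)].
Qed.

Lemma plane_smoothW k f : plane_smooth k.+1 f -> plane_smooth k f.
Proof.
elim: k f => [|k IH] f [cf [g1 [g2 [d1 d2 s1 s2]]]]; split => //.
by exists g1, g2; split => //; exact: IH.
Qed.

Lemma plane_smooth_cst k (c : R) : plane_smooth k (fun _ => c).
Proof.
elim: k c => [|k IH] c; (split; first by move=> z; exact: cvg_cst) => //.
exists (fun _ => 0), (fun _ => 0); split; [| |exact: IH|exact: IH].
- by move=> z; exact: is_derive_cst.
- by move=> z; exact: is_derive_cst.
Qed.

Lemma plane_smooth_fst k : plane_smooth k fst.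
Proof.
have c : continuous (fst : R * R -> R) by move=> z; exact: cvg_fst.
case: k => [//|k]; split => //.
exists (fun _ => 1), (fun _ => 0); split; [| |exact: plane_smooth_cst..].
- by move=> z; exact: is_derive_fst.
- by move=> z; exact: is_derive_fst.
Qed.

Lemma plane_smooth_snd k : plane_smooth k snd.
Proof.
have c : continuous (snd : R * R -> R) by move=> z; exact: cvg_snd.
case: k => [//|k]; split => //.
exists (fun _ => 0), (fun _ => 1); split; [| |exact: plane_smooth_cst..].
- by move=> z; exact: is_derive_snd.
- by move=> z; exact: is_derive_snd.
Qed.

Lemma plane_smoothD k f g : plane_smooth k f -> plane_smooth k g ->
  plane_smooth k (fun z => f z + g z).
Proof.
have c f' g' : continuous f' -> continuous g' -> continuous (fun z => f' z + g' z).
  by move=> cf cg z; apply: cvgD; [exact: cf|exact: cg].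
elim: k f g => [|k IH] f g; first by move=> [cf _] [cg _]; split => //; exact: c.
move=> [cf [f1 [f2 [df1 df2 sf1 sf2]]]] [cg [g1 [g2 [dg1 dg2 sg1 sg2]]]].
split; first exact: c.
exists (fun z => f1 z + g1 z), (fun z => f2 z + g2 z); split.
- by move=> z; have h1 := df1 z; have h2 := dg1 z; exact: is_deriveD.
- by move=> z; have h1 := df2 z; have h2 := dg2 z; exact: is_deriveD.
- exact: IH.
- exact: IH.
Qed.

Lemma plane_smoothM k f g : plane_smooth k f -> plane_smooth k g ->
  plane_smooth k (fun z => f z * g z).
Proof.
have c f' g' : continuous f' -> continuous g' -> continuous (fun z => f' z * g' z).
  by move=> cf cg z; apply: cvgM; [exact: cf|exact: cg].
elim: k f g => [|k IH] f g; first by move=> [cf _] [cg _]; split => //; exact: c.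
move=> sf sg; have := plane_smoothW sf; have := plane_smoothW sg.
move: sf sg => [cf [f1 [f2 [df1 df2 sf1 sf2]]]] [cg [g1 [g2 [dg1 dg2 sg1 sg2]]]] sg sf.
split; first exact: c.
exists (fun z => f z * g1 z + g z * f1 z), (fun z => f z * g2 z + g z * f2 z); split.
- by move=> z; have h1 := df1 z; have h2 := dg1 z; exact: is_deriveM.
- by move=> z; have h1 := df2 z; have h2 := dg2 z; exact: is_deriveM.
- by apply: plane_smoothD; exact: IH.
- by apply: plane_smoothD; exact: IH.
Qed.

Lemma plane_smooth_comp k F g : line_smooth k F -> plane_smooth k g ->
  plane_smooth k (F \o g).
Proof.
have c F' g' : continuous F' -> continuous g' -> continuous (F' \o g').
  by move=> cF cg z; exact: (continuous_comp (cg z) (cF (g' z))).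
elim: k F g => [|k IH] F g; first by move=> [cF _] [cg _]; split => //; exact: c.
move=> sF sg; have := plane_smoothW sg.
move: sF sg => [cF [F' dF sF]] [cg [g1 [g2 [dg1 dg2 sg1 sg2]]]] sg.
split; first exact: c.
exists (fun z => F' (g z) * g1 z), (fun z => F' (g z) * g2 z); split.
- by move=> z; exact: (is_derive_comp1 (dF _) (dg1 z)).
- by move=> z; exact: (is_derive_comp1 (dF _) (dg2 z)).
- by apply: plane_smoothM => //; exact: IH.
- by apply: plane_smoothM => //; exact: IH.
Qed.

Lemma line_smoothD k F G : line_smooth k F -> line_smooth k G ->
  line_smooth k (fun x => F x + G x).
Proof.
have c (F' G' : R -> R) : continuous F' -> continuous G' -> continuous (fun z => F' z + G' z).
  by move=> cf cg z; apply: cvgD; [exact: cf|exact: cg].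
elim: k F G => [|k IH] F G; first by move=> [cF _] [cG _]; split => //; exact: c.
move=> [cF [F' dF sF]] [cG [G' dG sG]]; split; first exact: c.
exists (fun x => F' x + G' x); last exact: IH.
by move=> z; have h1 := dF z; have h2 := dG z; exact: is_deriveD.
Qed.

Lemma line_smoothZ k (c : R) F : line_smooth k F -> line_smooth k (fun x => c * F x).
Proof.
elim: k F => [|k IH] F.
  by move=> [cF _]; split => // x; apply: cvgM; [exact: cvg_cst|exact: cF].
move=> [cF [F' dF sF]]; split; first by move=> x; apply: cvgM; [exact: cvg_cst|exact: cF].
exists (fun x => c * F' x); last exact: IH.
by move=> z; have h1 := dF z; exact: is_deriveZ.
Qed.

Lemma line_smooth_expR k : line_smooth k (@expR R).
Proof.
elim: k => [|k IH]; split => //; try exact: continuous_expR.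
by exists expR => // x; exact: is_derive_expR.
Qed.

(** The classical functions flat at [0]; with the index [k] their linear span is closed under
    differentiation. *)
Definition flat k (x : R) : R := if 0 < x then x ^- k * expR (- x^-1) else 0.

Lemma flat_ge0 k x : 0 <= flat k x.
Proof.
rewrite /flat; case: ifPn => // x0.
by rewrite mulr_ge0 ?expR_ge0// invr_ge0 exprn_ge0// ltW.
Qed.

(** The inequality [1 + y <= exp y] at [y = 1 / ((k + 2) x)], raised to the power [k + 2], lets the
    exponential absorb [x^-k] with a factor [x^2] to spare; a quadratic bound forces derivative [0]
    at the origin. *)
Lemma flat_le k x : flat k x <= (k.+2)%:R ^+ k.+2 * x ^+ 2.
Proof.
rewrite /flat; case: ifPn => x0; last first.
  by rewrite mulr_ge0 ?sqr_ge0// exprn_ge0.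
have h : (x^-1 / (k.+2)%:R) ^+ k.+2 <= expR (x^-1).
  rewrite [leRHS](_ : _ = expR (x^-1 / (k.+2)%:R) ^+ k.+2); last first.
    by rewrite -expRM_natr divfK// gt_eqF.
  have q0 : 0 <= x^-1 / (k.+2)%:R by rewrite divr_ge0 ?invr_ge0 ?ltW.
  rewrite lerXn2r ?nnegrE ?expR_ge0//.
  by apply: le_trans (expR_ge1Dx _); rewrite lerDr.
rewrite expRN.
have h2 : (expR x^-1)^-1 <= ((x^-1 / (k.+2)%:R) ^+ k.+2)^-1.
  by rewrite lef_pV2 ?posrE ?expR_gt0// exprn_gt0// divr_gt0 ?invr_gt0.
have xk : 0 <= x ^- k by rewrite invr_ge0 exprn_ge0// ltW.
apply: le_trans (ler_wpM2l xk h2) _.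
rewrite le_eqVlt; apply/orP; left; apply/eqP.
rewrite expr_div_n exprVn invf_div invrK mulrCA; congr (_ * _).
by rewrite -addn2 exprD mulKf// expf_neq0// gt_eqF.
Qed.

Lemma is_derive_flat k x :
  is_derive x (1 : R) (flat k) (flat k.+2 x - k%:R * flat k.+1 x).
Proof.
have [x0|x0|->] := ltgtP x 0.
- have flat0 j : flat j x = 0 by rewrite /flat ltNge (ltW x0).
  rewrite !flat0 mulr0 subr0.
  apply: (near_eq_is_derive (f := cst 0)).
  near=> y; rewrite /= /flat; case: ifPn => // y0.
  have : y < 0 by near: y; exact: lt_nbhsl.
  by move=> /(lt_trans y0); rewrite ltxx.
- have flatE j y : 0 < y -> flat j y = y ^- j * expR (- y^-1) by move=> y0; rewrite /flat y0.
  rewrite !flatE//.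
  apply: (near_eq_is_derive (f := (fun y => y^-1) ^+ k * (expR \o (fun y => - y^-1)))).
    near=> y; rewrite !fctE/= flatE ?exprVn//.
    by near: y; exact: lt_nbhsr.
  have xN : x != 0 by rewrite gt_eqF.
  have dV : is_derive x 1 (fun y : R => y^-1) (- x ^- 2).
    have dI : derivable (@id R) x 1 by exact: derivable_id.
    apply: DeriveDef; first exact: (derivableV xN dI).
    by have := deriveV xN dI; rewrite derive_id /GRing.scale/= mulr1.
  have dN := is_deriveN dV.
  have dE := @is_derive1_comp R expR (fun y => - y^-1) x _ _ (is_derive_expR _) dN.
  have dX := is_deriveX k dV.
  apply: (is_derive_eq (is_deriveM dX dE)).
  rewrite /= !fctE /GRing.scale/= opprK.
  rewrite -!exprVn; case: k dX => [|k] dX; rewrite /= !exprS ?expr0; ring.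
- have flat0 j : flat j 0 = 0 by rewrite /flat ltxx.
  rewrite !flat0 mulr0 subr0.
  have H : h^-1 *: (flat k (h + 0) - flat k 0) @[h --> 0^'] --> (0 : R).
    apply/cvgrPdist_le => e e0.
    pose M : R := (k.+2)%:R ^+ k.+2.
    have M0 : 0 < M by rewrite exprn_gt0.
    near=> h.
    rewrite sub0r normrN addr0 flat0 subr0 normrM normfV.
    rewrite (ger0_norm (flat_ge0 _ _)).
    have hN : h != 0 by near: h; exact: nbhs_dnbhs_neq.
    have hp : 0 < `|h| by rewrite normr_gt0.
    rewrite mulrC ler_pdivrMr// (le_trans (flat_le k h))// -/M.
    rewrite -(real_normK (num_real h)) expr2 mulrA ler_wpM2r// mulrC -ler_pdivlMr//.
    near: h; apply: dnbhs0_le; by rewrite divr_gt0.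
  have E : 'D_1 (flat k) 0 = 0.
    rewrite /derive; apply: cvg_lim; first exact: norm_hausdorff.
    move: H; apply: cvg_trans; apply: near_eq_cvg; near=> h.
    by rewrite /= scaler1.
  rewrite -[X in is_derive _ _ _ X]E; apply: derivableP.
  apply/cvg_ex; exists 0; move: H; apply: cvg_trans; apply: near_eq_cvg; near=> h.
  by rewrite /= scaler1.
Unshelve. all: by end_near. Qed.

Lemma line_smooth_flat m k : line_smooth m (flat k).
Proof.
have c j : continuous (flat j).
  move=> x; apply/differentiable_continuous/derivable1_diffP.
  by case: (is_derive_flat j x).
elim: m k => [|m IH] k; split => //.
exists (fun x => flat k.+2 x + - k%:R * flat k.+1 x).
  by move=> x; rewrite mulNr; exact: is_derive_flat.
by apply: line_smoothD => //; exact: line_smoothZ.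
Qed.

End PlaneSmooth.

(** * Radial test functions *)

Section TestFunctions.
Variable R : realType.
Implicit Types (z : R * R) (a s x : R).

(** A smooth convex substitute for the positive part: zero for [x <= 0], at least [x - 1], and with
    slope between [0] and [1]. *)
Definition flat_ramp x : R := x * flat 0 x.

Lemma flat_mul k x : x * flat k.+1 x = flat k x.
Proof.
rewrite /flat; case: ifPn => x0; last by rewrite mulr0.
by rewrite mulrA exprS invfM mulVKf// gt_eqF.
Qed.

Lemma is_derive_flat_ramp x : is_derive x (1 : R) flat_ramp (flat 0 x + flat 1 x).
Proof.
have h1 := is_derive_flat 0 x.
have h := @is_deriveM R _ (@id R) (flat 0) x 1 _ _ (is_derive_id x 1) h1.
apply: (is_derive_eq h); rewrite /GRing.scale/= mul0r subr0 flat_mul mulr1 addrC.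
by [].
Qed.

(** The [flat 2] terms cancel, and what remains is nonnegative: the ramp is convex. *)
Lemma is_derive_flat_ramp' x : is_derive x (1 : R) (fun x => flat 0 x + flat 1 x) (flat 3 x).
Proof.
have h := is_deriveD (is_derive_flat 0 x) (is_derive_flat 1 x).
by apply: (is_derive_eq h); rewrite mul0r subr0 mul1r addrC subrK.
Qed.

Lemma line_smooth_flat_ramp k : line_smooth k flat_ramp.
Proof.
have c : continuous flat_ramp.
  move=> x; apply/differentiable_continuous/derivable1_diffP.
  by case: (is_derive_flat_ramp x).
case: k => [//|k]; split => //.
exists (fun x => flat 0 x + flat 1 x); first exact: is_derive_flat_ramp.
by apply: line_smoothD; exact: line_smooth_flat.
Qed.

Lemma flat_eq0 k x : x <= 0 -> flat k x = 0.
Proof. by move=> x0; rewrite /flat ltNge x0. Qed.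

Lemma flat_ramp_eq0 x : x <= 0 -> flat_ramp x = 0.
Proof. by move=> x0; rewrite /flat_ramp flat_eq0// mulr0. Qed.

Lemma flat_ramp_ge0 x : 0 <= flat_ramp x.
Proof.
have [x0|x0] := leP x 0; first by rewrite flat_ramp_eq0.
by rewrite mulr_ge0 ?flat_ge0// ltW.
Qed.

Lemma flat_ramp_ge x : x - 1 <= flat_ramp x.
Proof.
have [x0|x0] := leP x 0; first by rewrite flat_ramp_eq0//; lra.
rewrite /flat_ramp /flat x0 expr0 invr1 mul1r.
have -> : x - 1 = x * (1 + - x^-1) by rewrite mulrDr mulr1 mulrN mulfV// gt_eqF.
by rewrite ler_wpM2l ?(ltW x0)// expR_ge1Dx.
Qed.

Lemma flat_ramp'_le1 x : flat 0 x + flat 1 x <= 1.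
Proof.
have [x0|x0] := leP x 0; first by rewrite !flat_eq0// addr0.
rewrite /flat x0 expr0 invr1 expr1 -mulrDl expRN ler_pdivrMr ?expR_gt0// mul1r.
exact: expR_ge1Dx.
Qed.

Lemma is_derive_sqnorm z v :
  is_derive z v (fun w : R * R => w.1 ^+ 2 + w.2 ^+ 2) (2 * z.1 * v.1 + 2 * z.2 * v.2).
Proof.
have h := is_deriveD (is_deriveX 2 (is_derive_fst z v)) (is_deriveX 2 (is_derive_snd z v)).
by apply: (is_derive_eq h); rewrite /GRing.scale/= !expr1.
Qed.

Lemma plane_smooth_sqnorm k : plane_smooth k (fun z : R * R => z.1 ^+ 2 + z.2 ^+ 2).
Proof.
have -> : (fun z : R * R => z.1 ^+ 2 + z.2 ^+ 2) = (fun z => z.1 * z.1 + z.2 * z.2).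
  by apply/funext => z; rewrite !expr2.
by apply: plane_smoothD; apply: plane_smoothM;
  (exact: plane_smooth_fst || exact: plane_smooth_snd).
Qed.

Lemma laplacian_radial (F F' F'' : R -> R) z :
  (forall s, is_derive s (1 : R) F (F' s)) -> (forall s, is_derive s (1 : R) F' (F'' s)) ->
  let s := z.1 ^+ 2 + z.2 ^+ 2 in
  laplacian (fun w => F (w.1 ^+ 2 + w.2 ^+ 2)) z = 4 * (s * F'' s + F' s).
Proof.
move=> dF dF' s.
pose S (w : R * R) := w.1 ^+ 2 + w.2 ^+ 2.
pose L v (w : R * R) := 2 * w.1 * v.1 + 2 * w.2 * v.2.
have D1 v w : 'D_v (F \o S) w = F' (S w) * L v w.
  by case: (is_derive_comp1 (dF _) (is_derive_sqnorm w v)).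
have D2 v : 'D_v (fun w => 'D_v (F \o S) w) z =
    F' s * (2 * v.1 * v.1 + 2 * v.2 * v.2) + L v z * (F'' s * L v z).
  have -> : (fun w => 'D_v (F \o S) w) = (F' \o S) * L v.
    by apply/funext => w; rewrite D1.
  have hL : is_derive z v (L v) (2 * v.1 * v.1 + 2 * v.2 * v.2).
    have h := is_derive_affine (2 * v.1) (2 * v.2) 0 z v.
    have -> : L v = (fun w => 2 * v.1 * w.1 + 2 * v.2 * w.2 + 0).
      by apply/funext => w; rewrite /L; ring.
    exact: h.
  by case: (is_deriveM (is_derive_comp1 (dF' _) (is_derive_sqnorm z v)) hL).
have := D2 (e1 R); have := D2 (e2 R).
rewrite /laplacian -/(F \o S) /L /= => -> ->; rewrite /s; ring.
Qed.

(** A smooth cut-off of [exp (2 (1 - |z|^2)) - 1]: the ramp vanishes where this is at most [1 / a],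
    that is, near the circle. Large [a] removes the cut-off. *)
Definition exhaust a z : R :=
  a^-1 * flat_ramp (a * (expR (2 * (1 - (z.1 ^+ 2 + z.2 ^+ 2))) - 1) - 1).

Lemma plane_smooth_exhaust a k : plane_smooth k (exhaust a).
Proof.
have pc (c : R) : plane_smooth k (fun _ => c) := plane_smooth_cst k c.
apply: plane_smoothM => //.
apply: (plane_smooth_comp (F := flat_ramp)); first exact: line_smooth_flat_ramp.
apply: plane_smoothD => //; apply: plane_smoothM => //; apply: plane_smoothD => //.
apply: (plane_smooth_comp (F := expR)); first exact: line_smooth_expR.
apply: plane_smoothM => //; apply: plane_smoothD => //.
have -> : (fun z => - (z.1 ^+ 2 + z.2 ^+ 2)) = (fun z => -1 * (z.1 ^+ 2 + z.2 ^+ 2)).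
  by apply/funext => z; rewrite mulN1r.
by apply: plane_smoothM => //; exact: plane_smooth_sqnorm.
Qed.

Lemma laplacian_exhaust_ge a z : 0 < a ->
  (if 2^-1 <= z.1 ^+ 2 + z.2 ^+ 2 then 0 else - (8 * expR 2)) <= laplacian (exhaust a) z.
Proof.
move=> a0.
pose w s := expR (2 * (1 - s)).
pose X s := a * (w s - 1) - 1.
have dw s : is_derive s (1 : R) w (-2 * w s).
  have h : is_derive s (1 : R) (fun s => 2 * (1 - s)) (2 * (0 - 1)).
    exact: (is_deriveZ 2 (is_deriveB (is_derive_cst (1 : R) s (1 : R)) (is_derive_id s (1 : R)))).
  by apply: (is_derive_eq (is_derive1_comp (is_derive_expR _) h)); rewrite /w; ring.
have dX s : is_derive s (1 : R) X (a * (-2 * w s)).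
  have h := is_deriveB (is_deriveZ a (is_deriveB (dw s) (is_derive_cst (1 : R) s (1 : R)))) (is_derive_cst (1 : R) s (1 : R)).
  by apply: (is_derive_eq h); rewrite /GRing.scale/= !subr0.
have dF s : is_derive s (1 : R) (fun s => a^-1 * flat_ramp (X s))
    ((flat 0 (X s) + flat 1 (X s)) * (-2 * w s)).
  have h := is_deriveZ a^-1 (is_derive1_comp (is_derive_flat_ramp (X s)) (dX s)).
  apply: (is_derive_eq h); rewrite /GRing.scale/= mulrCA; congr (_ * _).
  by rewrite mulKf// gt_eqF.
have dF' s : is_derive s (1 : R) (fun s => (flat 0 (X s) + flat 1 (X s)) * (-2 * w s))
    ((flat 0 (X s) + flat 1 (X s)) * (-2 * (-2 * w s)) +
     (-2 * w s) * (flat 3 (X s) * (a * (-2 * w s)))).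
  exact: (is_deriveM (is_derive1_comp (is_derive_flat_ramp' (X s)) (dX s)) (is_deriveZ (-2) (dw s))).
have := laplacian_radial z dF dF' => /=.
rewrite -/(exhaust a) => ->.
set s := z.1 ^+ 2 + z.2 ^+ 2.
have s0 : 0 <= s by rewrite addr_ge0 ?sqr_ge0.
set f3 := flat 3 (X s); set f := flat 0 (X s) + flat 1 (X s).
have f30 : 0 <= f3 := flat_ge0 _ _.
have f0 : 0 <= f by rewrite addr_ge0 ?flat_ge0.
have f1 : f <= 1 := flat_ramp'_le1 _.
have w0 : 0 <= w s := expR_ge0 _.
(* The first term is the slope [f] of the ramp times the Laplacian [8 * w * (2 * s - 1)] of the
   exponential, which changes sign at [s = 1/2]; the second comes from convexity of the ramp. On the
   core, [f <= 1] and [w <= exp 2] give the constant [8 * expR 2]. *)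
have -> : 4 * (s * (f * (-2 * (-2 * w s)) + -2 * w s * (f3 * (a * (-2 * w s)))) + f * (-2 * w s)) =
   8 * (f * w s) * (2 * s - 1) + 16 * (s * f3 * (a * (w s * w s))) by ring.
have t0 : 0 <= 16 * (s * f3 * (a * (w s * w s))).
  by rewrite mulr_ge0// mulr_ge0 ?mulr_ge0// ltW.
rewrite ler_wpDr//.
case: ifPn => hs.
  by rewrite mulr_ge0 ?mulr_ge0//; lra.
have we : w s <= expR 2 by rewrite /w ler_expR; lra.
have fw0 : 0 <= f * w s by rewrite mulr_ge0.
nra.
Qed.

Lemma exhaust_ge0 a z : 0 < a -> 0 <= exhaust a z.
Proof. by move=> a0; rewrite mulr_ge0 ?flat_ramp_ge0// invr_ge0 ltW. Qed.

Lemma exhaust_ge a z : 0 < a ->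
  2 * (1 - (z.1 ^+ 2 + z.2 ^+ 2)) - 2 / a <= exhaust a z.
Proof.
move=> a0; rewrite /exhaust ler_pdivlMl//.
apply: le_trans (flat_ramp_ge _).
set s := z.1 ^+ 2 + z.2 ^+ 2; have h := expR_ge1Dx (2 * (1 - s)).
have -> : a * (2 * (1 - s) - 2 / a) = a * (2 * (1 - s)) - 1 - 1 by field; rewrite gt_eqF.
by rewrite !lerB// ler_wpM2l ?(ltW a0)// lerBrDl.
Qed.

Lemma disk_test_radial (phi : R * R -> R) (r : R) : r < 1 ->
  (forall k, plane_smooth k phi) -> (forall z, r < cdist z (0, 0) -> phi z = 0) ->
  disk_test phi.
Proof.
move=> r1 sphi phi0; split; first by move=> k; exact: plane_smooth_Ck.
exists [set z | cdist z (0, 0) <= r]; split; first exact: closed_disk_compact.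
  by move=> z /= /le_lt_trans; exact.
by move=> z /negP; rewrite -ltNge; exact: phi0.
Qed.

Lemma disk_test_exhaust a : 0 < a -> disk_test (exhaust a).
Proof.
(* For [|z|^2 >= 1 - e] the exponential is at most [1 + a^-1], so the ramp vanishes. If [e > 1], the
   radius [Num.sqrt (1 - e)] takes the value [0], which is still correct. *)
move=> a0; pose e := ln (1 + a^-1) / 2.
have a1 : 1 < 1 + a^-1 by rewrite ltrDl invr_gt0.
have e0 : 0 < e by rewrite divr_gt0// ln_gt0.
apply: (@disk_test_radial _ (Num.sqrt (1 - e))); last 2 first.
- exact: plane_smooth_exhaust.
- move=> z hz.
  have h : 1 - e < z.1 ^+ 2 + z.2 ^+ 2.
    have [n0|n0] := leP 0 (1 - e); last first.
      by apply: lt_le_trans n0 _; rewrite addr_ge0 ?sqr_ge0.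
    have := cdist_sqr z (0, 0); rewrite !subr0 => <-.
    by rewrite -(sqr_sqrtr n0) ltrXn2r// ?nnegrE ?sqrtr_ge0 ?cdist_ge0.
  rewrite /exhaust flat_ramp_eq0 ?mulr0//.
  rewrite subr_le0 -ler_pdivlMl// mulr1 lerBlDl.
  rewrite -(@lnK R (1 + a^-1)) ?posrE ?addr_gt0 ?invr_gt0//.
  rewrite ler_expR (_ : ln (1 + a^-1) = 2 * e); last by rewrite /e mulrC divfK.
  by rewrite ler_wpM2l//; lra.
- by rewrite -[ltRHS]sqrtr1 ltr_sqrt// ltrBlDr ltrDl.
Qed.

(** Supported in [|z|^2 <= 7/8]. On [|z|^2 <= 1/2] the ramp is evaluated at points at least [3], far
    enough out for its slope to outweigh its curvature in the radial Laplacian. *)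
Definition core_test z : R := flat_ramp (7 - 8 * (z.1 ^+ 2 + z.2 ^+ 2)).

Lemma core_test_ge0 z : 0 <= core_test z.
Proof. exact: flat_ramp_ge0. Qed.

Lemma core_test_le z : core_test z <= 7.
Proof.
rewrite /core_test; set s := z.1 ^+ 2 + z.2 ^+ 2.
have s0 : 0 <= s by rewrite addr_ge0 ?sqr_ge0.
have [x0|x0] := leP (7 - 8 * s) 0; first by rewrite flat_ramp_eq0.
have h : flat 0 (7 - 8 * s) <= 1.
  have := flat_ramp'_le1 (7 - 8 * s); have := flat_ge0 1 (7 - 8 * s); lra.
rewrite /flat_ramp; have := flat_ge0 0 (7 - 8 * s); nra.
Qed.

Lemma core_test_eq0 z : 19 / 20 < cdist z (0, 0) -> core_test z = 0.
Proof.
move=> hz; apply: flat_ramp_eq0.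
have := cdist_sqr z (0, 0); rewrite !subr0 => <-; nra.
Qed.

Lemma plane_smooth_core_test k : plane_smooth k core_test.
Proof.
have pc (c : R) : plane_smooth k (fun _ => c) := plane_smooth_cst k c.
apply: (plane_smooth_comp (F := flat_ramp)); first exact: line_smooth_flat_ramp.
apply: plane_smoothD => //.
have -> : (fun z => - (8 * (z.1 ^+ 2 + z.2 ^+ 2))) = (fun z => - 8 * (z.1 ^+ 2 + z.2 ^+ 2)).
  by apply/funext => z; rewrite mulNr.
by apply: plane_smoothM => //; exact: plane_smooth_sqnorm.
Qed.

Lemma disk_test_core : disk_test core_test.
Proof.
apply: (@disk_test_radial _ (19 / 20)); first by lra.
  exact: plane_smooth_core_test.
exact: core_test_eq0.
Qed.

(** With [X = 7 - 8 s >= 3] and [f = flat 3 X], the radial formula becomes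
    [32 f (7 - X - X^3 - X^2)]. Here [7 - X <= X^2], and [f X^3 = exp (- 1 / X) >= 2/3]. *)
Lemma laplacian_core_test_le z : z.1 ^+ 2 + z.2 ^+ 2 <= 2^-1 ->
  laplacian core_test z <= -1.
Proof.
pose X s := 7 - 8 * s.
have dX s : is_derive s (1 : R) X (- 8).
  have h := is_deriveB (is_derive_cst (7 : R) s (1 : R)) (is_deriveZ 8 (is_derive_id s (1 : R))).
  by apply: (is_derive_eq h); rewrite /GRing.scale/= sub0r mulr1.
have dF s : is_derive s (1 : R) (fun s => flat_ramp (X s)) ((flat 0 (X s) + flat 1 (X s)) * (-8)).
  exact: (is_derive1_comp (is_derive_flat_ramp (X s)) (dX s)).
have dF' s : is_derive s (1 : R) (fun s => (flat 0 (X s) + flat 1 (X s)) * (-8)) (flat 3 (X s) * (-8) * (-8)).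
  have h := is_deriveZ (-8) (is_derive1_comp (is_derive_flat_ramp' (X s)) (dX s)).
  have -> : (fun s => (flat 0 (X s) + flat 1 (X s)) * -8) = (fun s => -8 * (flat 0 (X s) + flat 1 (X s))).
    by apply/funext => t; rewrite mulrC.
  by apply: (is_derive_eq h); rewrite /GRing.scale/= mulrC.
have := laplacian_radial z dF dF' => /=.
rewrite -/core_test => ->.
set s := z.1 ^+ 2 + z.2 ^+ 2 => s2.
have s0 : 0 <= s by rewrite addr_ge0 ?sqr_ge0.
have X3 : 3 <= X s by rewrite /X; lra.
have X0 : 0 < X s by lra.
have sX : 8 * s = 7 - X s by rewrite /X; ring.
rewrite -(flat_mul 0) -(flat_mul 1) -(flat_mul 2).
set f := flat 3 (X s).
have fX : 2 / 3 <= f * (X s) ^+ 3.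
  rewrite /f /flat X0 mulrAC mulVf ?mul1r ?expf_neq0 ?gt_eqF//.
  apply: le_trans (expR_ge1Dx _).
  have : (X s)^-1 <= 3^-1 by rewrite lef_pV2 ?posrE.
  lra.
have f0 : 0 <= f := flat_ge0 _ _.
have -> : 4 * (s * (f * -8 * -8) + (X s * (X s * (X s * f)) + X s * (X s * f)) * -8) =
    32 * (f * (8 * s)) - 32 * (f * X s ^+ 3) - 32 * (f * X s ^+ 2) by ring.
rewrite sX.
have h : f * (7 - X s) <= f * (X s ^+ 2).
  by rewrite ler_wpM2l//; nra.
lra.
Qed.

End TestFunctions.

(** * Green's formula against compactly supported test functions *)

Section Green.
Variable R : realType.
Local Notation mu := (@lebesgue_measure R).
Local Notation plane := (measurableTypeR R * measurableTypeR R)%type.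
Implicit Types (z v : R * R).

Lemma measurable_disk : measurable (@disk R : set plane).
Proof. by apply: open_measurable_plane; exact: disk_open. Qed.

Lemma leb2_disk_lty : (@leb2 R (@disk R) < +oo)%E.
Proof.
pose I : set (measurableTypeR R) := `[-1, 1]%classic.
have mI : measurable I by exact: measurable_itv.
have h : mu I = (2 : R)%:E.
  rewrite /I lebesgue_measure_itv/= lte_fin ifT; first by rewrite -EFinB; congr EFin; lra.
  by lra.
apply: (@le_lt_trans _ _ (@leb2 R (I `*` I))).
  apply: le_measure; [rewrite inE; exact: measurable_disk|rewrite inE; exact: measurableX|].
  move=> z /= /ltW zd; rewrite /disk/=; split; rewrite /I /= in_itv/= -ler_norml.
    by have := cdist_ge1 z (0, 0); rewrite /= subr0 => /le_trans; exact.
  by have := cdist_ge2 z (0, 0); rewrite /= subr0 => /le_trans; exact.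
rewrite (_ : @leb2 R (I `*` I) = ((2 : R)%:E * (2 : R)%:E)%E); first by rewrite -EFinM ltry.
by rewrite -h; exact: product_measure1E.
Qed.

Lemma bounded_closed_disk (f : R * R -> R) : continuous f ->
  exists M, forall z, cdist z (0, 0) <= 1 -> `|f z| <= M.
Proof.
move=> cf.
have : compact (f @` [set z | cdist z (0, 0) <= 1]).
  apply: continuous_compact; last exact: closed_disk_compact.
  exact: continuous_subspaceT.
move=> /compact_bounded[M [_ hM]]; exists (M + 1) => z z1.
by apply: (hM (M + 1)); [rewrite ltrDl|exists z].
Qed.

Lemma integrable_continuous_disk (f : R * R -> R) : continuous f ->
  (@leb2 R).-integrable (@disk R) (EFin \o f).
Proof.
move=> cf; have [M hM] := bounded_closed_disk cf.
apply: measurable_bounded_integrable.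
- exact: measurable_disk.
- exact: leb2_disk_lty.
- by apply: measurable_funTS; apply: (measurable_fun_cts_plane openT) => z _; exact: cf.
- exists M; split; first exact: num_real.
  by move=> x Mx z Dz; exact: le_trans (hM z (ltW Dz)) (ltW Mx).
Qed.

Lemma integral_derive_eq0 (G H : R -> R) :
  (forall x, is_derive x (1 : R) G (H x)) -> continuous H ->
  (forall x, 1 <= `|x| -> G x = 0 /\ H x = 0) ->
  (\int[mu]_x (H x)%:E = 0)%E.
Proof.
move=> dG cH GH0.
have cG : continuous G.
  by move=> x; apply/differentiable_continuous/derivable1_diffP; case: (dG x).
transitivity (\int[mu]_(x in `[(-1)%R, 1%R]) (H x)%:E)%E.
  rewrite [RHS]integral_mkcond; apply: eq_integral => x _.
  rewrite patchE; case: ifPn => //; rewrite notin_setE /= in_itv/= -ler_norml => /negP.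
  by rewrite -ltNge => /ltW/GH0[_ ->].
rewrite (@continuous_FTC2 _ H G (-1) 1).
- have n1 : 1 <= `|1 : R| by rewrite normr1.
  have n2 : 1 <= `|-1 : R| by rewrite normrN1.
  by rewrite (GH0 1 n1).1 (GH0 (-1) n2).1 subee.
- by lra.
- exact: continuous_subspaceT.
- split; first by move=> x _; case: (dG x).
    by apply: cvg_at_right_filter; exact: cG.
  by apply: cvg_at_left_filter; exact: cG.
- by move=> x _; rewrite derive1E; case: (dG x).
Qed.

(** Fubini, then the fundamental theorem of calculus on each horizontal line. *)
Lemma leb2_integral_derive1_eq0 (G H : R * R -> R) :
  (forall z, is_derive z (e1 R) G (H z)) -> continuous H ->
  (forall z, ~ disk z -> G z = 0 /\ H z = 0) ->
  (\int[@leb2 R]_(z in @disk R) (H z)%:E = 0)%E.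
Proof.
move=> dG cH GH0.
have E : (EFin \o H) \_ (@disk R) = EFin \o H.
  apply/funext => z; rewrite patchE; case: ifPn => //.
  by rewrite notin_setE => /GH0[_ /= ->].
have iH : (@leb2 R).-integrable setT (EFin \o H).
  rewrite -E; apply/(integrable_mkcond _ measurable_disk).
  exact: integrable_continuous_disk.
rewrite integral_mkcond E -(integral21_prod_meas1 iH).
apply: integral0_eq => y _; rewrite /fubini_G /=.
apply: (@integral_derive_eq0 (fun x => G (x, y)) (fun x => H (x, y))).
- by move=> x; exact/(is_derive_e1 G (x, y)).
- move=> x; apply: (continuous_comp (f := fun x => (x, y))); last exact: cH.
  by apply: (@cvg_pair _ _ _ (nbhs x) (nbhs x) (nbhs y) _ _ _ id (fun _ => y)); [exact: cvg_id|exact: cvg_cst].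
- move=> x x1; apply: GH0; rewrite /disk/= => /(le_lt_trans (cdist_ge1 _ _)) /=.
  by rewrite subr0 ltNge x1.
Qed.

Lemma leb2_integral_derive2_eq0 (G H : R * R -> R) :
  (forall z, is_derive z (e2 R) G (H z)) -> continuous H ->
  (forall z, ~ disk z -> G z = 0 /\ H z = 0) ->
  (\int[@leb2 R]_(z in @disk R) (H z)%:E = 0)%E.
Proof.
move=> dG cH GH0.
have E : (EFin \o H) \_ (@disk R) = EFin \o H.
  apply/funext => z; rewrite patchE; case: ifPn => //.
  by rewrite notin_setE => /GH0[_ /= ->].
have iH : (@leb2 R).-integrable setT (EFin \o H).
  rewrite -E; apply/(integrable_mkcond _ measurable_disk).
  exact: integrable_continuous_disk.
rewrite integral_mkcond E -(integral12_prod_meas1 iH).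
apply: integral0_eq => x _; rewrite /fubini_F /=.
apply: (@integral_derive_eq0 (fun y => G (x, y)) (fun y => H (x, y))).
- by move=> y; exact/(is_derive_e2 G (x, y)).
- move=> y; apply: (continuous_comp (f := fun y => (x, y))); last exact: cH.
  by apply: (@cvg_pair _ _ _ (nbhs y) (nbhs x) (nbhs y) _ _ _ (fun _ => x) id); [exact: cvg_cst|exact: cvg_id].
- move=> y y1; apply: GH0; rewrite /disk/= => /(le_lt_trans (cdist_ge2 _ _)) /=.
  by rewrite subr0 ltNge y1.
Qed.

Variables (K : set (R * R)).
Hypothesis cK : compact K.
Hypothesis KD : K `<=` @disk R.

Lemma near_notin_compact z : ~ K z -> \forall w \near z, ~ K w.
Proof.
move=> Kz; have oK : open (~` K).
  by rewrite openC; apply: compact_closed => //; exact: norm_hausdorff.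
by move: oK; rewrite openE => /(_ z Kz).
Qed.

Lemma near_patch_disk (g : R * R -> R) z : disk z ->
  \forall w \near z, g w = (g \_ (@disk R)) w.
Proof.
move=> Dz; have : nbhs z (@disk R) by apply: open_nbhs_nbhs; split => //; exact: disk_open.
by apply: filterS => w Dw; rewrite patchE mem_set.
Qed.

Lemma near_patch_notdisk (g : R * R -> R) z :
  (forall w, disk w -> ~ K w -> g w = 0) -> ~ disk z ->
  \forall w \near z, 0 = (g \_ (@disk R)) w.
Proof.
move=> g0 Dz; have Kz : ~ K z by move=> /KD.
have := near_notin_compact Kz; apply: filterS => w Kw.
rewrite patchE; case: ifPn => //; rewrite inE => Dw.
by rewrite g0.
Qed.

(** Nothing is known of a harmonic function outside the disk, so its products with a test function
    are extended by zero. As [K] is compact inside the disk, the extension vanishes near every point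
    outside it. *)
Lemma continuous_patch_disk (g : R * R -> R) :
  (forall w, disk w -> ~ K w -> g w = 0) ->
  (forall z, disk z -> {for z, continuous g}) -> continuous (g \_ (@disk R)).
Proof.
move=> g0 cg z; have [Dz|Dz] := pselect (disk z).
  rewrite /continuous_at {2}/patch mem_set//.
  have := cg z Dz; rewrite /prop_for /continuous_at; apply: cvg_trans; apply: near_eq_cvg.
  exact: near_patch_disk.
rewrite /continuous_at {2}/patch memNset//.
have : cst (0 : R) @ z --> (0 : R) by exact: cvg_cst.
apply: cvg_trans; apply: near_eq_cvg; exact: near_patch_notdisk.
Qed.

Lemma is_derive_patch_disk (g g' : R * R -> R) v :
  (forall w, disk w -> ~ K w -> g w = 0) ->
  (forall z, disk z -> is_derive z v g (g' z)) ->
  forall z, is_derive z v (g \_ (@disk R)) ((g' \_ (@disk R)) z).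
Proof.
move=> g0 dg z; have [Dz|Dz] := pselect (disk z).
  rewrite [X in is_derive _ _ _ X]patchE mem_set//.
  apply: (near_eq_is_derive (f := g)); last exact: dg.
  exact: near_patch_disk.
rewrite [X in is_derive _ _ _ X]patchE memNset//.
apply: (near_eq_is_derive (f := cst 0)).
exact: near_patch_notdisk.
Qed.

End Green.

(** [h * Delta phi - phi * Delta h] is the divergence of the field [(G1, G2)], in which the products
    of first derivatives cancel; both partial derivatives integrate to [0]. *)
Theorem integral_harmonic_laplacian (R : realType) (h phi : R * R -> R) :
  disk_harmonic h -> disk_test phi ->
  (@leb2 R).-integrable (@disk R) (EFin \o (fun z => h z * laplacian phi z)) /\
  (\int[@leb2 R]_(z in @disk R) (h z * laplacian phi z)%:E = 0)%E.
Proof.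
move=> [[ch dh [cd1h dd1h cd11h cd12h] [cd2h dd2h cd21h cd22h]] laph].
move=> [sphi [K [cK KD phi0]]].
have [cphi dphi [cd1p dd1p cd11p cd12p] [cd2p dd2p cd21p cd22p]] := sphi 2.
have near0 (g : R * R -> R) v : (forall z, ~ K z -> g z = 0) -> forall z, ~ K z -> 'D_v g z = 0.
  move=> g0 z Kz; rewrite -(derive_cst (0 : R) z v); apply: near_eq_derive.
  by apply: filterS (near_notin_compact cK Kz) => w; exact: g0.
have D1p0 := near0 _ (e1 R) phi0; have D2p0 := near0 _ (e2 R) phi0.
have D11p0 := near0 _ (e1 R) D1p0; have D22p0 := near0 _ (e2 R) D2p0.
pose G1 z := h z * 'D_(e1 R) phi z - phi z * 'D_(e1 R) h z.
pose G2 z := h z * 'D_(e2 R) phi z - phi z * 'D_(e2 R) h z.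
pose H1 z := h z * 'D_(e1 R) ('D_(e1 R) phi) z - phi z * 'D_(e1 R) ('D_(e1 R) h) z.
pose H2 z := h z * 'D_(e2 R) ('D_(e2 R) phi) z - phi z * 'D_(e2 R) ('D_(e2 R) h) z.
have G10 w : disk w -> ~ K w -> G1 w = 0.
  by move=> _ Kw; rewrite /G1 D1p0// phi0// mulr0 mul0r subr0.
have G20 w : disk w -> ~ K w -> G2 w = 0.
  by move=> _ Kw; rewrite /G2 D2p0// phi0// mulr0 mul0r subr0.
have H10 w : disk w -> ~ K w -> H1 w = 0.
  by move=> _ Kw; rewrite /H1 D11p0// phi0// mulr0 mul0r subr0.
have H20 w : disk w -> ~ K w -> H2 w = 0.
  by move=> _ Kw; rewrite /H2 D22p0// phi0// mulr0 mul0r subr0.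
have cross (a b c d p q : R) : a * d + b * c - (p * q + c * b) = a * d - p * q by ring.
have dG1 z : disk z -> is_derive z (e1 R) G1 (H1 z).
  move=> Dz; have [dh1 _] := dh z Dz; have [dp1 _] := dphi z I.
  have [dh11 _] := dd1h z Dz; have [dp11 _] := dd1p z I.
  have a := derivableP dh1; have b := derivableP dp1.
  have c := derivableP dh11; have d := derivableP dp11.
  apply: (is_derive_eq (is_deriveB (is_deriveM a d) (is_deriveM b c))).
  exact: cross.
have dG2 z : disk z -> is_derive z (e2 R) G2 (H2 z).
  move=> Dz; have [_ dh1] := dh z Dz; have [_ dp1] := dphi z I.
  have [_ dh11] := dd2h z Dz; have [_ dp11] := dd2p z I.
  have a := derivableP dh1; have b := derivableP dp1.
  have c := derivableP dh11; have d := derivableP dp11.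
  apply: (is_derive_eq (is_deriveB (is_deriveM a d) (is_deriveM b c))).
  exact: cross.
have cH1 : continuous (H1 \_ (@disk R)).
  apply: (continuous_patch_disk cK KD H10) => z Dz.
  apply: cvgB; apply: cvgM; [exact: ch|exact: cd11p|exact: cphi|exact: cd11h].
have cH2 : continuous (H2 \_ (@disk R)).
  apply: (continuous_patch_disk cK KD H20) => z Dz.
  apply: cvgB; apply: cvgM; [exact: ch|exact: cd22p|exact: cphi|exact: cd22h].
have p0 (g : R * R -> R) z : ~ disk z -> (g \_ (@disk R)) z = 0.
  by move=> Dz; rewrite patchE memNset.
have i1 := leb2_integral_derive1_eq0 (is_derive_patch_disk cK KD G10 dG1) cH1
  (fun z Dz => conj (p0 G1 z Dz) (p0 H1 z Dz)).
have i2 := leb2_integral_derive2_eq0 (is_derive_patch_disk cK KD G20 dG2) cH2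
  (fun z Dz => conj (p0 G2 z Dz) (p0 H2 z Dz)).
have E z : disk z -> h z * laplacian phi z = (H1 \_ (@disk R)) z + (H2 \_ (@disk R)) z.
  move=> Dz; transitivity (h z * laplacian phi z - phi z * laplacian h z).
    by rewrite laph// mulr0 subr0.
  have dist (a b p q r s : R) : a * (p + q) - b * (r + s) = (a * p - b * r) + (a * q - b * s).
    by ring.
  have pE (g : R * R -> R) : g z = (g \_ (@disk R)) z by rewrite patchE mem_set.
  transitivity (H1 z + H2 z); first exact: dist.
  by congr (_ + _); exact: pE.
have j1 := integrable_continuous_disk cH1; have j2 := integrable_continuous_disk cH2.
have mD := @measurable_disk R.
split.
  have := integrableD mD j1 j2; apply: eq_integrable => // z; rewrite inE => Dz.
  by rewrite /= E// EFinD.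
transitivity (\int[@leb2 R]_(z in @disk R) (((H1 \_ (@disk R)) z)%:E + ((H2 \_ (@disk R)) z)%:E))%E.
  by apply: eq_integral => z; rewrite inE => Dz; rewrite E// EFinD.
etransitivity; first exact: (integralD mD j1 j2).
transitivity (0 + 0 : \bar R)%E; last exact: adde0.
by congr (_ + _)%E; [exact: i1|exact: i2].
Qed.

(** * The first moment on the disk *)

Section IntegralComparison.
Context d (T : measurableType d) (R : realType) (m : {measure set T -> \bar R}).
Variables (D : set T) (mD : measurable D).
Implicit Types f g : T -> \bar R.

(** The smaller function may have integral [-oo]; comparing positive and negative parts separately
    still orders the integrals. *)
Lemma le_integral_integrable f g : measurable_fun D f -> m.-integrable D g ->
  (forall x, D x -> (f x <= g x)%E) ->
  (\int[m]_(x in D) f x <= \int[m]_(x in D) g x)%E.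
Proof.
move=> mf ig fg; have /integrableP[mg _] := ig.
have fg' : {in D, forall x, (f x <= g x)%E} by move=> x /set_mem; exact: fg.
rewrite integralE [leRHS]integralE; apply: leeB.
- apply: ge0_le_integral => //; try exact: measurable_funepos.
  by move=> x Dx; apply: (funepos_le fg'); exact: mem_set.
- apply: ge0_le_integral => //; try exact: measurable_funeneg.
  by move=> x Dx; apply: (funeneg_le fg'); exact: mem_set.
Qed.

(** Since [+oo - +oo] evaluates to [-oo], a finite value forces both the positive and the negative
    part to have finite integral. *)
Lemma integrable_of_fin_num f : measurable_fun D f ->
  (\int[m]_(x in D) f x)%E \is a fin_num -> m.-integrable D f.
Proof.
move=> mf; rewrite integralE => H.
have p0 : (0 <= \int[m]_(x in D) f^\+ x)%E by apply: integral_ge0 => x _; exact: funepos_ge0.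
have n0 : (0 <= \int[m]_(x in D) f^\- x)%E by apply: integral_ge0 => x _; exact: funeneg_ge0.
apply/integrableP; split => //.
have -> : (fun x => abse (f x)) = (fun x => (f^\+ x + f^\- x)%E) by exact: fune_abse.
rewrite ge0_integralD//; last 2 first.
- exact: measurable_funepos.
- exact: measurable_funeneg.
move: H p0 n0.
by case: (integral _ _ (f^\+)%E) => [p||]; case: (integral _ _ (f^\-)%E) => [n||]//= _ _ _; rewrite -EFinD ltry.
Qed.

End IntegralComparison.

Lemma measurable_usc_disk (R : realType) (u : R * R -> \bar R) :
  (forall z, disk z -> forall a : R, (u z < a%:E)%E -> \forall w \near z, (u w < a%:E)%E) ->
  measurable_fun (@disk R : set (measurableTypeR R * measurableTypeR R)) u.
Proof.
move=> usc; apply: (measurability _ (ErealGenInftyO.measurableE R)).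
move=> _ [_ [x ->] <-]; apply: open_measurable_plane.
rewrite openE => z [Dz]; rewrite /= in_itv/= => uz.
apply: filterI; first by apply: open_nbhs_nbhs; split => //; exact: disk_open.
by have := usc z Dz x uz; apply: filterS => w; rewrite /= in_itv/=.
Qed.

Section RieszMoment.
Variable R : realType.
Local Notation plane := (measurableTypeR R * measurableTypeR R)%type.
Local Notation D := (@disk R : set plane).
Local Notation sqnorm z := (z.1 ^+ 2 + z.2 ^+ 2).

Lemma dist_set_circle_le (z : R * R) : disk z ->
  dist_set (@cdist R) z (@circle R) <= 1 - sqnorm z.
Proof.
move=> Dz; have sE : sqnorm z = cdist z (0, 0) ^+ 2 by rewrite cdist_sqr !subr0.
have [z0|zN0] := eqVneq (cdist z (0, 0)) 0.
  have C1 : circle ((1, 0) : R * R).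
    by rewrite /circle/= /cdist/= !subr0 expr1n expr0n addr0 sqrtr1.
  rewrite (le_trans (dist_set_le (@cdist_ge0 R) z C1))//.
  have := cdist_triangle z (0, 0) (1, 0); rewrite (cdistC (0, 0)) C1 z0 sE z0; lra.
set r := cdist z (0, 0) in sE zN0 *.
have r0 : 0 <= r := cdist_ge0 _ _.
have r1 : r < 1 := Dz.
have C1 : circle ((z.1 / r, z.2 / r) : R * R).
  rewrite /circle/= /cdist/= !subr0 !expr_div_n -mulrDl sE divff ?sqrtr1//.
  by rewrite expf_neq0.
rewrite (le_trans (dist_set_le (@cdist_ge0 R) z C1))//.
have -> : cdist z (z.1 / r, z.2 / r) = 1 - r.
  apply/eqP; rewrite -(@eqrXn2 _ 2) ?cdist_ge0 ?subr_ge0 ?(ltW r1)//.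
  rewrite cdist_sqr /=.
  have -> : (z.1 - z.1 / r) ^+ 2 + (z.2 - z.2 / r) ^+ 2 = (z.1 ^+ 2 + z.2 ^+ 2) * (1 - r^-1) ^+ 2 by ring.
  by rewrite sE -exprMn mulrBr mulfV// mulr1 -sqrrN opprB.
rewrite sE; nra.
Qed.

Lemma continuous_laplacian (phi : R * R -> R) : (forall k, Ck_on setT k phi) ->
  continuous (laplacian phi).
Proof.
move=> /(_ 2)[_ _ [_ _ c11 _] [_ _ _ c22]] z.
by apply: cvgD; [exact: c11|exact: c22].
Qed.

Lemma measurable_cts_plane (f : R * R -> R) (B : set plane) : continuous f -> measurable_fun B f.
Proof.
move=> cf; apply: measurable_funTS.
by apply: (measurable_fun_cts_plane openT) => z _; exact: cf.
Qed.

Lemma continuous_sqnorm : continuous (fun z : R * R => sqnorm z).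
Proof. by have [] := plane_smooth_sqnorm R 0. Qed.

Let core : set plane := [set z | sqnorm z <= 2^-1].

Lemma core_disk : core `<=` D.
Proof.
move=> z /= h; rewrite /disk/= -(@ltr_pXn2r _ 2) ?nnegrE ?cdist_ge0//.
by rewrite cdist_sqr !subr0 expr1n; apply: le_lt_trans h _; lra.
Qed.

Lemma measurable_core : measurable core.
Proof.
have := measurable_cts_plane (B := setT) continuous_sqnorm measurableT
  (measurable_itv `]-oo, (2^-1 : R)]).
by rewrite setTI; congr measurable; apply/seteqP; split => z; rewrite /core /= in_itv.
Qed.

Lemma compact_core : compact (core : set (R * R)).
Proof.
rewrite (_ : core = [set z | cdist z (0, 0) <= Num.sqrt 2^-1]).
  exact: closed_disk_compact.
have E (z : R * R) : (cdist z (0, 0) <= Num.sqrt 2^-1) = (sqnorm z <= 2^-1).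
  rewrite -(@ler_pXn2r _ 2) ?nnegrE ?cdist_ge0 ?sqrtr_ge0//.
  by rewrite cdist_sqr !subr0 sqr_sqrtr// invr_ge0.
by apply/seteqP; split => z; rewrite /core /= E.
Qed.

Lemma integrable_core_cts (h : R * R -> R) : (forall z, disk z -> {for z, continuous h}) ->
  (@leb2 R).-integrable core (EFin \o h).
Proof.
move=> ch; have : compact (h @` core).
  apply: continuous_compact; last exact: compact_core.
  by apply: continuous_in_subspaceT => z /set_mem/core_disk; exact: ch.
move=> /compact_bounded[M [Mr hM]].
apply: measurable_bounded_integrable.
- exact: measurable_core.
- apply: le_lt_trans (leb2_disk_lty R); apply: le_measure.
  + by rewrite inE; exact: measurable_core.
  + by rewrite inE; exact: measurable_disk.
  + exact: core_disk.
- apply: (measurable_funS (@measurable_disk R) core_disk).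
  by apply: (measurable_fun_cts_plane (@disk_open R)).
- by exists M; split => // x Mx z cz; apply: (hM x Mx); exists z.
Qed.

Variables (u : R * R -> \bar R) (h : R * R -> R).
Hypothesis usc : forall z, disk z -> forall a : R, (u z < a%:E)%E ->
  \forall w \near z, (u w < a%:E)%E.
Hypothesis hh : disk_harmonic h.
Hypothesis uh : forall z, disk z -> (u z <= (h z)%:E)%E.
Variable m : {measure set plane -> \bar R}.
Hypothesis rm : disk_riesz u m.

Lemma measurable_mul_laplacian (phi : R * R -> R) : disk_test phi ->
  measurable_fun D (fun z => (u z * (laplacian phi z)%:E)%E).
Proof.
move=> [sphi _]; apply: emeasurable_funM; first exact: measurable_usc_disk.
by apply/measurable_EFinP; apply: measurable_cts_plane; exact: continuous_laplacian.
Qed.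

(** The pairing is finite because [core_test] is bounded and the Riesz measure is finite on a
    compact set containing its support. On the core its Laplacian is at most [-1], so the integrand
    dominates [|u|]. *)
Lemma integrable_core_subharmonic : (@leb2 R).-integrable core u.
Proof.
have tc := disk_test_core R.
have mf := measurable_mul_laplacian tc.
pose K : set plane := [set z | cdist z (0, 0) <= 19 / 20].
have KD : K `<=` @disk R by move=> z /= /le_lt_trans; apply; lra.
have cK : compact K := @closed_disk_compact R _.
have mK : measurable (K : set plane).
  have := measurable_cts_plane (B := setT) (@cdist_continuous R (0, 0)) measurableT
    (measurable_itv `]-oo, (19 / 20 : R)]).
  by rewrite setTI; congr measurable; apply/seteqP; split => z; rewrite /K /= in_itv.
have cc : continuous (@core_test R) by have [] := plane_smooth_core_test R 0.
have fin : (\int[m]_(z in D) (core_test z)%:E)%E \is a fin_num.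
  rewrite ge0_fin_numE; last by apply: integral_ge0 => z _; rewrite lee_fin core_test_ge0.
  apply: (@le_lt_trans _ _ (\int[m]_(z in D) (((cst 7%:E : plane -> \bar R) \_ K) z))%E).
    apply: ge0_le_integral.
    - exact: measurable_disk.
    - by move=> z _; rewrite lee_fin core_test_ge0.
    - by apply/measurable_EFinP; exact: measurable_cts_plane.
    - by apply: measurable_funTS; exact/(measurable_restrictT _ mK).
    - move=> z _; rewrite patchE; case: ifPn; first by rewrite lee_fin core_test_le.
      by rewrite notin_setE /K /= => /negP; rewrite -ltNge => /core_test_eq0 ->.
  rewrite -integral_mkcondr (setIidr KD) integral_cst// lte_mul_pinfty//.
  exact: (driesz_radon rm).
rewrite (driesz_distr rm tc) in fin.
have fin2 : (\int[@leb2 R]_(z in D) (u z * (laplacian (@core_test R) z)%:E))%E \is a fin_num.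
  move: fin; case: integral => [//||];
  rewrite ?gt0_muley ?gt0_muleNy ?lte_fin ?invr_gt0 ?two_pi_gt0//.
have := integrable_of_fin_num (@measurable_disk R) mf fin2.
move=> /(integrableS (@measurable_disk R) measurable_core core_disk).
apply: le_integrable; first exact: measurable_core.
  apply: (measurable_funS (@measurable_disk R) core_disk).
  exact: measurable_usc_disk.
move=> z cz; rewrite abseM -[leLHS]mule1; apply: lee_wpmul2l; first exact: abse_ge0.
have L := laplacian_core_test_le cz.
by rewrite abse_EFin lee_fin ler0_norm; lra.
Qed.

End RieszMoment.

(** * Uniform bound for the exhausting test functions and passage to the limit *)

Section RieszMomentBound.
Variable R : realType.
Local Notation plane := (measurableTypeR R * measurableTypeR R)%type.
Local Notation D := (@disk R : set plane).
Local Notation sqnorm z := (z.1 ^+ 2 + z.2 ^+ 2).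
Let core : set plane := [set z | sqnorm z <= 2^-1].

Variables (u : R * R -> \bar R) (h : R * R -> R).
Hypothesis usc : forall z, disk z -> forall a : R, (u z < a%:E)%E ->
  \forall w \near z, (u w < a%:E)%E.
Hypothesis hh : disk_harmonic h.
Hypothesis uh : forall z, disk z -> (u z <= (h z)%:E)%E.
Variable m : {measure set plane -> \bar R}.
Hypothesis rm : disk_riesz u m.

Let C : R := 8 * expR 2.
(** The most that [(u - h) * Delta] can contribute where the Laplacian is only known to be at least
    [- C]. *)
Let gap z : \bar R := (C%:E * ((h z)%:E - u z))%E.

Lemma integrable_core_gap : (@leb2 R).-integrable D (gap \_ core).
Proof.
have ic : (@leb2 R).-integrable core gap.
  apply: integrableZl; first exact: measurable_core.
  apply: integrableB; first exact: measurable_core.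
    by apply: integrable_core_cts; case: hh => -[].
  exact: (integrable_core_subharmonic usc rm).
apply: (integrableS measurableT (@measurable_disk R)) => //.
by apply/(integrable_mkcond _ (@measurable_core R)).
Qed.

Lemma exhaust_laplacian_le a z : 0 < a -> disk z ->
  (u z * (laplacian (exhaust a) z)%:E <=
   (h z * laplacian (exhaust a) z)%:E + (gap \_ core) z)%E.
Proof.
move=> a0 Dz; have L := laplacian_exhaust_ge z a0.
have C0 : 0 < C by rewrite mulr_gt0// expR_gt0.
move: L; set l := laplacian _ z; rewrite patchE /core /gap => L.
have := uh Dz; case: (u z) => [r|//|_].
  rewrite lee_fin => rh; rewrite -EFinM -EFinB -EFinM.
  case: ifPn; rewrite ?inE ?notin_setE /= => cz.
    rewrite -EFinD lee_fin.
    have lC : - C <= l.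
      by move: L; case: ifP => _ //; apply: le_trans; rewrite oppr_le0 ltW.
    nra.
  rewrite addr0 lee_fin; move: L; rewrite ifT; last by rewrite leNgt; apply/negP => /ltW.
  by move=> l0; rewrite ler_wpM2r.
(* The case [u z = -oo]: the gap is [+oo], and the Laplacian can be negative only on the core, where
   the gap is counted. *)
have -> : ((h z)%:E - -oo = +oo)%E by [].
rewrite (gt0_muley (x := C%:E)) ?lte_fin//.
have [l0|l0|l0] := ltgtP l 0.
- rewrite mem_set; last first.
    rewrite /=; move: L; case: ifP => [_ /(lt_le_trans l0)|/negbT]; first by rewrite ltxx.
    by rewrite -ltNge => /ltW.
  by rewrite addey// leey.
- by rewrite gt0_mulNye ?lte_fin// leNye.
- by rewrite l0 mule0 mulr0 add0e; case: ifPn => // _; rewrite leey.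
Qed.

Lemma integral_exhaust_bound : exists2 M : R, 0 <= M & forall a, 0 < a ->
  (\int[m]_(z in D) (exhaust a z)%:E <= M%:E)%E.
Proof.
have iG := integrable_core_gap.
pose N := fine (\int[@leb2 R]_(z in D) ((gap \_ core) z)).
exists `|(2 * pi)^-1 * N| => // a a0.
have te := disk_test_exhaust a0.
have [ih ih0] := integral_harmonic_laplacian hh te.
have mD := @measurable_disk R.
rewrite (driesz_distr rm te).
have le : (\int[@leb2 R]_(z in D) (u z * (laplacian (exhaust a) z)%:E) <= N%:E)%E.
  rewrite /N fineK; last exact: integrable_fin_num.
  (* The vanishing integral of [h] against the Laplacian is inserted, so that the pointwise bound
     [exhaust_laplacian_le] can be integrated; the result no longer depends on [a]. *)
  rewrite -[leRHS]add0e -ih0 -integralD//.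
  apply: le_integral_integrable => //.
  - exact: measurable_mul_laplacian.
  - exact: integrableD.
  - by move=> z Dz; exact: exhaust_laplacian_le.
apply: (@le_trans _ _ (((2 * pi)^-1)%:E * N%:E)%E).
  by apply: lee_wpmul2l => //; rewrite lee_fin invr_ge0 ltW// two_pi_gt0.
by rewrite -EFinM lee_fin ler_norm.
Qed.

Theorem riesz_first_moment :
  (\int[m]_(z in D) (dist_set (@cdist R) z (@circle R))%:E < +oo)%E.
Proof.
have [M M0 HM] := integral_exhaust_bound.
have mD := @measurable_disk R.
(* A lower bound for [exhaust n.+1] that is visibly nondecreasing in [n], as monotone convergence
   requires. *)
pose g n (z : plane) : R := Num.max 0 (2 * (1 - sqnorm z) - 2 / n.+1%:R).
have cs : continuous (fun z : R * R => sqnorm z) := @continuous_sqnorm R.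
have mg n : measurable_fun D (EFin \o g n).
  apply/measurable_EFinP; apply: measurable_maxr => //.
  apply: measurable_cts_plane => z.
  apply: cvgB; last exact: cvg_cst.
  by apply: cvgM; [exact: cvg_cst|apply: cvgB; [exact: cvg_cst|exact: cs]].
have gM n : (\int[m]_(z in D) (g n z)%:E <= M%:E)%E.
  have n0 : 0 < n.+1%:R :> R by [].
  have ce : continuous (@exhaust R n.+1%:R) by have [] := plane_smooth_exhaust (n.+1%:R : R) 0.
  apply: le_trans (HM _ n0); apply: ge0_le_integral => //.
  - by move=> z _; rewrite lee_fin le_max lexx.
  - exact: (mg n).
  - by apply/measurable_EFinP; exact: measurable_cts_plane.
  - by move=> z _; rewrite lee_fin ge_max exhaust_ge0//= exhaust_ge.
have ge0 n z : D z -> (0 <= (EFin \o g n) z)%E by rewrite lee_fin le_max lexx.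
have nd z : D z -> nondecreasing_seq (fun n => (EFin \o g n) z).
  move=> _ i j ij; rewrite /= lee_fin /g ge_max le_max lexx/= le_max; apply/orP; right.
  rewrite lerD2l lerN2 ler_wpM2l// lef_pV2 ?posrE// ler_nat ltnS//.
have MC := @monotone_convergence _ _ _ m D mD (fun n => EFin \o g n) mg ge0 nd.
have lim_le : (limn (fun n => \int[m]_(z in D) (EFin \o g n) z) <= M%:E)%E.
  apply: lime_le; last by apply: nearW => n; exact: gM.
  apply: ereal_nondecreasing_is_cvgn => i j ij; apply: ge0_le_integral => //.
  - by move=> z Dz; exact: ge0.
  - by move=> z Dz; exact: nd.
apply: le_lt_trans (ltry M); apply: le_trans lim_le; rewrite -MC.
apply: ge0_le_integral => //.
- move=> z _; rewrite lee_fin; apply: dist_set_ge => [|b _]; last exact: cdist_ge0.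
  exists (1, 0); rewrite /circle/= /cdist/= !subr0 expr1n expr0n addr0 sqrtr1//.
- apply/measurable_EFinP; apply: measurable_dist_set.
  exists (1, 0); rewrite /circle/= /cdist/= !subr0 expr1n expr0n addr0 sqrtr1//.
- apply: (emeasurable_fun_cvg _ _ mg) => z Dz.
  exact: ereal_nondecreasing_is_cvgn (nd z Dz).
move=> z Dz.
have d1 := dist_set_circle_le Dz.
have s1 : 0 < 1 - sqnorm z.
  have := cdist_sqr z (0, 0); rewrite !subr0 => <-; rewrite subr_gt0 expr_lt1//.
  exact: cdist_ge0.
apply: (@le_trans _ _ (1 - sqnorm z)%:E); first by rewrite lee_fin.
apply: lime_ge; first exact: ereal_nondecreasing_is_cvgn (nd z Dz).
(* Once [n >= 2 / (1 - |z|^2)], the subtracted term costs at most half of [2 (1 - |z|^2)], and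
   [1 - |z|^2] is left. *)
near=> n; rewrite /= lee_fin /g le_max; apply/orP; right.
have gen (s t : R) : t <= s -> s <= 2 * s - t by move=> ?; lra.
apply: gen.
rewrite ler_pdivrMr// -ler_pdivrMl//.
apply: (@le_trans _ _ n%:R); last by rewrite ler_nat.
near: n; exact: nbhs_infty_ger.
Unshelve. all: by end_near. Qed.

End RieszMomentBound.

(** * Vertices and ends of the tree *)

Section TreeStructure.
Variable T : homTree.
Local Notation o := (tree_root T).
Local Notation q := (tree_q T).
Local Notation lev := (@tlevel T).
Implicit Types (x y z v : T) (r s : nat -> T).

Lemma lev_root : lev o = 0%N.
Proof. exact: gdist_refl. Qed.

Lemma lev_eq0 x : (lev x == 0%N) = (x == o).
Proof.
apply/eqP/eqP => [|->]; last exact: lev_root.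
by have [_ + _] := geodP o x; rewrite /tlevel /gdist; case: (geod o x).
Qed.

Lemma lev_adj x y : tadj x y -> (lev y <= (lev x).+1)%N.
Proof.
move=> xy; apply: leq_trans (gdist_triangle o x y) _.
by rewrite -addn1 leq_add2l gdist_adj.
Qed.

Lemma tadj_neq x y : tadj x y -> y != x.
Proof. by apply: contraTneq => ->; rewrite /tadj/= (negbTE (nbr_irr x)). Qed.

(* Two different neighbours of x no farther from the root than x would close a
   cycle through x, since the geodesics from the root to them avoid x. *)
Lemma lower_neighbour_unique x y z : tadj x y -> tadj x z ->
  (lev y <= lev x)%N -> (lev z <= lev x)%N -> y = z.
Proof.
move=> yx zx ly_ lz_; apply/eqP/negPn/negP => yz.
have xo : x != o.
  rewrite -lev_eq0; apply/eqP => x0; have := tadj_neq yx; have := ly_.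
  by rewrite x0 leqn0 lev_eq0 => /eqP ->; rewrite eq_sym -lev_eq0 x0.
have av v : tadj x v -> (lev v <= lev x)%N -> x \notin o :: geod o v.
  move=> xv lv; rewrite inE negb_or xo /=.
  by apply: geod_avoid => //; exact: tadj_neq.
have [py ly _] := geodP o y; have [pz lz _] := geodP o z.
pose p := rev (belast o (geod o y)) ++ geod o z.
have lr : last y (rev (belast o (geod o y))) = o.
  by rewrite -{1}ly; case: (geod o y) => //= a s'; rewrite rev_cons last_rcons.
have pp : path (@tadj T) y p.
  rewrite cat_path lr pz andbT -{1}ly rev_path.
  by under eq_path do rewrite tadj_sym.
have pl : last y p = z by rewrite last_cat lr.
have xp : x \notin y :: p.
  rewrite inE negb_or eq_sym tadj_neq//= mem_cat negb_or mem_rev.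
  have := av z zx lz_; rewrite inE negb_or => /andP[_ ->]; rewrite andbT.
  by apply: contra (av y yx ly_) => /mem_belast.
case/shortenP: pp pl => p' pp' up' sp' pl'.
have : (size [:: x, y & p'] <= 2)%N.
  apply: (@tree_acyclic T); apply/andP; split.
    rewrite -[cycle _ _]/(tadj x y && path (@tadj T) y (rcons p' x)).
    by rewrite yx rcons_path pp' pl' tadj_sym.
  rewrite cons_uniq up' andbT.
  by apply: contra xp; rewrite !inE => /orP[->//|/sp' ->]; rewrite orbT.
case: p' {pp' up' sp'} pl' => // pl' _.
by move: yz; rewrite -pl' /= eqxx.
Qed.

Lemma lower_neighbour_ex x : x != o -> exists2 y, tadj x y & lev x = (lev y).+1.
Proof.
rewrite -lev_eq0 => x0.
have [p l _] := geodP o x; have ls : lev x = size (geod o x) by [].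
case/lastP: (geod o x) p l ls => [|p v]; first by move=> _ _ x0'; rewrite x0' in x0.
rewrite rcons_path last_rcons size_rcons => /andP[pp av] vx ls; subst v.
exists (last o p); first by rewrite tadj_sym.
apply/eqP; rewrite eqn_leq; apply/andP; split; first exact: lev_adj.
by rewrite ls ltnS; exact: (gdist_le pp).
Qed.

(** The filtered list has exactly one element off the root. At the root it is empty, and the default
    makes the root its own parent, so that iterates of [parent] stop there. *)
Definition parent x : T := head o [seq y <- nbr x | (lev y <= lev x)%N].

Definition children x : seq T := [seq y <- nbr x | (lev x < lev y)%N].

Lemma parentP x : x != o -> tadj x (parent x) /\ lev x = (lev (parent x)).+1.
Proof.
move=> xo; have [y xy ly] := lower_neighbour_ex xo.
suff -> : parent x = y by [].
have yin : y \in [seq y <- nbr x | (lev y <= lev x)%N].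
  by rewrite mem_filter ly leqnSn; exact: xy.
rewrite /parent; case E: [seq _ <- _ | _] yin => [//|a l] _ /=.
have : a \in [seq y <- nbr x | (lev y <= lev x)%N] by rewrite E mem_head.
rewrite mem_filter => /andP[la ax].
by apply: (lower_neighbour_unique (x := x)) => //; rewrite ly.
Qed.

Lemma adj_cases x y : tadj x y ->
  (x != o /\ y = parent x) \/ (y != o /\ x = parent y).
Proof.
move=> xy; have [le|gt] := leqP (lev y) (lev x).
  left; have xo : x != o.
    rewrite -lev_eq0; apply/eqP => x0; have := tadj_neq xy.
    by move: le; rewrite x0 leqn0 lev_eq0 => /eqP ->; rewrite eq_sym -lev_eq0 x0.
  split => //; have [xp lp] := parentP xo.
  by apply: (lower_neighbour_unique xy xp le); rewrite lp.
right; have yo : y != o by rewrite -lev_eq0 -lt0n (leq_trans _ gt).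
split => //; have [yp lp] := parentP yo.
apply: (lower_neighbour_unique (x := y)) => //; first by rewrite tadj_sym.
  exact: ltnW.
by rewrite lp.
Qed.

Lemma mem_children x y : (y \in children x) = (y != o) && (parent y == x).
Proof.
rewrite /children mem_filter; apply/andP/andP => [[lt xy]|[yo /eqP <-]].
  have [[xo E]|[yo E]] := adj_cases xy; last by rewrite yo E.
  by have [_ lp] := parentP xo; move: lt; rewrite lp -E ltnNge leqnSn.
have [yp lp] := parentP yo; rewrite lp; split => //.
by rewrite -[_ \in _]/(tadj (parent y) y) tadj_sym.
Qed.

Lemma lev_child x y : y \in children x -> lev y = (lev x).+1.
Proof. by rewrite mem_children => /andP[yo /eqP <-]; case: (parentP yo). Qed.

Lemma uniq_children x : uniq (children x).
Proof. by rewrite filter_uniq// nbr_uniq. Qed.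

Lemma perm_nbr x : x != o -> perm_eq (nbr x) (parent x :: children x).
Proof.
move=> xo; have [xp lp] := parentP xo.
apply: uniq_perm; first exact: nbr_uniq.
  rewrite /= uniq_children andbT; apply/negP => /lev_child E.
  have : (lev (parent x) < lev x)%N by rewrite lp.
  by rewrite E ltnNge leqnSn.
move=> y; rewrite inE; apply/idP/orP => [xy|[/eqP ->//|]].
  have [[_ E]|[yo E]] := adj_cases xy; first by left; rewrite E.
  by right; rewrite mem_children yo E /=.
by rewrite mem_filter => /andP[].
Qed.

Lemma nbr_root : nbr o = children o.
Proof.
apply/esym/all_filterP/allP => y oy; rewrite lev_root lt0n lev_eq0.
exact: (tadj_neq oy).
Qed.

Lemma size_children x : size (children x) = (q + (x == o))%N.
Proof.
have [->|xo] := eqVneq x o; first by rewrite -nbr_root nbr_size addn1.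
have := perm_size (perm_nbr xo); rewrite nbr_size /= => -[->].
by rewrite addn0.
Qed.

Lemma tree_ind (P : T -> Prop) : P o -> (forall x, x != o -> P (parent x) -> P x) ->
  forall x, P x.
Proof.
move=> Po IH x; move: {2}(lev x) (erefl (lev x)) => n; elim: n x => [|n IHn] x lx.
  by have /eqP := lx; rewrite lev_eq0 => /eqP ->.
have xo : x != o by rewrite -lev_eq0 lx.
by apply: IH => //; apply: IHn; have [_] := parentP xo; rewrite lx => -[].
Qed.

Lemma parent_root : parent o = o.
Proof.
rewrite /parent (_ : [seq _ <- _ | _] = [::])//.
apply/eqP; rewrite -(negbK (_ == _)) -has_filter; apply/hasPn => y oy.
by rewrite lev_root leqn0 lev_eq0; exact: (tadj_neq oy).
Qed.

Lemma lev_parent x : lev (parent x) = (lev x).-1.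
Proof.
have [->|xo] := eqVneq x o; first by rewrite parent_root lev_root.
by have [_ ->] := parentP xo.
Qed.

Lemma lev_iter_parent k x : lev (iter k parent x) = (lev x - k)%N.
Proof. by elim: k => [|k IH]; rewrite ?subn0//= lev_parent IH subnS. Qed.

End TreeStructure.

(** * Automorphisms exchanging siblings *)

Section SiblingSwap.
Variable T : homTree.
Local Notation o := (tree_root T).
Local Notation lev := (@tlevel T).
Implicit Types (x y z v : T).

Variables (m a b : nat).
Hypothesis am : forall x, lev x = m -> (a < size (children x))%N.
Hypothesis bm : forall x, lev x = m -> (b < size (children x))%N.

Definition swap_index k i : nat :=
  if k == m then (if i == a then b else if i == b then a else i) else i.

Lemma swap_indexK k : involutive (swap_index k).
Proof.
move=> i; rewrite /swap_index; case: (k == m) => //.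
have [->|ia] := eqVneq i a; first by have [->|ba] := eqVneq b a; rewrite ?eqxx.
have [->|ib] := eqVneq i b; first by rewrite eqxx.
by rewrite (negbTE ia) (negbTE ib).
Qed.

Lemma swap_index_lt x i : (i < size (children x))%N ->
  (swap_index (lev x) i < size (children x))%N.
Proof.
by rewrite /swap_index => ix; case: eqP => [/[dup] /am ? /bm ?|//]; do 2?case: ifP.
Qed.

(* The automorphism exchanging the a-th and b-th child of every vertex at
   level m, together with the subtrees below them. *)
Fixpoint sibling_swap_rec k v : T :=
  if k is k'.+1 then
    nth o (children (sibling_swap_rec k' (parent v)))
      (swap_index k' (index v (children (parent v))))
  else o.

Definition sibling_swap v : T := sibling_swap_rec (lev v) v.
Local Notation g := sibling_swap.

Lemma sibling_swap_root : g o = o.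
Proof. by rewrite /sibling_swap lev_root. Qed.

Lemma sibling_swapE v : v != o -> g v =
  nth o (children (g (parent v))) (swap_index (lev (parent v)) (index v (children (parent v)))).
Proof. by move=> vo; rewrite {1}/sibling_swap; have [_ ->] := parentP vo. Qed.

(** The three claims need a joint induction: swapping twice makes sense only if the image of the
    parent has as many children as the parent, which depends on being the root. *)
Lemma sibling_swap_spec v : [/\ lev (g v) = lev v, (g v == o) = (v == o) & g (g v) = v].
Proof.
elim/tree_ind: v => [|v vo [lp po pp]].
  by rewrite !sibling_swap_root eqxx.
have vc : v \in children (parent v) by rewrite mem_children vo /=.
have sz : size (children (g (parent v))) = size (children (parent v)).
  by rewrite !size_children po.
have li : (swap_index (lev (parent v)) (index v (children (parent v))) <
    size (children (parent v)))%N.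
  by apply: swap_index_lt; rewrite index_mem.
have gc : g v \in children (g (parent v)) by rewrite sibling_swapE// mem_nth// sz.
have lv : lev (g v) = lev v by rewrite (lev_child gc) (lev_child vc) lp.
have := gc; rewrite mem_children => /andP[gvo /eqP pg].
split => //; first by rewrite (negbTE gvo) (negbTE vo).
rewrite sibling_swapE// pg pp lp [in index _ _]sibling_swapE//.
rewrite index_uniq ?sz ?uniq_children// swap_indexK.
exact: nth_index.
Qed.

Lemma sibling_swapK : involutive g.
Proof. by move=> v; case: (sibling_swap_spec v). Qed.

Lemma lev_sibling_swap v : lev (g v) = lev v.
Proof. by case: (sibling_swap_spec v). Qed.

Lemma sibling_swap_eq_root v : (g v == o) = (v == o).
Proof. by case: (sibling_swap_spec v). Qed.

Lemma parent_sibling_swap v : parent (g v) = g (parent v).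
Proof.
have [->|vo] := eqVneq v o; first by rewrite !(sibling_swap_root, parent_root).
have vc : v \in children (parent v) by rewrite mem_children vo /=.
have : g v \in children (g (parent v)).
  rewrite sibling_swapE// mem_nth// [X in (_ < X)%N]size_children sibling_swap_eq_root.
  by rewrite -size_children swap_index_lt// index_mem.
by rewrite mem_children => /andP[_ /eqP].
Qed.

Lemma tadj_sibling_swap x y : tadj (g x) (g y) = tadj x y.
Proof.
have imp x' y' : tadj x' y' -> tadj (g x') (g y').
  move=> /adj_cases [[xo ->]|[yo ->]].
    rewrite -parent_sibling_swap; apply: (parentP _).1.
    by rewrite sibling_swap_eq_root.
  rewrite -parent_sibling_swap tadj_sym; apply: (parentP _).1.
  by rewrite sibling_swap_eq_root.
by apply/idP/idP => [/imp|/imp//]; rewrite !sibling_swapK.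
Qed.

Lemma tree_aut_sibling_swap : tree_aut g.
Proof.
split; last exact: tadj_sibling_swap.
by exists g; exact: sibling_swapK.
Qed.

Lemma sibling_swap_low v : (lev v <= m)%N -> g v = v.
Proof.
elim/tree_ind: v => [|v vo IH] lv; first exact: sibling_swap_root.
have [_ lp] := parentP vo; rewrite lp in lv.
rewrite sibling_swapE// IH 1?ltnW//.
rewrite /swap_index (ltn_eqF lv) nth_index//.
by rewrite mem_children vo /=.
Qed.

End SiblingSwap.

Lemma sibling_aut (T : homTree) (x y z : T) : y \in children x -> z \in children x ->
  exists2 g : T -> T, tree_aut g /\ involutive g &
    [/\ forall v, tlevel (g v) = tlevel v, g (tree_root T) = tree_root T & g y = z].
Proof.
move=> yx zx.
pose a := index y (children x); pose b := index z (children x).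
(* The swap acts at every vertex on the level of [x], so both indices must be valid there; vertices
   on one level have equally many children. *)
have lt (i v : T) : i \in children x -> tlevel v = tlevel x ->
    (index i (children x) < size (children v))%N.
  move=> ix lv; rewrite (_ : size (children v) = size (children x)) ?index_mem//.
  by rewrite !size_children -(lev_eq0 v) lv lev_eq0.
have am (v : T) : tlevel v = tlevel x -> (a < size (children v))%N by exact: lt.
have bm (v : T) : tlevel v = tlevel x -> (b < size (children v))%N by exact: lt.
exists (sibling_swap (tlevel x) a b).
  exact: conj (tree_aut_sibling_swap am bm) (sibling_swapK am bm).
split; [exact: (lev_sibling_swap am bm)|exact: sibling_swap_root|].
have := yx; rewrite mem_children => /andP[yo /eqP py].
rewrite sibling_swapE// py sibling_swap_low// /swap_index eqxx /a eqxx.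
exact: nth_index.
Qed.

(** * Ends represented by rays from the root *)

Section Ends.
Variable T : homTree.
Local Notation o := (tree_root T).
Local Notation lev := (@tlevel T).
Implicit Types (x y z v : T) (r s t : nat -> T) (xi zeta eta : tree_end T).

Lemma ray_equiv_sym r s : ray_equiv r s -> ray_equiv s r.
Proof. by move=> [m [n rs]]; exists n, m => k; rewrite rs. Qed.

Lemma ray_equiv_trans r s t : ray_equiv r s -> ray_equiv s t -> ray_equiv r t.
Proof.
move=> [m [n rs]] [m' [n' st]]; exists (m + m')%N, (n' + n)%N => k.
by rewrite -addnA rs addnCA st addnA.
Qed.

(** Each end contains exactly one such ray, which serves as its canonical representative. *)
Definition root_ray s : Prop :=
  s 0%N = o /\ forall k, parent (s k.+1) = s k /\ s k.+1 != o.

Lemma lev_root_ray s k : root_ray s -> lev (s k) = k.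
Proof.
move=> [s0 sp]; elim: k => [|k IH]; first by rewrite s0 lev_root.
by have [ps so] := sp k; have [_ ->] := parentP so; rewrite ps IH.
Qed.

Lemma iter_parent_root_ray s i k : root_ray s -> iter i (@parent T) (s (k + i)%N) = s k.
Proof.
move=> [s0 sp]; elim: i => [|i IH]; first by rewrite addn0.
by rewrite iterSr addnS (sp _).1 IH.
Qed.

Lemma root_ray_agree s t j k : root_ray s -> root_ray t -> (j <= k)%N ->
  s k = t k -> s j = t j.
Proof.
move=> sr tr jk st.
by rewrite -(iter_parent_root_ray (k - j) j sr) -(iter_parent_root_ray (k - j) j tr) subnKC// st.
Qed.

Lemma root_ray_geodesic s : root_ray s -> geodesic_ray s.
Proof.
move=> sr m n mn; apply/eqP; rewrite eqn_leq; apply/andP; split; last first.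
  rewrite leq_subLR -{1}(lev_root_ray n sr) -{1}(lev_root_ray m sr).
  exact: gdist_triangle.
rewrite -{1}(subnKC mn); elim: (n - m)%N => [|k IH]; first by rewrite addn0 gdist_refl.
apply: leq_trans (gdist_triangle _ (s (m + k)%N) _) _.
rewrite addnS -[k.+1]addn1; apply: leq_add => //.
have [ps so] := sr.2 (m + k)%N.
by apply: gdist_adj; rewrite tadj_sym -ps; exact: (parentP so).1.
Qed.

Lemma tadj_of_gdist1 x y : gdist x y = 1%N -> tadj x y.
Proof.
have [+ + _] := geodP x y; rewrite /gdist.
by case: (geod x y) => [//|a [|//]] /= /andP[xa _] <-.
Qed.

(* A geodesic ray never turns down after a step away from the root, and it
   cannot descend forever. *)
Lemma geodesic_ray_rises r : geodesic_ray r ->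
  exists N, forall k, parent (r (N + k).+1) = r (N + k)%N /\ r (N + k).+1 != o.
Proof.
move=> rr.
have adj k : tadj (r k) (r k.+1) by apply: tadj_of_gdist1; rewrite rr// subSnn.
have [[N rN]|no] := pselect (exists N, parent (r N.+1) = r N /\ r N.+1 != o).
  exists N; elim=> [|k [pk ok]]; first by rewrite addn0.
  rewrite addnS; have [[_ E]|[-> ->]//] := adj_cases (adj (N + k).+1).
  have := rr (N + k)%N (N + k).+2; rewrite E pk gdist_refl => /(_ (leqW (leqnSn _))).
  by move/esym/eqP; rewrite subn_eq0 ltnNge leqnSn.
have down k : r k != o /\ r k.+1 = parent (r k).
  by have [//|[ok E]] := adj_cases (adj k); case: no; exists k.
suff H k : (lev (r k) + k = lev (r 0))%N.
  by have := leq_addl (lev (r (lev (r 0)).+1)) (lev (r 0)).+1; rewrite H ltnn.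
elim: k => [|k IH]; first by rewrite addn0.
by rewrite addnS -addSn -IH; have [rk ->] := down k; have [_ <-] := parentP rk.
Qed.

Lemma root_ray_ex r : geodesic_ray r -> exists2 s, root_ray s & ray_equiv s r.
Proof.
move=> rr; have [N up] := geodesic_ray_rises rr.
have lr k : lev (r (N + k)%N) = (lev (r N) + k)%N.
  elim: k => [|k IH]; first by rewrite !addn0.
  by have [p ko] := up k; rewrite !addnS; have [_ ->] := parentP ko; rewrite p IH.
have it i k : iter i (@parent T) (r (N + k + i)%N) = r (N + k)%N.
  elim: i => [|i IH]; first by rewrite addn0.
  by rewrite iterSr addnS -addnA (up _).1 addnA IH.
(* With [l = lev (r N)], the vertex [r (N + k)] has level [l + k], so its [l]-th ancestor is the
   vertex at level [k]. From level [l] on, the new ray runs through [r N], [r N.+1] and so on. *)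
exists (fun k => iter (lev (r N)) (@parent T) (r (N + k)%N)).
  split=> [|k].
    by apply/eqP; rewrite -lev_eq0 lev_iter_parent lr addn0 subnn.
  rewrite -lev_eq0 lev_iter_parent lr addKn; split => //.
  by rewrite -iterS iterSr addnS (up k).1.
by exists (lev (r N)), N => k; rewrite [(lev _ + k)%N]addnC addnA it.
Qed.

Lemma root_ray_unique s t : root_ray s -> root_ray t -> ray_equiv s t -> s = t.
Proof.
move=> sr tr [m [n st]]; apply/funext => k.
have mn : m = n by have := st 0%N; rewrite !addn0 => /(congr1 lev); rewrite !lev_root_ray.
by apply: (root_ray_agree sr tr (leq_addl m k)); rewrite st mn.
Qed.

Definition ray_class r : set (nat -> T) := [set s | geodesic_ray s /\ ray_equiv r s].

Lemma end_ray_ex xi : exists s, root_ray s /\ (val xi : set (nat -> T)) = ray_class s.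
Proof.
have [r rr E] : is_end (val xi : set (nat -> T)) by apply: set_mem; exact: (valP xi).
have [s sr rs] := root_ray_ex rr; exists s; split => //; rewrite E.
apply/seteqP; split => t [tr rt]; split => //.
  exact: ray_equiv_trans rs rt.
exact: ray_equiv_trans (ray_equiv_sym rs) rt.
Qed.

Definition end_ray xi : nat -> T := projT1 (cid (end_ray_ex xi)).

Lemma end_rayP xi : root_ray (end_ray xi) /\
  (val xi : set (nat -> T)) = ray_class (end_ray xi).
Proof. exact: projT2 (cid (end_ray_ex xi)). Qed.

Lemma root_end_ray xi : root_ray (end_ray xi).
Proof. exact: (end_rayP xi).1. Qed.

Lemma val_end xi : (val xi : set (nat -> T)) = ray_class (end_ray xi).
Proof. exact: (end_rayP xi).2. Qed.

Lemma lev_end_ray xi n : lev (end_ray xi n) = n.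
Proof. exact: lev_root_ray (root_end_ray xi). Qed.

Lemma end_ray_inj : injective end_ray.
Proof. by move=> xi eta E; apply: val_inj; rewrite /= !val_end E. Qed.

Lemma end_of_ray s : root_ray s -> exists xi, end_ray xi = s.
Proof.
move=> sr.
have H : is_end (ray_class s) by exists s; first exact: root_ray_geodesic.
exists (SigSub (mem_set H) : tree_end T); set xi : tree_end T := SigSub _.
have : (val xi : set (nat -> T)) (end_ray xi).
  rewrite val_end; split; first exact/root_ray_geodesic/root_end_ray.
  by exists 0%N, 0%N.
by move=> [_ /root_ray_unique]/(_ sr (root_end_ray xi)) ->.
Qed.

Lemma end_ray_le xi eta j k : (j <= k)%N -> end_ray xi k = end_ray eta k ->
  end_ray xi j = end_ray eta j.
Proof. by apply: root_ray_agree; exact: root_end_ray. Qed.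

Lemma root_geodesic_end xi y : root_geodesic (inr xi) y <-> end_ray xi (lev y) = y.
Proof.
split=> [[r + [r0 [n <-]]]|E]; last first.
  exists (end_ray xi); last by split; [exact: (root_end_ray xi).1|exists (lev y)].
  rewrite val_end; split; first exact/root_ray_geodesic/root_end_ray.
  by exists 0%N, 0%N.
rewrite val_end => -[rr eq].
suff rro : root_ray r.
  by rewrite (root_ray_unique (root_end_ray xi) rro eq) lev_root_ray.
have lr k : lev (r k) = k by rewrite /tlevel -r0 rr// subn0.
split=> // k; have adj : tadj (r k) (r k.+1) by apply: tadj_of_gdist1; rewrite rr// subSnn.
have [[ko E]|[ko <-]] := adj_cases adj; last by [].
by have := congr1 lev E; rewrite lr lev_parent lr => kE; have := leq_pred k; rewrite -kE ltnn.
Qed.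

Lemma root_geodesic_vertex x y :
  root_geodesic (inl x) y <-> exists i, iter i (@parent T) x = y.
Proof.
suff H p : path (@tadj T) o p -> size p = lev (last o p) ->
    forall y, (y \in o :: p) <-> exists i, iter i (@parent T) (last o p) = y.
  have [pp lp _] := geodP o x; have := H _ pp; rewrite lp; exact.
elim/last_ind: p => [_ _ {}y|p v IH].
  rewrite inE; split=> [/eqP ->|[i <-]]; first by exists 0%N.
  by apply/eqP; elim: i => //= i ->; rewrite parent_root.
rewrite rcons_path last_rcons size_rcons => /andP[pp av] sv {}y.
have lp : size p = lev (last o p).
  apply/eqP; rewrite eqn_leq (gdist_le pp erefl) andbT.
  by rewrite -ltnS sv lev_adj.
have pv : parent v = last o p.
  have [[_ E]|[_ ->//]] := adj_cases av.
  by have := lev_parent (last o p); rewrite -E -sv -lp => pE; have := leq_pred (size p); rewrite -pE ltnn.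
rewrite -rcons_cons mem_rcons inE; split.
  move=> /orP[/eqP ->|yp]; first by exists 0%N.
  have [i <-] := (IH pp lp y).1 yp.
  by exists i.+1; rewrite iterSr pv.
move=> [[|i] <-]; first by rewrite eqxx.
by rewrite iterSr pv; apply/orP; right; apply: (IH pp lp _).2; exists i.
Qed.

End Ends.

(** * The ultrametric on the boundary and the cones of ends *)

Section BoundaryMetric.
Variables (R : realType) (T : homTree).
Local Notation o := (tree_root T).
Local Notation q := (tree_q T).
Local Notation lev := (@tlevel T).
Local Notation d := (@tdist T R).
Implicit Types (x y z v : T) (xi zeta eta : tree_end T).

Lemma q_gt1 : 1 < q%:R :> R.
Proof. by rewrite ltr1n tree_q_ge2. Qed.

Lemma q_gt0 : 0 < q%:R :> R.
Proof. exact: lt_trans ltr01 q_gt1. Qed.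

Lemma expVq_le j k : (q%:R ^- j <= q%:R ^- k :> R) = (k <= j)%N.
Proof. by rewrite lef_pV2 ?posrE ?exprn_gt0 ?q_gt0// ler_eXn2l// q_gt1. Qed.

Lemma expVq_gt0 k : 0 < q%:R ^- k :> R.
Proof. by rewrite invr_gt0 exprn_gt0// q_gt0. Qed.

Lemma expVq_le1 k : q%:R ^- k <= 1 :> R.
Proof. by have := expVq_le k 0; rewrite expr0 invr1 => ->. Qed.

Lemma tdist_ge0 (w z : tree_bar T) : 0 <= d w z.
Proof. by rewrite /tdist; case: ifP => // _; exact/ltW/expVq_gt0. Qed.

Lemma tdist_le1 (w z : tree_bar T) : d w z <= 1.
Proof. by rewrite /tdist; case: ifP => // _; exact: expVq_le1. Qed.

Lemma tdistxx (w : tree_bar T) : d w w = 0.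
Proof. by rewrite /tdist asboolT. Qed.

Lemma tdistC (w z : tree_bar T) : d w z = d z w.
Proof.
rewrite /tdist /confluent setIC; congr (if _ then _ else _).
by apply/asboolP/asboolP.
Qed.

(** The confluent is an arbitrary choice among common vertices of maximal level, but the distance
    sees only its level. *)
Lemma tdist_common (w z : tree_bar T) (c : T) : w <> z ->
  root_geodesic w c -> root_geodesic z c ->
  (forall y, root_geodesic w y -> root_geodesic z y -> (lev y <= lev c)%N) ->
  d w z = q%:R ^- lev c.
Proof.
move=> wz wc zc cmax; rewrite /tdist asboolF//; congr (_ ^- _).
rewrite /confluent; case: xgetP => [y _ [[wy zy] ymax]|/(_ c) []].
  by apply/eqP; rewrite eqn_leq cmax// ymax.
by split => // y [wy zy]; exact: cmax.
Qed.

Lemma tdist_end xi eta : xi <> eta ->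
  exists k, [/\ end_ray xi k = end_ray eta k,
    forall j, end_ray xi j = end_ray eta j -> (j <= k)%N &
    d (inr xi) (inr eta) = q%:R ^- k].
Proof.
move=> ne.
have [N Nne] : exists N, end_ray xi N <> end_ray eta N.
  apply/existsNP => all; apply: ne; apply: end_ray_inj; exact/funext.
have bnd j : end_ray xi j == end_ray eta j -> (j <= N)%N.
  by move=> /eqP E; rewrite leqNgt; apply/negP => /ltnW /end_ray_le /(_ E).
have ex : exists j, end_ray xi j == end_ray eta j.
  by exists 0%N; rewrite (root_end_ray xi).1 (root_end_ray eta).1.
have [k /eqP Ek kmax] := ex_maxnP ex bnd; exists k; split => // [j /eqP/kmax//|].
have -> : q%:R ^- k = q%:R ^- lev (end_ray xi k) :> R by rewrite lev_end_ray.
apply: tdist_common; first by move=> -[].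
- by apply/root_geodesic_end; rewrite lev_end_ray.
- by apply/root_geodesic_end; rewrite lev_end_ray.
- move=> y /root_geodesic_end xy /root_geodesic_end ey.
  by rewrite lev_end_ray; apply: kmax; rewrite xy ey.
Qed.

Lemma tdist_end_le xi eta j :
  d (inr xi) (inr eta) <= q%:R ^- j <-> end_ray xi j = end_ray eta j.
Proof.
have [->|ne] := pselect (xi = eta); first by rewrite tdistxx ltW ?expVq_gt0.
have [k [Ek kmax ->]] := tdist_end ne; rewrite expVq_le; split; last exact: kmax.
by move=> /end_ray_le; exact.
Qed.

Lemma tdist_vertex x xi :
  exists k, [/\ (k <= lev x)%N, end_ray xi k = iter (lev x - k) (@parent T) x,
    end_ray xi (lev x) = x -> k = lev x &
    d (inl x) (inr xi) = q%:R ^- k].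
Proof.
pose P k := (k <= lev x)%N && (end_ray xi k == iter (lev x - k) (@parent T) x).
have bnd k : P k -> (k <= lev x)%N by case/andP.
have ex : exists k, P k.
  exists 0%N; rewrite /P (root_end_ray xi).1 subn0 eq_sym -lev_eq0.
  by rewrite lev_iter_parent subnn eqxx.
have [k /andP[kx /eqP Ek] kmax] := ex_maxnP ex bnd; exists k; split => //.
  by move=> E; apply/eqP; rewrite eqn_leq kx kmax// /P leqnn subnn E /=.
have -> : q%:R ^- k = q%:R ^- lev (end_ray xi k) :> R by rewrite lev_end_ray.
apply: tdist_common => //.
- by apply/root_geodesic_vertex; exists (lev x - k)%N.
- by apply/root_geodesic_end; rewrite lev_end_ray.
- move=> y /root_geodesic_vertex[i yi] /root_geodesic_end ey.
  have ly : lev y = (lev x - i)%N by rewrite -yi lev_iter_parent.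
  rewrite lev_end_ray; apply: kmax; rewrite /P ly leq_subr /= -ly ey ly.
  have [ix|xi_] := leqP i (lev x); first by rewrite subKn// yi.
  have yo : y = o by apply/eqP; rewrite -lev_eq0 ly subn_eq0 ltnW.
  by rewrite (eqP (ltnW xi_)) subn0 yo eq_sym -lev_eq0 lev_iter_parent subnn.
Qed.

Definition cone x : set (tree_end T) := [set xi | end_ray xi (lev x) = x].

Lemma cone_root : cone o = setT.
Proof. by apply/seteqP; split => // xi _; rewrite /cone/= lev_root (root_end_ray xi).1. Qed.

Lemma cone_children x : cone x = \big[setU/set0]_(y <- children x) cone y.
Proof.
rewrite -bigcup_seq; apply/seteqP; split => [xi Ex|xi [y yx Ey]].
  have [px xo] := (root_end_ray xi).2 (lev x).
  exists (end_ray xi (lev x).+1); last by rewrite /cone/= lev_end_ray.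
  by rewrite /= mem_children xo px Ex /=.
move: yx => /[dup] /lev_child ly; rewrite /= mem_children => /andP[_ /eqP <-].
by rewrite /cone/= -Ey ly (((root_end_ray xi).2 (lev x)).1) lev_end_ray.
Qed.

Lemma cone_disjoint x y : lev x = lev y -> cone x `&` cone y !=set0 -> x = y.
Proof. by move=> xy [xi []]; rewrite /cone/= xy => <-. Qed.

Lemma trivIset_cone_children x : trivIset [set` children x] cone.
Proof.
by move=> y z /= /lev_child ly /lev_child lz; apply: cone_disjoint; rewrite ly lz.
Qed.

Lemma cone_open x : @end_open T R (cone x).
Proof.
(* Nonzero distances are powers of [q^-1], so being less than [q * q^-lev x] means being at most
   [q^-lev x]. *)
move=> xi Ex; exists (q%:R * q%:R ^- lev x); first by rewrite mulr_gt0 ?q_gt0 ?expVq_gt0.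
move=> eta lt; rewrite /cone/= -[RHS]Ex; apply/esym/tdist_end_le.
have [->|ne] := pselect (xi = eta); first by rewrite tdistxx ltW ?expVq_gt0.
have [k [Ek kmax E]] := tdist_end ne; move: lt; rewrite E expVq_le.
case: (lev x) => // n; rewrite exprS invfM mulrA divff ?gt_eqF ?q_gt0// mul1r.
by rewrite ltNge expVq_le -ltnNge.
Qed.

Lemma tdist_vertex_cone x xi : cone x xi -> d (inl x) (inr xi) = q%:R ^- lev x.
Proof. by have [k [_ _ + ->]] := tdist_vertex x xi => /[apply] ->. Qed.

(** The ray of [zeta] runs through all ancestors of [x], so it follows the ray of [xi] at least as
    far as the geodesic to [x] does. Unlike on the disk, no constant is lost. *)
Lemma tdist_cone_le x zeta xi : cone x zeta -> d (inr zeta) (inr xi) <= d (inl x) (inr xi).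
Proof.
move=> Ex; have [k [kx Ek _ ->]] := tdist_vertex x xi; apply/tdist_end_le.
rewrite Ek -(iter_parent_root_ray (lev x - k) k (root_end_ray zeta)) subnKC//.
by rewrite Ex.
Qed.

Section DistanceToSet.
Variable A : set (tree_end T).
Hypothesis A0 : A !=set0.
Let E : set (tree_bar T) := [set inr xi | xi in A].
Local Notation dE w := (dist_set d w E).

Lemma dist_ends_ge0 w : 0 <= dE w.
Proof.
have [xi Axi] := A0.
by apply: dist_set_ge => [|a _]; [by exists (inr xi), xi|exact: tdist_ge0].
Qed.

Lemma dist_ends_le1 w : dE w <= 1.
Proof.
have [xi Axi] := A0.
apply: le_trans (tdist_le1 w (inr xi)); apply: (dist_set_le tdist_ge0).
by exists xi.
Qed.

Lemma dist_ends_cone x zeta : cone x zeta -> dE (inr zeta) <= dE (inl x).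
Proof.
have [xi Axi] := A0 => cz.
apply: dist_set_ge => [|_ [eta Aeta <-]]; first by exists (inr xi), xi.
apply: le_trans (tdist_cone_le eta cz); apply: (dist_set_le tdist_ge0).
by exists eta.
Qed.

Lemma dist_ends_open a : @end_open T R [set xi | dE (inr xi) < a].
Proof.
move=> zeta /= lta.
have [_ [xi Axi <-] dlt] : exists2 b, E b & d (inr zeta) b < a.
  have E0 : E !=set0 by have [xi Axi] := A0; exists (inr xi), xi.
  have lta' : 0 < a - dE (inr zeta) by rewrite subr_gt0.
  have [b Eb] := dist_set_near tdist_ge0 (inr zeta) E0 lta'.
  by rewrite addrC subrK; exists b.
have sub eta : d (inr eta) (inr xi) < a -> dE (inr eta) < a.
  by apply: le_lt_trans; apply: (dist_set_le tdist_ge0); exists xi.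
have [zx|ne] := pselect (zeta = xi).
  exists a; first by move: dlt; rewrite zx tdistxx.
  by move=> eta; rewrite zx tdistC => /sub.
(* By the ultrametric property, an end that agrees with [zeta] up to level [k] is no farther from
   [xi] than [zeta] is. *)
have [k [Ek _ dk]] := tdist_end ne.
exists (q%:R ^- k); first exact: expVq_gt0.
move=> eta /ltW /tdist_end_le zk; apply: sub; apply: le_lt_trans dlt.
by rewrite dk; apply/tdist_end_le; rewrite -zk.
Qed.

End DistanceToSet.

Lemma dist_boundary_le x : cone x !=set0 ->
  dist_set d (inl x) (range inr) <= q%:R ^- lev x.
Proof.
move=> [xi cx]; rewrite -(tdist_vertex_cone cx); apply: (dist_set_le tdist_ge0).
by exists xi.
Qed.

End BoundaryMetric.

(** * The majorant on the tree *)

Section AutomorphismOnEnds.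
Variables (T : homTree) (g : T -> T).
Local Notation lev := (@tlevel T).
Hypothesis g_adj : forall x y, tadj (g x) (g y) = tadj x y.
Hypothesis gK : involutive g.
Hypothesis lev_g : forall v, lev (g v) = lev v.
Hypothesis g_root : g (tree_root T) = tree_root T.

Lemma gdist_aut x y : gdist (g x) (g y) = gdist x y.
Proof.
have le x' y' : (gdist (g x') (g y') <= gdist x' y')%N.
  have [p l _] := geodP x' y'; rewrite [leqRHS](_ : _ = size (map g (geod x' y'))); last by rewrite size_map.
  apply: gdist_le.
    by rewrite path_map; under eq_path do rewrite /= g_adj.
  by rewrite last_map l.
by apply/eqP; rewrite eqn_leq le -{1}(gK x) -{1}(gK y) le.
Qed.

Lemma geodesic_ray_aut r : geodesic_ray r -> geodesic_ray (g \o r).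
Proof. by move=> rr m n mn; rewrite /= gdist_aut rr. Qed.

Lemma ray_equiv_aut r s : ray_equiv r s -> ray_equiv (g \o r) (g \o s).
Proof. by move=> [m [n rs]]; exists m, n => k; rewrite /= rs. Qed.

Lemma ray_class_aut s : [set g \o r | r in ray_class s] = ray_class (g \o s).
Proof.
have gg r : g \o (g \o r) = r by apply/funext => n; exact: gK.
apply/seteqP; split=> [_ [r [rr sr] <-]|r [rr sr]].
  by split; [exact: geodesic_ray_aut|exact: ray_equiv_aut].
exists (g \o r) => //; split; first exact: geodesic_ray_aut.
by have := ray_equiv_aut sr; rewrite gg.
Qed.

Lemma root_ray_aut s : root_ray s -> root_ray (g \o s).
Proof.
move=> sr; split=> [|k]; first by rewrite /= sr.1.
have [ps so] := sr.2 k.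
have go : g (s k.+1) != tree_root T by rewrite -lev_eq0 lev_g lev_eq0.
split=> //=; have [gp lp] := parentP go.
have ap : tadj (g (s k.+1)) (g (s k)) by rewrite g_adj -ps; exact: (parentP so).1.
apply: (lower_neighbour_unique gp ap); first by rewrite lp.
by rewrite !lev_g !lev_root_ray.
Qed.

Lemma cone_aut y z : g y = z ->
  [set xi : tree_end T | exists2 eta : tree_end T, cone z eta &
     val eta = [set g \o r | r in (val xi : set (nat -> T))]] = cone y.
Proof.
move=> gyz; apply/seteqP; split=> [xi [eta cz E]|xi cy].
  have [zeta Ez] := end_of_ray (root_ray_aut (root_end_ray xi)).
  have ez : eta = zeta.
    by apply: val_inj; rewrite /= E [in LHS]val_end ray_class_aut val_end Ez.
  move: cz; rewrite ez /cone/= Ez /= -gyz => /(can_inj gK).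
  by rewrite lev_g.
have [zeta Ez] := end_of_ray (root_ray_aut (root_end_ray xi)).
exists zeta; first by rewrite /cone/= Ez -gyz lev_g /= cy.
by rewrite [in RHS]val_end ray_class_aut val_end Ez.
Qed.

End AutomorphismOnEnds.

(** * The invariant measure of cones *)

Section BoundaryMeasure.
Variables (R : realType) (T : homTree) (lam : probability (borel_end T R) R).
Hypothesis lam_inv : aut_invariant lam.
Local Notation o := (tree_root T).
Local Notation q := (tree_q T).
Local Notation lev := (@tlevel T).
Local Notation bcone x := (cone x : set (borel_end T R)).
Implicit Types (x y z v : T).

Lemma measurable_end_open (A : set (borel_end T R)) : @end_open T R A -> measurable A.
Proof. exact: sub_sigma_algebra. Qed.

Lemma measurable_cone x : measurable (bcone x).
Proof. by apply: measurable_end_open; exact: cone_open. Qed.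

Lemma measurable_dist_ends (A : set (tree_end T)) : A !=set0 ->
  measurable_fun setT (fun xi : borel_end T R =>
    dist_set (@tdist T R) (inr xi) [set inr xi | xi in A]).
Proof.
move=> A0 _; apply: (measurability _ (RGenInftyO.measurableE R)) => //.
move=> _ [_ [a ->] <-]; rewrite setTI; apply: measurable_end_open.
rewrite (_ : _ @^-1` _ = [set xi | dist_set (@tdist T R) (inr xi) [set inr xi | xi in A] < a]).
  exact: dist_ends_open.
by apply/seteqP; split => xi; rewrite /= in_itv.
Qed.

Lemma integral_cone (f : borel_end T R -> \bar R) x : measurable_fun setT f ->
  (forall xi, 0 <= f xi)%E ->
  (\int[lam]_(xi in bcone x) f xi = \sum_(y <- children x) \int[lam]_(xi in bcone y) f xi)%E.
Proof.
move=> mf f0; rewrite cone_children ge0_integral_bigsetU//.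
- exact: measurable_cone.
- exact: uniq_children.
- exact: trivIset_cone_children.
- exact: measurable_funTS.
Qed.

Definition cone_prob x : R := fine (lam (bcone x)).

Lemma cone_probE x : lam (bcone x) = (cone_prob x)%:E.
Proof. by rewrite fineK// fin_num_measure//; exact: measurable_cone. Qed.

Lemma cone_prob_root : cone_prob o = 1.
Proof. by rewrite /cone_prob cone_root probability_setT. Qed.

Lemma cone_prob_sibling x y z : y \in children x -> z \in children x ->
  cone_prob y = cone_prob z.
Proof.
move=> yx zx; have [g [ga gK] [lg go gyz]] := sibling_aut yx zx.
rewrite /cone_prob -[in RHS](lam_inv ga go (measurable_cone z)).
by rewrite (cone_aut ga.2 gK lg go gyz).
Qed.

Lemma cone_prob_child x y : y \in children x ->
  cone_prob x = (q + (x == o))%:R * cone_prob y.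
Proof.
have intE z : (\int[lam]_(xi in bcone z) 1 = (cone_prob z)%:E)%E.
  by rewrite integral_cst; [rewrite mul1e; exact: cone_probE|exact: measurable_cone].
move=> yx; apply: EFin_inj; rewrite -intE integral_cone//.
under eq_bigr do rewrite intE.
rewrite sumEFin big_seq_cond (eq_bigr (fun=> cone_prob y)); last first.
  by move=> z /andP[zx _]; exact: (cone_prob_sibling zx yx).
by rewrite -big_seq_cond big_const_seq count_predT iter_addr_0 size_children mulr_natl.
Qed.

(** Off the root this is an equality, [cone_prob x] being the inverse of [(q + 1) q^(lev x - 1)];
    the root, with its extra child, gives the strict case. *)
Lemma cone_prob_ge x : q%:R <= q.+1%:R * (q%:R ^+ lev x * cone_prob x).
Proof.
elim/tree_ind: x => [|x xo IH].
  by rewrite lev_root cone_prob_root expr0 !mulr1 ler_nat.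
have xp : x \in children (parent x) by rewrite mem_children xo /=.
have [_ lx] := parentP xo; rewrite lx exprS.
have := cone_prob_child xp; have [po|po] := eqVneq (parent x) o.
  rewrite po lev_root cone_prob_root addn1 => E.
  by rewrite expr0 mulr1 mulrCA -E mulr1.
by rewrite addn0 => E; rewrite [q%:R * _]mulrC -[_ * cone_prob x]mulrA -E.
Qed.

Lemma cone_prob_ge_half x : 1 <= 2 * (q%:R ^+ lev x * cone_prob x).
Proof.
have := cone_prob_ge x.
have : 0 <= q%:R ^+ lev x * cone_prob x by rewrite mulr_ge0 ?exprn_ge0 ?fine_ge0 ?ler0n.
move: (_ * cone_prob x) => a a0 le; rewrite -(ler_pM2l (q_gt0 R T)) mulr1.
apply: le_trans le _; rewrite mulrA ler_wpM2r//.
by rewrite -natrM ler_nat muln2 -addnn -addn1 leq_add2l (leq_trans _ (tree_q_ge2 T)).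
Qed.

Lemma cone_prob_gt0 x : 0 < cone_prob x.
Proof.
have := cone_prob_ge_half x; rewrite lt_neqAle fine_ge0// andbT => h.
by apply: contraTneq h => <-; rewrite !mulr0 ler10.
Qed.

(** Read off from positive measure, without constructing a ray through [x]. *)
Lemma cone_neq0 x : @cone T x !=set0.
Proof.
apply/set0P/eqP => E; have := cone_prob_gt0 x.
by rewrite /cone_prob E measure0 ltxx.
Qed.

End BoundaryMeasure.

(** * Harmonic functions built from additive masses on cones *)

Section TreePotential.
Variables (R : realType) (T : homTree).
Local Notation o := (tree_root T).
Local Notation q := (tree_q T).
Local Notation Q := (q%:R : R).
Local Notation lev := (@tlevel T).
Implicit Types (x y z v : T) (f : T -> R).

Lemma sum_nbr f x : \sum_(y <- nbr x) f y =
  (if x == o then 0 else f (parent x)) + \sum_(y <- children x) f y.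
Proof.
have [->|xo] := eqVneq x o; first by rewrite nbr_root add0r.
by rewrite (perm_big _ (perm_nbr xo)) big_cons.
Qed.

Lemma tree_laplacianE f x :
  q.+1%:R * tree_laplacian f x = \sum_(y <- nbr x) f y - q.+1%:R * f x.
Proof.
rewrite /tree_laplacian mulrA divff ?pnatr_eq0// mul1r sumrB; congr (_ - _).
by rewrite big_const_seq count_predT iter_addr_0 nbr_size mulr_natl.
Qed.

Lemma tree_harmonic0 f : (forall x, \sum_(y <- nbr x) f y = q.+1%:R * f x) -> tree_harmonic f.
Proof.
move=> fE x; apply: (@mulfI _ q.+1%:R); first by rewrite pnatr_eq0.
by rewrite tree_laplacianE fE subrr mulr0.
Qed.

Lemma tree_harmonicZ (c : R) f : tree_harmonic f -> tree_harmonic (fun x => c * f x).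
Proof.
move=> fh; apply: tree_harmonic0 => x; rewrite -mulr_sumr mulrCA; congr (_ * _).
by apply/eqP; rewrite -subr_eq0 -tree_laplacianE fh mulr0.
Qed.

Variable m : T -> R.
Hypothesis m_children : forall x, m x = \sum_(y <- children x) m y.

(* [m] is a finitely additive boundary measure; [q ^- lev v * mass_sum v] is a
   multiple of its Poisson integral. *)
Fixpoint mass_sum_rec n v : R :=
  if n is n'.+1 then
    mass_sum_rec n' (parent v) + (Q ^+ n ^+ 2 - Q ^+ n' ^+ 2) * m v
  else m v.

Definition mass_sum v : R := mass_sum_rec (lev v) v.

Lemma mass_sum_root : mass_sum o = m o.
Proof. by rewrite /mass_sum lev_root. Qed.

Lemma mass_sumE v : v != o ->
  mass_sum v = mass_sum (parent v) + (Q ^+ (lev (parent v)).+1 ^+ 2 - Q ^+ lev (parent v) ^+ 2) * m v.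
Proof. by move=> vo; rewrite {1}/mass_sum; have [_ ->] := parentP vo. Qed.

Definition mass_potential v : R := Q ^- lev v * mass_sum v.

Lemma sum_children_potential x : \sum_(y <- children x) mass_potential y =
  Q ^- (lev x).+1 * ((q + (x == o))%:R * mass_sum x + (Q ^+ (lev x).+1 ^+ 2 - Q ^+ lev x ^+ 2) * m x).
Proof.
have -> : (q + (x == o))%:R * mass_sum x = \sum_(y <- children x) mass_sum x.
  by rewrite big_const_seq count_predT iter_addr_0 size_children mulr_natl.
rewrite [in X in _ = _ * (_ + _ * X)]m_children mulr_sumr -big_split/= mulr_sumr.
rewrite !big_seq; apply: eq_bigr => y yx.
rewrite /mass_potential (lev_child yx); congr (_ * _).
by move: yx; rewrite mem_children => /andP[/mass_sumE -> /eqP ->].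
Qed.

(** At level [n > 0] the increments of [mass_sum] make the terms in [m x] cancel: the children
    contribute [(q^(n+1) - q^(n-1)) m x], and the parent the opposite. What is left is
    [(q^-n + q^(1-n)) * mass_sum x]. *)
Lemma mass_potential_harmonic : tree_harmonic mass_potential.
Proof.
have q0 : Q != 0 by rewrite gt_eqF// q_gt0.
apply: tree_harmonic0 => x; rewrite sum_nbr sum_children_potential.
have [->|xo] := eqVneq x o.
  rewrite /mass_potential mass_sum_root lev_root expr0 expr1 addn1 -natr1.
  by move: Q q0 => r r0; field.
rewrite {2}/mass_potential {2}(mass_sumE xo) /mass_potential addn0.
have [_ ->] := parentP xo; set n := lev (parent x).
rewrite {1}(mass_sumE xo) -/n !(exprS _ n.+1) !(exprS _ n) -natr1.
have := expf_neq0 n q0; move: Q q0 (Q ^+ n) (mass_sum (parent x)) (m x) => r r0 e S a e0.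
by field; rewrite r0 e0.
Qed.

Lemma mass_sum_ge0 : (forall x, 0 <= m x) -> forall x, 0 <= mass_sum x.
Proof.
move=> m0; elim/tree_ind => [|x xo IH]; first by rewrite mass_sum_root.
rewrite mass_sumE// addr_ge0// mulr_ge0// subr_ge0 lerXn2r ?nnegrE ?exprn_ge0//.
by rewrite ler_weXn2l// ltW// q_gt1.
Qed.

(** Off the root only the last increment is kept; it contributes [(1 - q^-2) q^(lev x) m x], and
    [1 - q^-2 >= 3/4] as [q >= 2]. *)
Lemma mass_le_potential : (forall x, 0 <= m x) ->
  forall x, 3 * (Q ^+ lev x * m x) <= 4 * mass_potential x.
Proof.
have aux (a b : R) : 2 <= a -> b <= 2^-1 -> 3 * a <= 4 * (a - b) by lra.
move=> m0; elim/tree_ind => [|x xo _].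
  rewrite /mass_potential mass_sum_root lev_root expr0 invr1 !mul1r.
  by have := m0 o; lra.
have q0 := @q_gt0 R T.
have q2 : 2 <= Q by rewrite ler_nat tree_q_ge2.
have S0 := mass_sum_ge0 m0 (parent x).
rewrite /mass_potential (mass_sumE xo) mulrDr.
have [_ ->] := parentP xo; set n := lev (parent x).
have e0 : 0 < Q ^+ n by rewrite exprn_gt0.
apply: (@le_trans _ _ (4 * (Q ^- n.+1 * ((Q ^+ n.+1 ^+ 2 - Q ^+ n ^+ 2) * m x)))); last first.
  by rewrite ler_pM2l// lerDr mulr_ge0// ltW// expVq_gt0.
rewrite !(exprS _ n) !mulrA ler_wpM2r//.
rewrite [leRHS](_ : _ = Q ^+ n * (4 * (Q - Q^-1))); last first.
  by move: Q q0 {q2} (Q ^+ n) e0 => r r0 e e0; field; rewrite !gt_eqF.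
rewrite [leLHS](_ : _ = Q ^+ n * (3 * Q)); last by rewrite mulrC mulrCA.
rewrite ler_pM2l//.
by apply: aux => //; rewrite lef_pV2 ?posrE.
Qed.

End TreePotential.

Section TreeMajorant.
Variables (R : realType) (T : homTree) (lam : probability (borel_end T R) R).
Hypothesis lam_inv : aut_invariant lam.
Variables (A : set (tree_end T)) (Psi : R -> \bar R) (u : T -> R).
Hypothesis A0 : A !=set0.
Hypothesis HPsi : majorant_profile 1 Psi.
Local Notation lev := (@tlevel T).
Local Notation dE w := (dist_set (@tdist T R) w [set inr xi | xi in A]).
Hypothesis uPsi : forall x : T, ((u x)%:E <= Psi (dE (inl x)))%E.
Let F (xi : borel_end T R) := Psi (dE (inr xi)).
Hypothesis F_int : (\int[lam]_xi F xi < +oo)%E.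
Implicit Types (x y z v : T).

Let dE01 w : 0 <= dE w <= 1.
Proof. by rewrite dist_ends_ge0// dist_ends_le1. Qed.

Let F_ge0 xi : (0 <= F xi)%E.
Proof. exact: (profile_ge0 HPsi). Qed.

Let measurable_F : measurable_fun setT F.
Proof.
apply: (measurable_profile_comp (g := fun xi : borel_end T R => dE (inr xi)) HPsi) => //.
exact: measurable_dist_ends.
Qed.

Definition cone_mass x : R := fine (\int[lam]_(xi in cone x) F xi)%E.

Lemma cone_massE x : (\int[lam]_(xi in cone x) F xi)%E = (cone_mass x)%:E.
Proof.
rewrite fineK// ge0_fin_numE ?integral_ge0//.
apply: le_lt_trans F_int; apply: ge0_subset_integral => //.
exact: measurable_cone.
Qed.

Lemma cone_mass_ge0 x : 0 <= cone_mass x.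
Proof. by rewrite fine_ge0// integral_ge0. Qed.

Lemma cone_mass_children x : cone_mass x = \sum_(y <- children x) cone_mass y.
Proof.
apply: EFin_inj; rewrite -cone_massE integral_cone//.
by under eq_bigr do rewrite cone_massE; rewrite sumEFin.
Qed.

Lemma le_cone_mass x : u x * cone_prob lam x <= cone_mass x.
Proof.
have [u0|u0] := leP (u x) 0.
  apply: le_trans (cone_mass_ge0 x); rewrite mulr_le0_ge0//.
  exact/ltW/cone_prob_gt0.
rewrite -lee_fin -cone_massE EFinM -(cone_probE lam) -integral_cst; last exact: measurable_cone.
apply: ge0_le_integral => //; first exact: measurable_cone.
- by move=> xi _; rewrite lee_fin ltW.
- exact: measurable_funTS.
- move=> xi cx; apply: le_trans (uPsi x) _.
  by apply: (profile_decr HPsi); [exact: dist_ends_ge0|exact: dist_ends_cone|exact: dist_ends_le1].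
Qed.

Lemma tree_harmonic_majorant : exists h, tree_harmonic h /\ forall x, u x <= h x.
Proof.
(* The factor [4/3] comes from [mass_le_potential], the factor [2] from [cone_prob_ge_half]. *)
exists (fun x => 8 / 3 * mass_potential cone_mass x); split.
  exact/tree_harmonicZ/mass_potential_harmonic/cone_mass_children.
move=> x; have := mass_le_potential cone_mass_ge0 x.
have := le_cone_mass x; have := cone_prob_ge_half lam_inv x.
have := cone_mass_ge0 x.
have : 0 < (tree_q T)%:R ^+ lev x :> R by rewrite exprn_gt0// q_gt0.
move: (_ ^+ _) (mass_potential _ _) (cone_prob _ _) (cone_mass x) (u x).
move=> e h p a b e0 a0 ep bp eh.
have ea0 : 0 <= e * a by rewrite mulr_ge0// ltW.
have [b0|b0] := leP b 0; first by lra.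
have : b <= 2 * (e * p) * b by rewrite ler_peMl// ltW.
have : e * (b * p) <= e * a by rewrite ler_pM2l.
lra.
Qed.

End TreeMajorant.

(** * The first moment on the tree *)

Section TreeMoment.
Variables (R : realType) (T : homTree).
Local Notation o := (tree_root T).
Local Notation q := (tree_q T).
Local Notation Q := (q%:R : R).
Local Notation lev := (@tlevel T).
Implicit Types (x y z : T) (f : T -> R).

Fixpoint sphere n : seq T :=
  if n is n'.+1 then flatten [seq children x | x <- sphere n'] else [:: o].

Lemma mem_sphere n x : (x \in sphere n) = (lev x == n).
Proof.
elim: n x => [|n IH] x /=; first by rewrite inE lev_eq0.
apply/flattenP/eqP => [[_ /mapP[y + ->] /lev_child ->]|lx].
  by rewrite IH => /eqP ->.
have xo : x != o by rewrite -lev_eq0 lx.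
exists (children (parent x)); last by rewrite mem_children xo /=.
by apply: map_f; rewrite IH lev_parent lx.
Qed.

Lemma sum_sphere f n : \sum_(x <- sphere n.+1) f x =
  \sum_(x <- sphere n) \sum_(y <- children x) f y.
Proof. by rewrite big_flatten big_map. Qed.

Lemma sum_sphere_parent f n : \sum_(x <- sphere n.+1) f (parent x) =
  (q + (n == 0))%:R * \sum_(x <- sphere n) f x.
Proof.
rewrite sum_sphere mulr_sumr !big_seq; apply: eq_bigr => x; rewrite mem_sphere => /eqP lx.
rewrite -lx lev_eq0 -size_children mulr_natl -iter_addr_0 -(count_predT (children x)).
rewrite -big_const_seq !big_seq; apply: eq_bigr => y.
by rewrite mem_children => /andP[_ /eqP ->].
Qed.

Variable v : T -> R.
Hypothesis v_sub : tree_subharmonic v.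
Hypothesis v_le0 : forall x, v x <= 0.

Let S n := \sum_(x <- sphere n) v x.
Let D n := \sum_(x <- sphere n) q.+1%:R * tree_laplacian v x.

Let S_le0 n : S n <= 0.
Proof. exact: sumr_le0. Qed.

Let D_ge0 n : 0 <= D n.
Proof. by apply: sumr_ge0 => x _; rewrite mulr_ge0. Qed.

(** Discrete divergence theorem: the inner edges cancel and only the flux from level [n] to level
    [n.+1] remains. *)
Let sum_DE n : \sum_(i < n.+1) D i = S n.+1 - (q + (n == 0))%:R * S n.
Proof.
have DE k : D k = \sum_(x <- sphere k) (if x == o then 0 else v (parent x)) +
    S k.+1 - q.+1%:R * S k.
  rewrite /D; under eq_bigr do rewrite tree_laplacianE sum_nbr.
  by rewrite sumrB big_split/= -mulr_sumr -sum_sphere.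
elim: n => [|n IH].
  by rewrite big_ord1 DE big_seq1 eqxx add0r addn1.
rewrite big_ord_recr/= IH DE addn0.
rewrite [X in _ + (X + _ - _)](_ : _ = (q + (n == 0))%:R * S n); last first.
  rewrite -sum_sphere_parent !big_seq; apply: eq_bigr => x; rewrite mem_sphere => /eqP lx.
  by rewrite -lev_eq0 lx.
by rewrite -natr1; ring.
Qed.

(* Summation by parts; the weights vanish at level [N.+1], so only the sign of
   [S N.+1] will matter. *)
Let weighted_sumE N : \sum_(n < N.+1) (Q ^- n - Q ^- N.+1) * D n =
  (Q - 1) * Q ^- N.+1 * S N.+1 + q.+1%:R * (Q^-1 - 1) * S 0.
Proof.
have q0 : Q != 0 by rewrite gt_eqF// q_gt0.
elim: N => [|N IH].
  have := sum_DE 0; rewrite !big_ord1 /= addn1 expr0 expr1 => ->.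
  by move: (q.+1%:R) Q q0 (S 0) (S 1) => c r r0 a b; field.
rewrite (eq_bigr (fun n : 'I_N.+2 => (Q ^- n - Q ^- N.+1) * D n +
  (Q ^- N.+1 - Q ^- N.+2) * D n)); last by move=> i _; rewrite -mulrDl subrKA.
rewrite big_split/= big_ord_recr/= subrr mul0r addr0 IH -mulr_sumr sum_DE addn0.
rewrite !(exprS _ N.+1).
have := expf_neq0 N.+1 q0.
move: q.+1%:R Q q0 (Q ^+ N.+1) (S N.+1) (S N.+2) (S 0) => c r r0 e a b s e0.
by field; rewrite r0 e0.
Qed.

Lemma sphere_sum_bounded : exists C, forall N,
  \sum_(n < N) Q ^- n * \sum_(x <- sphere n) tree_laplacian v x <= C.
Proof.
have q0 : 0 < Q by exact: q_gt0.
have qV : Q^-1 <= 2^-1 by rewrite lef_pV2 ?posrE// ler_nat tree_q_ge2.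
exists (2 * (q.+1%:R * (Q^-1 - 1) * S 0)) => N.
case: N => [|N].
  rewrite big_ord0 mulr_ge0// mulr_le0// mulr_ge0_le0// subr_le0.
  by apply: le_trans qV _; rewrite invf_le1// ler1n.
(* For [n <= N] the subtracted [q^-(N+1)] is at most half of [q^-n], as [q >= 2]; hence the factor
   [2], also present in the bound. *)
have bound (n : 'I_N.+1) : Q ^- n * \sum_(x <- sphere n) tree_laplacian v x <=
    2 * ((Q ^- n - Q ^- N.+1) * D n).
  rewrite mulrA; apply: ler_pM.
  - exact/ltW/expVq_gt0.
  - by apply: sumr_ge0 => x _; exact: v_sub.
  - have : Q ^- N.+1 <= Q ^- n.+1 by rewrite expVq_le.
    have : Q ^- n.+1 <= 2^-1 * Q ^- n by rewrite exprS invfM ler_wpM2r// ltW// expVq_gt0.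
    move: (Q ^- N.+1) (Q ^- n.+1) (Q ^- n) => a b c; lra.
  - by rewrite /D -mulr_sumr ler_peMl ?ler1n// sumr_ge0// => x _; exact: v_sub.
apply: le_trans (ler_sum _ (fun n _ => bound n)) _.
rewrite -mulr_sumr ler_pM2l// weighted_sumE gerDr mulr_ge0_le0//.
by rewrite mulr_ge0 ?subr_ge0 ?ltW ?q_gt1 ?expVq_gt0.
Qed.

End TreeMoment.

Section TreeRieszMoment.
Variables (R : realType) (T : homTree) (u h : T -> R).
Variable mu : {measure set (discrete_tree T) -> \bar R}.
Local Notation Q := ((tree_q T)%:R : R).
Local Notation lev := (@tlevel T).
Local Notation dB x := (dist_set (@tdist T R) (inl x) (range inr)).
Hypothesis u_sub : tree_subharmonic u.
Hypothesis h_harm : tree_harmonic h.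
Hypothesis uh : forall x, u x <= h x.
Hypothesis mu_u : tree_riesz u mu.
Hypothesis cone0 : forall x : T, @cone T x !=set0.

Lemma measurable_discrete (X : set (discrete_tree T)) : measurable X.
Proof. exact: sub_sigma_algebra. Qed.

Let mlev n : set (discrete_tree T) := [set x | lev (x : T) == n].

Let lap_sub x : tree_laplacian (fun x => u x - h x) x = tree_laplacian u x.
Proof.
have qn0 : (tree_q T).+1%:R != 0 :> R by rewrite pnatr_eq0.
apply: (mulfI qn0); rewrite !tree_laplacianE sumrB.
have := tree_laplacianE h x; rewrite h_harm mulr0 => /esym/subr0_eq ->.
by rewrite mulrBr opprB addrA subrK.
Qed.

(** An upper bound is all that the moment requires, so the atoms are added by subadditivity along
    the list. *)
Let mu_mlev n : (mu (mlev n) <= (\sum_(x <- sphere T n) tree_laplacian u x)%:E)%E.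
Proof.
have -> : mlev n = [set` sphere T n].
  by apply/seteqP; split => x; rewrite /mlev/= mem_sphere.
elim: (sphere T n) => [|x s IH]; first by rewrite set_nil measure0 big_nil.
rewrite [X in mu X](_ : _ = [set x] `|` [set` s]); last first.
  by apply/seteqP; split => y /=; rewrite inE => /predU1P.
rewrite big_cons EFinD.
apply: le_trans (measureU2 _ _ _) _; try exact: measurable_discrete.
by apply: leeD IH; rewrite le_eqVlt; apply/predU1P; left; exact: mu_u.
Qed.

Lemma tree_riesz_first_moment : (\int[mu]_x (dB x)%:E < +oo)%E.
Proof.
have v_sub : tree_subharmonic (fun x => u x - h x) by move=> x; rewrite lap_sub.
have v_le0 x : u x - h x <= 0 by rewrite subr_le0.
have [C HC] := sphere_sum_bounded v_sub v_le0.
have dB0 x : (0 <= (dB x)%:E)%E.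
  rewrite lee_fin; apply: dist_set_ge => [|w _]; last exact: tdist_ge0.
  by have [xi _] := cone0 x; exists (inr xi), xi.
have mf (D : set (discrete_tree T)) (f : discrete_tree T -> \bar R) : measurable_fun D f.
  by move=> _ B _; exact: measurable_discrete.
have cover : setT = \bigcup_n mlev n.
  by apply/seteqP; split => // x _; exists (lev x) => //=; rewrite /mlev/= eqxx.
apply: (@le_lt_trans _ _ C%:E); last by rewrite ltry.
rewrite cover ge0_integral_bigcup//; last 2 first.
- by move=> n; exact: measurable_discrete.
- by move=> i j _ _ [x [/= /eqP <- /eqP <-]].
apply: lime_le; first by apply: is_cvg_nneseries => n _ _; exact: integral_ge0.
near=> N; apply: le_trans (_ : (_ <= (\sum_(0 <= n < N) Q ^- n *
  \sum_(x <- sphere T n) tree_laplacian u x)%:E)%E) _.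
  rewrite -sumEFin; apply: lee_sum => n _.
  apply: (@le_trans _ _ (\int[mu]_(x in mlev n) (Q ^- n)%:E)%E).
    apply: ge0_le_integral => //; first exact: measurable_discrete.
    by move=> x /= /eqP <-; rewrite lee_fin dist_boundary_le.
  rewrite integral_cst; last exact: measurable_discrete.
  by rewrite EFinM; apply: lee_wpmul2l; [rewrite lee_fin ltW// expVq_gt0|exact: mu_mlev].
rewrite lee_fin big_mkord; apply: le_trans (HC N); rewrite le_eqVlt; apply/predU1P; left; apply: eq_bigr => n _.
by congr (_ * _); apply: eq_bigr => x _; rewrite lap_sub.
Unshelve. all: by end_near. Qed.

End TreeRieszMoment.

Theorem theorem3p3 (R : realType) :
  (forall (u : R * R -> \bar R) (Psi : R -> \bar R),
    let E := disk_blowup u in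
    let dE := fun x => dist_set (@cdist R) x E in
    disk_subharmonic u ->
    E !=set0 ->
    majorant_profile 2 Psi ->
    (forall x, disk x -> (u x <= Psi (dE x))%E) ->
    (\int[@arc_measure R]_(xi in @circle R) Psi (dE xi) < +oo)%E ->
    (exists h, disk_harmonic h /\ forall x, disk x -> (u x <= (h x)%:E)%E) /\
    (forall mu : {measure set (measurableTypeR R * measurableTypeR R) -> \bar R},
      disk_riesz u mu ->
      (\int[mu]_(x in @disk R) (dist_set (@cdist R) x (@circle R))%:E < +oo)%E))
  /\
  (forall (T : homTree) (u : T -> R) (Psi : R -> \bar R)
      (lam : probability (borel_end T R) R),
    let E : set (tree_bar T) := [set inr xi | xi in tree_blowup u] in
    let dE := fun x : tree_bar T => dist_set (@tdist T R) x E in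
    aut_invariant lam ->
    tree_subharmonic u ->
    E !=set0 ->
    majorant_profile 1 Psi ->
    (forall x : T, ((u x)%:E <= Psi (dE (inl x)))%E) ->
    (\int[lam]_xi Psi (dE (inr xi)) < +oo)%E ->
    (exists h, tree_harmonic h /\ forall x : T, u x <= h x) /\
    (forall mu : {measure set (discrete_tree T) -> \bar R},
      tree_riesz u mu ->
      (\int[mu]_x (dist_set (@tdist T R) (inl x) (range inr))%:E < +oo)%E)).
Proof.
split=> [u Psi E dE u_sub E0 HPsi uPsi Psi_int|T u Psi lam E dE lam_inv u_sub E0 HPsi uPsi Psi_int].
  have EC : E `<=` @circle R by move=> xi [].
  have [h [hh uh]] := disk_harmonic_majorant E0 EC HPsi uPsi Psi_int.
  split; first by exists h.
  move=> mu mu_u; apply: (riesz_first_moment (u := u) (h := h)) => //.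
  exact: (dsub_usc u_sub).
have A0 : tree_blowup u !=set0 by have [_ [xi uxi _]] := E0; exists xi.
have [h [hh uh]] := tree_harmonic_majorant lam_inv A0 HPsi uPsi Psi_int.
split; first by exists h.
move=> mu mu_u; apply: (tree_riesz_first_moment (u := u) (h := h)) => //.
exact: (cone_neq0 lam_inv).
Qed.
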